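(* Let $\mathcal H$ be any Birkhoff decomposable subgroup of $\Lambda G$, let $\tau$ be an involution of the second kind of $\mathcal H$, let $U$ be a manifold, and let $b$ be an extended integer greater than zero. Given an element $$F_+\in\mathcal B^\tau_-\mathcal H(U)_{-\infty}^b,$$ there exists a unique element $$[F]\in\frac{\mathcal H_\tau}{\mathcal H_\tau^\circ}(U)_{-b}^b$$ such that for any local frame for $[F]$, that is, an element $F\in\mathcal H_\tau(W)_{-b}^b$ which represents $[F](t)$ for all $t\in W\subset U$, one has the decomposition $$F=F_+\,F_-=\tau F_+\;\tau F_-$$ for some $F_-\in\mathcal H^-(W)$. Moreover, if $F_+$ is based at $t_0$, then $F$ and $F_-$ can be chosen to be based at $t_0$ also.
   Context: Loop groups. $G$ is a connected complex semisimple matrix Lie group, with a matrix norm satisfying $\|AB\|\le\|A\|\|B\|$, $\|I\|=1$. $\Lambda G$ is the Banach Lie group of maps $g=\sum_{i\in\mathbb Z} g_i\lambda^i:\mathbb S^1\to G$ with $\|g\|:=\sum\|g_i\|<\infty$. $\mathbb D_+$ is the open unit disc and $\mathbb D_-$ the complement of its closure in the Riemann sphere; $\Lambda^\pm G$ is the subgroup of loops extending holomorphically to maps $\mathbb D_\pm\to G$; $\Lambda^+_1G$ (resp. $\Lambda^-_1G$) is the subgroup of $\Lambda^+G$ (resp. $\Lambda^-G$) of loops with $g(0)=I$ (resp. $g(\infty)=I$). All subgroups of $\Lambda G$ are assumed to be Banach Lie subgroups (closed submanifolds with the induced topology). For a subgroup $\mathcal H\subset\Lambda G$: $\mathcal H^\pm=\mathcal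 H\cap\Lambda^\pm G$, $\mathcal H_1^\pm=\mathcal H\cap\Lambda_1^\pm G$, and $\mathcal H^\circ=\mathcal H\cap\Lambda^+G\cap\Lambda^-G=\mathcal H\cap G$ (constant loops). $(X)_I$ is the identity component of $X$. Birkhoff decomposability. A Banach Lie group $\mathcal H$ together with connected Banach Lie subgroups $\mathcal H_1^{\pm}$ and $\mathcal H^\circ$ is called Birkhoff decomposable if $\mathcal{RB}\mathcal H:=\mathcal H_1^+\cdot\mathcal H^\circ\cdot\mathcal H_1^-$ and $\mathcal{LB}\mathcal H:=\mathcal H_1^-\cdot\mathcal H^\circ\cdot\mathcal H_1^+$ are open and dense in $(\mathcal H)_I$ and the multiplication maps $\mathcal H_1^+\times\mathcal H^\circ\times\mathcal H_1^-\to\mathcal{RB}\mathcal H$ and $\mathcal H_1^-\times\mathcal H^\circ\times\mathcal H_1^+\to\mathcal{LB}\mathcal H$ are analytic diffeomorphisms. A Banach Lie subgroup $\mathcal H\subset\Lambda G$ is a Birkhoff decomposable subgroup if the identity components of $\mathcal H\cap\Lambda_1^+G$, $\mathcal H\cap\Lambda_1^-G$ and $\mathcal H\cap\Lambda^+G\cap\Lambda^-G$ are closed Banach Lie subgroups and make $\mathcal H$ a Birkhoff decomposable group. Automorphisms. All automorphisms are assumed to have the form $(\phi x)(\lambda)=\phi_0(x(e^{2k\pi i/m}\lambda^j))$ with $\phi_0$ a finite order automorphism of $G$, $m$ the order of $\phi$, $k\in\mathbb Z$, $j=\pm1$ (complex linear case), or, for anti-linear involutions, $(\rho x)(\lambda)=\rho_0(x(\varepsilon\bar\lambda^{\,j}))$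 with $\rho_0$ an anti-linear involution of $G$, $\varepsilon,j\in\{1,-1\}$. They are of the first kind if $j=1$ and of the second kind if $j=-1$. $\mathcal H_\tau$ is the fixed point subgroup of $\tau$ in $\mathcal H$, and $\mathcal H_\tau^\circ$ the subgroup of constant loops in $\mathcal H_\tau$. Connection order. $\mathcal H(U)$ is the set of smooth maps $F:U\to\mathcal H$; similarly $\mathcal H^-(W)$, $\mathcal H_\tau(W)$. $F$ is based at $t_0$ if $F(t_0)=I$. For extended integers $a\le b$, $\mathcal H(U)_a^b$ is the set of $F\in\mathcal H(U)$ of connection order $(_a^b)$, i.e. whose Maurer-Cartan form has Fourier expansion $F^{-1}\mathrm dF=\sum_{i=a}^b A_i\lambda^i$. The Iwasawa big cell is $\mathcal B^\tau_-\mathcal H:=\mathcal H_\tau\cdot\mathcal H^-$, and $\mathcal B^\tau_-\mathcal H(U)_a^b$ is the set of $F\in\mathcal H(U)_a^b$ with values in $\mathcal B^\tau_-\mathcal H$. $\frac{\mathcal H_\tau}{\mathcal H_\tau^\circ}(U)_{-b}^b$ is the set of smooth maps $[F]:U\to\mathcal H_\tau/\mathcal H_\tau^\circ$ (cosets under right multiplication by $\mathcal H^\circ_\tau$) whose local lifts to $\mathcal H_\tau$ are of connection order $(_{-b}^b)$. *)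

(* Defs.v *)
From HB Require Import structures.
From mathcomp Require Import all_boot all_order all_algebra.
From mathcomp Require Import all_classical all_reals all_analysis.
From mathcomp Require Import complex.

Set Implicit Arguments.
Unset Strict Implicit.
Unset Printing Implicit Defensive.
Import Order.TTheory GRing.Theory Num.Theory.
Import numFieldNormedType.Exports.
Local Open Scope classical_set_scope.
Local Open Scope ring_scope.

(* R[i] declared as an abstract numClosedFieldType: its topology and that of
   matrices over it are then found by MathComp-Analysis. *)
Definition Cx (R : realType) : numClosedFieldType := R[i].

Definition real_cx (R : realType) (t : R) : Cx R := (t%:C)%C.

Record matnorm (R : realType) (n : nat) := MatNorm {
  mnorm :> 'M[Cx R]_n -> R;
  mnorm_eq0 : forall A, mnorm A = 0 -> A = 0;
  mnormD : forall A B, mnorm (A + B) <= mnorm A + mnorm B;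
  mnormZ : forall (a : Cx R) A,
    real_cx (mnorm (a *: A)) = `|a| * real_cx (mnorm A);
  mnormM : forall A B, mnorm (A *m B) <= mnorm A * mnorm B;
  mnorm1 : mnorm 1%:M = 1 }.

Section WienerSpace.
Context (R : realType) (n : nat) (N : matnorm R n).
Implicit Types a b : int -> 'M[Cx R]_n.

Lemma mnorm0 : N 0 = 0.
Proof.
have := mnormZ N 0 0; rewrite scaler0 normr0 mul0r => /eqP.
by rewrite /real_cx (eq_complex (_%:C)%C 0) /= => /andP[/eqP].
Qed.

Lemma mnormZr (t : R) A : N (real_cx t *: A) = `|t| * N A.
Proof.
apply: (@complexI R); have /= := mnormZ N (real_cx t) A.
by rewrite /real_cx => ->; rewrite normc_def /= expr0n addr0 sqrtr_sqr rmorphM.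
Qed.

Lemma mnormN A : N (- A) = N A.
Proof.
have := mnormZr (-1) A; rewrite normrN1 mul1r => <-; congr (N _).
by rewrite /real_cx rmorphN rmorph1 scaleN1r.
Qed.

Lemma mnorm_ge0 A : 0 <= N A.
Proof.
have := mnormD N A (- A); rewrite subrr mnorm0 mnormN.
by rewrite -mulr2n pmulrn_lge0.
Qed.



Lemma esumZ (T : choiceType) (t : R) (a : T -> \bar R) :
  0 <= t -> (forall i, (0 <= a i)%E) ->
  esum setT (fun i => (t%:E * a i)%E) = (t%:E * esum setT a)%E.
Proof.
move=> t0 a0; rewrite /esum -ereal_supZl//.
- rewrite image_comp; congr ereal_sup; apply: eq_imagel => A [finA _] /=.
  by rewrite ge0_mule_fsumr.
- by apply/set0P; exists (\sum_(x \in set0) a x)%E; exists set0 => //; split.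
Qed.

Definition abs_summable a : bool := (\esum_(i in [set: int]) (N (a i))%:E < +oo)%E.

(* A loop \sum_k x_k lambda^k on the unit circle is encoded by its Fourier
   coefficients x : int -> 'M_n. *)
Record wiener := Wiener { coef :> int -> 'M[Cx R]_n; _ : abs_summable coef }.
HB.instance Definition _ := [isSub for coef].
HB.instance Definition _ := [Choice of wiener by <:].

Lemma wienerP (x : wiener) : abs_summable x.
Proof. by case: x. Qed.

Lemma abs_summable0 : abs_summable (fun=> 0).
Proof. by rewrite /abs_summable esum1// => i _; rewrite mnorm0. Qed.

Lemma abs_summableD a b : abs_summable a -> abs_summable b ->
  abs_summable (fun i => a i + b i).
Proof.
move=> sa sb; apply: (@le_lt_trans _ _
  (\esum_(i in [set: int]) ((N (a i))%:E + (N (b i))%:E))%E).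
  by apply: le_esum => i _; rewrite -EFinD lee_fin mnormD.
by rewrite esumD ?lte_add_pinfty// => i _; rewrite lee_fin mnorm_ge0.
Qed.

Lemma abs_summableZ (t : R) a : abs_summable a ->
  abs_summable (fun i => real_cx t *: a i).
Proof.
move=> sa; rewrite /abs_summable; under eq_esum do rewrite mnormZr EFinM.
rewrite esumZ// => [|i]; last by rewrite lee_fin mnorm_ge0.
by rewrite lte_mul_pinfty// ?fin_numE.
Qed.

Lemma abs_summableN a : abs_summable a -> abs_summable (fun i => - a i).
Proof. by move=> sa; rewrite /abs_summable; under eq_esum do rewrite mnormN. Qed.

Fact wiener_zmod_closed :
  zmod_closed abs_summable.
Proof.
split=> [|a b sa sb]; first exact: abs_summable0.
exact: (abs_summableD sa (abs_summableN sb)).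
Qed.
HB.instance Definition _ := GRing.isZmodClosed.Build (int -> 'M[Cx R]_n)
  abs_summable wiener_zmod_closed.
HB.instance Definition _ := [SubChoice_isSubZmodule of wiener by <:].

Lemma wienerE (x y : wiener) : (forall k, x k = y k) -> x = y.
Proof. by move=> xy; apply/val_inj/funext. Qed.

Definition wscale (t : R) (x : wiener) : wiener :=
  Wiener (abs_summableZ t (wienerP x)).

Fact wscaleA s t x : wscale s (wscale t x) = wscale (s * t) x.
Proof. by apply: wienerE => k /=; rewrite scalerA /real_cx rmorphM. Qed.
Fact wscale1 : left_id 1 wscale.
Proof. by move=> x; apply: wienerE => k /=; rewrite /real_cx rmorph1 scale1r. Qed.
Fact wscaleDr : right_distributive wscale +%R.
Proof. by move=> t x y; apply: wienerE => k /=; rewrite -scalerDr. Qed.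
Fact wscaleDl x : {morph wscale^~ x : s t / s + t}.
Proof. by move=> s t; apply: wienerE => k /=; rewrite /real_cx rmorphD scalerDl. Qed.
HB.instance Definition _ := GRing.Zmodule_isLmodule.Build R wiener
  wscaleA wscale1 wscaleDr wscaleDl.

Definition wnorm (x : wiener) : R := fine (\esum_(i in [set: int]) (N (x i))%:E)%E.

Fact wnormE x : (wnorm x)%:E = (\esum_(i in [set: int]) (N (x i))%:E)%E.
Proof.
rewrite fineK// ge0_fin_numE; first exact: wienerP.
by apply: esum_ge0 => i _; rewrite lee_fin mnorm_ge0.
Qed.
Fact wnormD x y : wnorm (x + y) <= wnorm x + wnorm y.
Proof.
rewrite -lee_fin EFinD !wnormE -esumD; try by move=> i _; rewrite lee_fin mnorm_ge0.
by apply: le_esum => i _; rewrite -EFinD lee_fin mnormD.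
Qed.
Fact wnormZ (t : R) x : wnorm (t *: x) = `|t| * wnorm x.
Proof.
apply: EFin_inj; rewrite EFinM !wnormE -esumZ//; last first.
  by move=> i; rewrite lee_fin mnorm_ge0.
by apply: eq_esum => i _; rewrite mnormZr EFinM.
Qed.
Fact wnorm_eq0 x : wnorm x = 0 -> x = 0.
Proof.
move=> x0; apply: wienerE => k; apply: (mnorm_eq0 (m := N)); apply/eqP.
rewrite eq_le mnorm_ge0 andbT -lee_fin -x0 wnormE.
apply: esum_ge; exists [set k]; first by split.
by rewrite fsbig_set1.
Qed.
HB.instance Definition _ := Lmodule_isNormed.Build R wiener wnormD wnormZ wnorm_eq0.

End WienerSpace.

Section MatrixSeries.
Context (R : realType) (n : nat) (N : matnorm R n).

(* Bilateral series, summed along the partial sums over [-m, m). *)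
Definition zsum (f : int -> 'M[Cx R]_n) : 'M[Cx R]_n :=
  limn (series (fun k : nat => f (Posz k) + f (Negz k))).

Lemma cx_normE (z : Cx R) : `|z| = real_cx (complex.Re `|z|).
Proof. by rewrite /real_cx [`|z|]normc_def. Qed.

Lemma cx_norm_le (z : Cx R) :
  complex.Re `|z| <= `|complex.Re z| + `|complex.Im z|.
Proof.
rewrite [`|z|]normc_def /= -[leRHS]ger0_norm ?addr_ge0// -sqrtr_sqr ler_wsqrtr//.
by rewrite sqrrD !real_normK ?num_real// lerD2r lerDl mulrn_wge0 ?mulr_ge0.
Qed.

Lemma Re_le_cx_norm (z : Cx R) : `|complex.Re z| <= complex.Re `|z|.
Proof. by rewrite [`|z|]normc_def /= -sqrtr_sqr ler_wsqrtr// lerDl sqr_ge0. Qed.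

Lemma Im_le_cx_norm (z : Cx R) : `|complex.Im z| <= complex.Re `|z|.
Proof. by rewrite [`|z|]normc_def /= -sqrtr_sqr ler_wsqrtr// lerDr sqr_ge0. Qed.

Lemma mnormZc (a : Cx R) A : N (a *: A) = complex.Re `|a| * N A.
Proof.
by apply: (@complexI R); have := mnormZ N a A; rewrite cx_normE /real_cx -rmorphM.
Qed.

Lemma mnorm_sum (I : Type) (r : seq I) (P : pred I) (F : I -> 'M[Cx R]_n) :
  N (\sum_(i <- r | P i) F i) <= \sum_(i <- r | P i) N (F i).
Proof.
elim/big_ind2: _ => [|x1 x2 y1 y2 h1 h2|//]; first by rewrite mnorm0.
by rewrite (le_trans (mnormD _ _ _))// lerD.
Qed.

Lemma mnorm_entry (A : 'M[Cx R]_n) p q : complex.Re `|A p q| <= N (delta_mx q p) * N A.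
Proof.
have d0 : 0 < N (delta_mx p p).
  rewrite lt_neqAle mnorm_ge0 andbT eq_sym; apply/eqP => /(mnorm_eq0).
  by move/matrixP => /(_ p p)/eqP; rewrite !mxE !eqxx oner_eq0.
rewrite -(ler_pM2r d0) -mnormZc.
have -> : A p q *: delta_mx p p = delta_mx p p *m A *m delta_mx q p.
  apply/matrixP => i j; rewrite !mxE (bigD1 q)//= big1 ?addr0.
    rewrite !mxE (bigD1 p)//= big1 ?addr0 ?mxE ?eqxx ?andbT.
      by case: (i == p); case: (j == p); rewrite ?(mulr1, mulr0, mul1r, mul0r).
    by move=> k kp; rewrite mxE (negbTE kp) andbF mul0r.
  by move=> k kq; rewrite [X in _ * X]mxE (negbTE kq) mulr0.
rewrite (le_trans (mnormM _ _ _))//.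
rewrite mulrC -mulrA ler_wpM2l ?mnorm_ge0// mulrC; exact: mnormM.
Qed.

Lemma mnorm_le_entries (A : 'M[Cx R]_n) : N A <= \sum_p \sum_q
  complex.Re `|A p q| * N (delta_mx p q).
Proof.
rewrite {1}(matrix_sum_delta A) (le_trans (mnorm_sum _ _ _))// ler_sum// => p _.
rewrite (le_trans (mnorm_sum _ _ _))// ler_sum// => q _.
by rewrite mnormZc.
Qed.

End MatrixSeries.

Section MatrixSeriesConvergence.
Context (R : realType) (n : nat) (N : matnorm R n).

Lemma cx_gt0 (e : R[i]) : 0 < e -> e = (complex.Re e)%:C%C /\ 0 < complex.Re e.
Proof. by case: e => x y; rewrite ltcE /= => /andP[/eqP -> ?]. Qed.

Lemma cx_ReB (x y : Cx R) : complex.Re (x - y) = complex.Re x - complex.Re y.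
Proof. exact: (raddfB (@complex.Re R)). Qed.

Lemma cx_ImB (x y : Cx R) : complex.Im (x - y) = complex.Im x - complex.Im y.
Proof. exact: (raddfB (@complex.Im R)). Qed.

Lemma cvg_mx_ReIm (S : nat -> 'M[Cx R]_n) (L : 'M[Cx R]_n) :
  (forall p q, (fun k => complex.Re (S k p q)) @ \oo --> complex.Re (L p q)) ->
  (forall p q, (fun k => complex.Im (S k p q)) @ \oo --> complex.Im (L p q)) ->
  S @ \oo --> L.
Proof.
move=> cRe cIm; apply/cvg_ballP => e e0.
have [e_real {}e0] := @cx_gt0 e e0.
have e20 : 0 < complex.Re e / 2 by rewrite divr_gt0.
suff: \forall k \near \oo, forall p q : 'I_n,
    `|complex.Re (L p q) - complex.Re (S k p q)| < complex.Re e / 2 /\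
    `|complex.Im (L p q) - complex.Im (S k p q)| < complex.Re e / 2.
  apply: filterS => k h; split; first by rewrite e_real ltcR.
  move=> p q; have [h1 h2] := h p q.
  rewrite -ball_normE /ball_ /= cx_normE e_real ltcR.
  rewrite (le_lt_trans (cx_norm_le _))// [ltRHS](splitr (complex.Re e)) ltrD//.
    by rewrite cx_ReB.
  by rewrite cx_ImB.
apply: filter_forall => p; apply: filter_forall => q.
near=> k; split; near: k.
  by move/cvgrPdist_lt : (cRe p q); exact.
by move/cvgrPdist_lt : (cIm p q); exact.
Unshelve. all: by end_near. Qed.

Lemma le_esum_int (g : int -> R) m : (forall i, 0 <= g i) ->
  ((\sum_(0 <= k < m) (g (Posz k) + g (Negz k)))%:E <=
   \esum_(i in [set: int]) (g i)%:E)%E.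
Proof.
move=> g0; set r := [seq Posz k | k <- index_iota 0 m] ++
  [seq Negz k | k <- index_iota 0 m].
have ur : uniq r.
  rewrite cat_uniq !map_inj_uniq ?iota_uniq ?andbT/=; last 2 first.
  - by move=> ? ? [].
  - by move=> ? ? [].
  by apply/hasPn => _ /mapP[k _ ->]; apply/mapP => -[].
apply: esum_ge; exists [set` r]; first by split=> [|//]; exact: finite_seq.
by rewrite -fsbig_seq// big_cat/= !big_map !sumEFin -EFinD -big_split.
Qed.

Lemma zsum_term_le (f : int -> 'M[Cx R]_n) k p q :
  complex.Re `|(f (Posz k) + f (Negz k)) p q| <=
  N (delta_mx q p) * (N (f (Posz k)) + N (f (Negz k))).
Proof.
rewrite (le_trans (mnorm_entry N _ _ _))// ler_wpM2l ?mnorm_ge0//; exact: mnormD.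
Qed.

Lemma cvg_zsum f : abs_summable N f ->
  series (fun k : nat => f (Posz k) + f (Negz k)) @ \oo --> zsum f.
Proof.
move=> sf.
set u := fun k : nat => f (Posz k) + f (Negz k).
set B := fine (\esum_(i in [set: int]) (N (f i))%:E)%E.
have BE : B%:E = (\esum_(i in [set: int]) (N (f i))%:E)%E.
  rewrite fineK// ge0_fin_numE; first exact: sf.
  by apply: esum_ge0 => i _; rewrite lee_fin mnorm_ge0.
have cN : cvgn (series (fun k => N (f (Posz k)) + N (f (Negz k)))).
  apply: nondecreasing_is_cvgn.
    by apply: nondecreasing_series => k _ _; rewrite addr_ge0 ?mnorm_ge0.
  exists B => _ [m _ <-]; rewrite -lee_fin BE.
  by apply: (@le_esum_int (N \o f)) => i; exact: mnorm_ge0.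
have cK p q : cvgn (series (fun k => complex.Re `|u k p q|)).
  apply: (@series_le_cvg _ _ (fun k => N (delta_mx q p) *
     (N (f (Posz k)) + N (f (Negz k))))).
  - by move=> k; exact: (le_trans _ (Re_le_cx_norm _)).
  - by move=> k; rewrite mulr_ge0 ?addr_ge0 ?mnorm_ge0.
  - by move=> k; exact: zsum_term_le.
  - exact: (@is_cvg_seriesZ _ _ (N (delta_mx q p)) cN).
have cRe p q : cvgn (series (fun k => complex.Re (u k p q))).
  apply: normed_cvg; apply: series_le_cvg (cK p q) => k /=.
  - exact: normr_ge0.
  - exact: (le_trans _ (Re_le_cx_norm _)).
  - exact: Re_le_cx_norm.
have cIm p q : cvgn (series (fun k => complex.Im (u k p q))).
  apply: normed_cvg; apply: series_le_cvg (cK p q) => k /=.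
  - exact: normr_ge0.
  - exact: (le_trans _ (Re_le_cx_norm _)).
  - exact: Im_le_cx_norm.
apply: cvgP; apply: (@cvg_mx_ReIm _ (\matrix_(p, q)
  (limn (series (fun k => complex.Re (u k p q))) +i*
   limn (series (fun k => complex.Im (u k p q))))%C)) => p q; rewrite mxE /=.
  rewrite [X in X @ _](_ : _ = series (fun k => complex.Re (u k p q)));
    first exact: cRe.
  by apply/funext => m; rewrite /series/= summxE raddf_sum.
rewrite [X in X @ _](_ : _ = series (fun k => complex.Im (u k p q)));
  first exact: cIm.
by apply/funext => m; rewrite /series/= summxE raddf_sum.
Qed.

End MatrixSeriesConvergence.

Section WienerProduct.
Context (R : realType) (n : nat) (N : matnorm R n).

Lemma mnorm_zsum f : abs_summable N f ->
  ((N (zsum f))%:E <= \esum_(i in [set: int]) (N (f i))%:E)%E.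
Proof.
move=> sf; have cf := cvg_zsum sf.
set u := fun k : nat => f (Posz k) + f (Negz k) in cf.
set B := fine (\esum_(i in [set: int]) (N (f i))%:E)%E.
have BE : B%:E = (\esum_(i in [set: int]) (N (f i))%:E)%E.
  rewrite fineK// ge0_fin_numE; first exact: sf.
  by apply: esum_ge0 => i _; rewrite lee_fin mnorm_ge0.
rewrite -BE lee_fin; apply/ler_addgt0Pr => e e0.
set D := \sum_p \sum_q N (delta_mx p q).
have D0 : 0 <= D by apply: sumr_ge0 => p _; apply: sumr_ge0 => q _; exact: mnorm_ge0.
have D1 : 0 < D + 1 by rewrite ltr_wpDl.
have e1 : 0 < real_cx (e / (D + 1)).
  by rewrite /real_cx (ltcR 0) divr_gt0.
have /cvg_ballP/(_ _ e1)[m _ /(_ m (leqnn m))[_ mb]] := cf.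
have SB : N (series u m) <= B.
  rewrite -lee_fin BE; apply: le_trans (le_esum_int m (fun i => mnorm_ge0 N (f i))).
  rewrite lee_fin (le_trans (mnorm_sum _ _ _ _))// ler_sum// => k _.
  exact: mnormD.
have LS : N (zsum f - series u m) <= e.
  rewrite (le_trans (mnorm_le_entries _ _))//.
  apply: (@le_trans _ _ (\sum_p \sum_q (e / (D + 1)) * N (delta_mx p q))).
    apply: ler_sum => p _; apply: ler_sum => q _.
    rewrite ler_wpM2r ?mnorm_ge0//; have := mb p q.
    rewrite -ball_normE /ball_ /= cx_normE /real_cx ltcR !mxE => /ltW; exact.
  under eq_bigr do rewrite -mulr_sumr.
  rewrite -mulr_sumr -/D -mulrA ler_piMr ?(ltW e0)// mulrC ler_pdivrMr// mul1r.
  by rewrite lerDl.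
rewrite -(subrK (series u m) (zsum f)) addrC.
by rewrite (le_trans (mnormD _ _ _))// lerD.
Qed.

(* The coefficients of the pointwise product of two loops. *)
Definition wconv (x y : wiener N) (k : int) : 'M[Cx R]_n :=
  zsum (fun i => x i *m y (k - i)).

Lemma esum_shift (g : int -> \bar R) k :
  \esum_(i in [set: int]) g (i - k) = \esum_(i in [set: int]) g i.
Proof.
rewrite -(@reindex_esum _ _ _ [set: int] [set: int] (fun i => i - k) g)//.
split=> [//|i j _ _ /addIr//|i _]; exists (i + k) => //; exact: addrK.
Qed.

Lemma esum_wconv_term (x y : wiener N) :
  \esum_(k in [set: int]) \esum_(i in [set: int])
     (N (x i) * N (y (k - i)))%:E = (wnorm x * wnorm y)%:E.
Proof.
rewrite esum_esum; last by move=> *; rewrite lee_fin mulr_ge0 ?mnorm_ge0.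
rewrite (@reindex_esum _ _ _ ([set: int] `*`` (fun=> [set: int])) _
  (fun p : int * int => (p.2, p.1)) _); last first.
  split=> [//|[a b] [c d] _ _ [-> ->]//|[a b] _]; by exists (b, a).
rewrite -(@esum_esum _ _ _ [set: int] (fun=> [set: int])
  (fun i k => (N (x i) * N (y (k - i)))%:E)); last first.
  by move=> *; rewrite lee_fin mulr_ge0 ?mnorm_ge0.
rewrite mulrC EFinM (wnormE x) -esumZ; last 2 first.
- by rewrite -lee_fin wnormE esum_ge0// => i _; rewrite lee_fin mnorm_ge0.
- by move=> i; rewrite lee_fin mnorm_ge0.
apply: eq_esum => i _; under eq_esum do rewrite EFinM.
rewrite esumZ ?mnorm_ge0//; last by move=> k; rewrite lee_fin mnorm_ge0.
by rewrite (esum_shift (fun k => (N (y k))%:E)) -wnormE muleC.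
Qed.

Lemma wconv_summable_term (x y : wiener N) k :
  abs_summable N (fun i => x i *m y (k - i)).
Proof.
apply: (@le_lt_trans _ _ (wnorm x * wnorm y)%:E); last exact: ltry.
rewrite -esum_wconv_term.
apply: (@le_trans _ _ (\esum_(i in [set: int]) (N (x i) * N (y (k - i)))%:E)).
  by apply: le_esum => i _; rewrite lee_fin mnormM.
apply: esum_ge; exists [set k]; first by split.
by rewrite fsbig_set1.
Qed.

Lemma wconv_summable (x y : wiener N) : abs_summable N (wconv x y).
Proof.
apply: (@le_lt_trans _ _ (wnorm x * wnorm y)%:E); last exact: ltry.
rewrite -esum_wconv_term; apply: le_esum => k _.
apply: (le_trans (mnorm_zsum (wconv_summable_term x y k))).
by apply: le_esum => i _; rewrite lee_fin mnormM.
Qed.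

Definition wmul (x y : wiener N) : wiener N := Wiener (wconv_summable x y).

Lemma wone_summable :
  abs_summable N (fun k : int => if k == 0 then 1%:M else 0).
Proof.
rewrite /abs_summable (esumID [set 0])//; last first.
  by move=> i _; rewrite lee_fin mnorm_ge0.
rewrite setTI esum_set1 ?lee_fin ?mnorm_ge0// esum1 ?adde0 ?ltry//.
by move=> i [_ /eqP/negbTE ->]; rewrite mnorm0.
Qed.

Definition wone : wiener N := Wiener wone_summable.

(* The inverse loop; meaningless when x is not invertible. *)
Definition winv (x : wiener N) : wiener N :=
  xget wone [set y | wmul x y = wone /\ wmul y x = wone].

Definition loop_eval (x : wiener N) (z : Cx R) : 'M[Cx R]_n :=
  zsum (fun k => z ^ k *: x k).

End WienerProduct.

Section MatrixGroups.
Context (R : realType) (n : nat).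
Implicit Types (G : set 'M[Cx R]_n) (X Y A B : 'M[Cx R]_n).
Implicit Types (V I g : {vspace 'M[Cx R]_n}).

Definition mexp X : 'M[Cx R]_n :=
  limn (series (fun k : nat => k`!%:R^-1 *: X ^+ k)).

Definition matrix_lie_group G :=
  [/\ G 1%:M, forall A B, G A -> G B -> G (A *m B),
      forall A, G A -> A \in unitmx /\ G (invmx A)
    & closure G `&` [set A | A \in unitmx] `<=` G].

Definition lie_algebra G : set 'M[Cx R]_n :=
  [set X | forall t : R, G (mexp (real_cx t *: X))].

Definition lie_bracket X Y := X *m Y - Y *m X.

Definition lie_ideal I g :=
  (I <= g)%VS /\ forall X Y, X \in g -> Y \in I -> lie_bracket X Y \in I.

Definition derived_algebra V : {vspace 'M[Cx R]_n} :=
  <<[seq lie_bracket X Y | X <- vbasis V, Y <- vbasis V]>>%VS.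

Definition solvable_algebra V := exists k, iter k derived_algebra V = 0%VS.

Definition semisimple_algebra g :=
  forall I, lie_ideal I g -> solvable_algebra I -> I = 0%VS.

(* That lie_algebra G is the carrier of some g : {vspace 'M[Cx R]_n} says that
   it is a complex subspace, i.e. that the Lie group G is complex. *)
Definition connected_complex_semisimple_group G :=
  [/\ matrix_lie_group G, connected G &
      exists2 g : {vspace 'M[Cx R]_n},
        forall X, X \in g <-> lie_algebra G X & semisimple_algebra g].

(* Automorphisms of G whose differential L is s-semilinear: complex linear for
   s = id, anti-linear for s = Num.conj. *)
Definition group_automorphism (s : Cx R -> Cx R) G (phi : 'M[Cx R]_n -> 'M[Cx R]_n) :=
  [/\ set_bij G G phi,
      forall A B, G A -> G B -> phi (A *m B) = phi A *m phi B &
      exists2 L : 'M[Cx R]_n -> 'M[Cx R]_n,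
        forall X, lie_algebra G X ->
          lie_algebra G (L X) /\ phi (mexp X) = mexp (L X) &
        forall c X Y, lie_algebra G X -> lie_algebra G Y ->
          L (c *: X + Y) = s c *: L X + L Y].

End MatrixGroups.

Definition has_finite_order (T : Type) (D : set T) (phi : T -> T) :=
  exists2 m, (0 < m)%N & forall x, D x -> iter m phi x = x.

Definition has_order (T : Type) (D : set T) (phi : T -> T) (m : nat) :=
  [/\ (0 < m)%N, forall x, D x -> iter m phi x = x &
      forall k, (0 < k < m)%N -> exists2 x, D x & iter k phi x <> x].

Section Calculus.
Context (R : realType).

(* For open O; k-fold continuous differentiability through the iterated
   directional derivatives of f. *)
Fixpoint Ck_on (d : nat) (F : normedModType R) (k : nat)
    (O : set 'rV[R]_d) (f : 'rV[R]_d -> F) : Prop :=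
  if k is k'.+1 then
    (forall x, O x -> differentiable f x) /\
    (forall v, Ck_on k' O (fun x => 'd f x v))
  else forall x, O x -> {for x, continuous f}.

Definition smooth_on (d : nat) (F : normedModType R)
    (O : set 'rV[R]_d) (f : 'rV[R]_d -> F) := forall k, Ck_on k O f.

Context (E F : normedModType R).

Definition multilinear (k : nat) (A : ('I_k -> E) -> F) :=
  forall (i : 'I_k) (v : 'I_k -> E) (c : R) (x y : E),
    A [eta v with i |-> c *: x + y] =
    c *: A [eta v with i |-> x] + A [eta v with i |-> y].

(* f (x + h) is the sum of A_k(h, ..., h) over k, normally for `|h| < r. *)
Definition analytic_at (f : E -> F) (x : E) :=
  exists (A : forall k : nat, ('I_k -> E) -> F) (M : nat -> R) (r : R),
    [/\ 0 < r,
        forall k, multilinear (A k),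
        forall k v, `|A k v| <= M k * \prod_(i < k) `|v i|,
        cvgn (series (fun k => M k * r ^+ k)) &
        forall h, `|h| < r ->
          series (fun k => A k (fun=> h)) @ \oo --> f (x + h)].

(* Maps on a submanifold D are analytic when they extend locally to analytic
   maps of the ambient space. *)
Definition analytic_on (D : set E) (f : E -> F) :=
  forall x, D x -> exists (O : set E) (f' : E -> F),
    [/\ open O, O x, forall y, O y -> analytic_at f' y &
        forall y, O y -> D y -> f' y = f y].

End Calculus.

Definition analytic_diffeo (R : realType) (E F : normedModType R)
    (D : set E) (D' : set F) (f : E -> F) :=
  [/\ f @` D = D', analytic_on D f &
      exists2 f' : F -> E, {in D, cancel f f'} & analytic_on D' f'].

(* A chart phi of the ambient space maps M to the range of a continuous linear
   projection P, i.e. to a closed complemented subspace. *)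
Definition submanifold (R : realType) (E : normedModType R) (M : set E) :=
  forall p, M p -> exists (O O' : set E) (phi : E -> E) (P : {linear E -> E}),
    [/\ open O /\ O p, open O', analytic_diffeo O O' phi,
        continuous P /\ (forall x, P (P x) = P x) &
        forall x, O x -> M x <-> P (phi x) = phi x].

Section LoopGroups.
Context (R : realType) (n : nat) (N : matnorm R n) (G : set 'M[Cx R]_n).
Implicit Types (x y : wiener N) (H K : set (wiener N)).

Definition LambdaG : set (wiener N) :=
  [set x | forall z, `|z| = 1 -> G (loop_eval x z)].

(* h is the holomorphic extension to the unit disc, with values in G, of a map
   u on the unit circle. *)
Definition holomorphic_extension (u h : Cx R -> 'M[Cx R]_n) :=
  [/\ forall z, `|z| < 1 -> derivable h z 1 /\ G (h z),
      {within [set z | `|z| <= 1], continuous h} &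
      forall z, `|z| = 1 -> h z = u z].

(* LambdaM and LambdaM1 use the coordinate 1 / z around infinity. *)
Definition LambdaP : set (wiener N) := LambdaG `&`
  [set x | exists h, holomorphic_extension (loop_eval x) h].
Definition LambdaM : set (wiener N) := LambdaG `&`
  [set x | exists h, holomorphic_extension (fun z => loop_eval x z^-1) h].
Definition LambdaP1 : set (wiener N) := LambdaG `&`
  [set x | exists2 h, holomorphic_extension (loop_eval x) h & h 0 = 1%:M].
Definition LambdaM1 : set (wiener N) := LambdaG `&`
  [set x | exists2 h,
    holomorphic_extension (fun z => loop_eval x z^-1) h & h 0 = 1%:M].

Definition subgroup H :=
  [/\ H (wone N), forall x y, H x -> H y -> H (wmul x y) &
      forall x, H x -> exists y,
        [/\ H y, wmul x y = wone N & wmul y x = wone N]].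

Definition banach_lie_subgroup H :=
  [/\ H `<=` LambdaG, subgroup H, closure H `&` LambdaG `<=` H & submanifold H].

Definition minus_part H := H `&` LambdaM.
Definition const_part H := H `&` LambdaP `&` LambdaM.

Definition id_component H : set (wiener N) := connected_component H (wone N).

Definition wmul3 (t : wiener N * wiener N * wiener N) : wiener N :=
  wmul (wmul t.1.1 t.1.2) t.2.

Definition open_dense_in (B H : set (wiener N)) :=
  (exists2 O, open O & B = H `&` O) /\ H `<=` closure B.

Definition birkhoff_decomposable H Hp Ho Hm :=
  let RB := wmul3 @` (Hp `*` Ho `*` Hm) in
  let LB := wmul3 @` (Hm `*` Ho `*` Hp) in
  [/\ open_dense_in RB (id_component H), open_dense_in LB (id_component H),
      analytic_diffeo (Hp `*` Ho `*` Hm) RB wmul3 &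
      analytic_diffeo (Hm `*` Ho `*` Hp) LB wmul3].

Definition birkhoff_subgroup H :=
  let Hp := id_component (H `&` LambdaP1) in
  let Hm := id_component (H `&` LambdaM1) in
  let Ho := id_component (const_part H) in
  [/\ banach_lie_subgroup H, banach_lie_subgroup Hp, banach_lie_subgroup Hm,
      banach_lie_subgroup Ho & birkhoff_decomposable H Hp Ho Hm].

Definition loop_automorphism H (phi : wiener N -> wiener N) :=
  [/\ set_bij H H phi,
      forall x y, H x -> H y -> phi (wmul x y) = wmul (phi x) (phi y) &
      analytic_diffeo H H phi].

Definition cis (t : R) : Cx R := (cos t +i* sin t)%C.

(* In both definitions j = 1 is the first kind and j = -1 the second kind. *)
Definition linear_automorphism H (j : int) (m : nat) (phi : wiener N -> wiener N) :=
  [/\ loop_automorphism H phi, has_order H phi m &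
      exists (phi0 : 'M[Cx R]_n -> 'M[Cx R]_n) (k : int),
        [/\ group_automorphism id G phi0, has_finite_order G phi0 &
            forall x z, H x -> `|z| = 1 ->
              loop_eval (phi x) z =
              phi0 (loop_eval x (cis (2 * k%:~R * pi / m%:R) * z ^ j))]].

Definition antilinear_involution H (j : int) (rho : wiener N -> wiener N) :=
  [/\ loop_automorphism H rho, has_order H rho 2 &
      exists (rho0 : 'M[Cx R]_n -> 'M[Cx R]_n) (e : Cx R),
        [/\ group_automorphism Num.conj G rho0,
            forall A, G A -> rho0 (rho0 A) = A, e = 1 \/ e = -1 &
            forall x z, H x -> `|z| = 1 ->
              loop_eval (rho x) z = rho0 (loop_eval x (e * (z^*) ^ j))]].

Definition involution_second_kind H (tau : wiener N -> wiener N) :=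
  linear_automorphism H (-1) 2 tau \/ antilinear_involution H (-1) tau.

Definition fixed_part (tau : wiener N -> wiener N) H := H `&` [set x | tau x = x].

Definition iwasawa_cell (tau : wiener N -> wiener N) H : set (wiener N) :=
  [set wmul t.1 t.2 | t in fixed_part tau H `*` minus_part H].

Definition lcoset x K : set (wiener N) := [set wmul x k | k in K].

End LoopGroups.

Record chart (R : realType) (U : topologicalType) (d : nat) := Chart {
  chart_dom : set U;
  chart_map : U -> 'rV[R]_d;
  chart_inv : 'rV[R]_d -> U }.

Section Manifolds.
Context (R : realType) (U : topologicalType) (d : nat).
Implicit Types (c : chart R U d) (atlas : set (chart R U d)).

Definition chart_image c (W : set U) := chart_map c @` (chart_dom c `&` W).

Definition chart_homeomorphism c :=
  [/\ open (chart_dom c), open (chart_image c setT),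
      {in chart_dom c, cancel (chart_map c) (chart_inv c)},
      {within chart_dom c, continuous (chart_map c)} &
      {within chart_image c setT, continuous (chart_inv c)}].

Definition smooth_manifold atlas :=
  [/\ hausdorff_space U, @second_countable U,
      forall c, atlas c -> chart_homeomorphism c,
      forall t, exists2 c, atlas c & chart_dom c t &
      forall c c', atlas c -> atlas c' ->
        smooth_on (chart_image c (chart_dom c')) (chart_map c' \o chart_inv c)].

(* For open W; the values of F outside W are irrelevant. *)
Definition smooth_map atlas (E : normedModType R) (W : set U) (F : U -> E) :=
  forall c, atlas c -> smooth_on (chart_image c W) (F \o chart_inv c).

End Manifolds.

Section ConnectionOrder.
Context (R : realType) (n : nat) (N : matnorm R n).
Context (U : topologicalType) (d : nat) (atlas : set (chart R U d)).
Implicit Types (H K Ko : set (wiener N)) (W : set U) (F : U -> wiener N).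
Implicit Types (a b : \bar int) (Phi : U -> set (wiener N)).

(* Subgroups carry the topology and smooth structure induced by wiener N. *)
Definition smooth_maps H W F := (forall t, W t -> H (F t)) /\ smooth_map atlas W F.

(* F^-1 dF at the point of coordinates x in the chart c, on the vector v. *)
Definition maurer_cartan F (c : chart R U d) (x v : 'rV[R]_d) : wiener N :=
  wmul (winv (F (chart_inv c x))) ('d (F \o chart_inv c) x v).

Definition connection_order a b W F :=
  forall c x v (i : int), atlas c -> chart_image c W x ->
    ~~ (a <= i%:E <= b)%E -> maurer_cartan F c x v i = 0.

Definition smooth_maps_order H a b W F :=
  smooth_maps H W F /\ connection_order a b W F.

Definition local_lift K Ko Phi W F :=
  [/\ open W, smooth_maps K W F & forall t, W t -> Phi t = lcoset (F t) Ko].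

(* A point of K / Ko is a coset x Ko; smoothness of Phi : U -> K / Ko is the
   existence of smooth local lifts. *)
Definition quotient_maps_order K Ko a b Phi :=
  [/\ forall t, exists2 x, K x & Phi t = lcoset x Ko,
      forall t, exists W F, W t /\ local_lift K Ko Phi W F &
      forall W F, local_lift K Ko Phi W F -> connection_order a b W F].

End ConnectionOrder.

(* Main.v *)
(** The class of t is H_tau /\ F_+(t) H^-.  A loop of H_tau /\ H^- extends to both
    discs, because tau exchanges Lambda^+ and Lambda^-; by Goursat's theorem its
    Fourier coefficients outside 0 vanish, so the set above is a single coset of the
    constants of H_tau.

    For a smooth local lift near t_1, write F_+(t_1) = f_1 h_1 and K = F_+ h_1^-1.
    Then P = tau(K)^-1 K is close to I, and its Birkhoff factors P = P_+ P_0 P_-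
    are analytic in P.  From tau(P) = P^-1 one gets tau(P_-) = P_+^-1 and
    tau(P_0) = P_0^-1, so with k = sqrt(P_0), which lies in the constant subgroup by
    Cartan's closed subgroup theorem, h = k P_- satisfies P = tau(h)^-1 h, and
    F = K h^-1 is fixed by tau.

    Since F = F_+ F_- with F_- in H^-, the Maurer-Cartan form of F has no coefficient
    above b.  It is tangent to H_tau, hence of the form X(z) = L(X(c / z)) with L the
    derivative of an automorphism of G, so it has none below -b either. *)
Require Import Defs.
From HB Require Import structures.
From mathcomp Require Import all_boot all_order all_algebra.
From mathcomp Require Import all_classical all_reals all_analysis.
From mathcomp Require Import complex ring lra.

Set Implicit Arguments.
Unset Strict Implicit.
Unset Printing Implicit Defensive.
Import Order.TTheory GRing.Theory Num.Theory.
Import numFieldNormedType.Exports.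
Local Open Scope classical_set_scope.
Local Open Scope ring_scope.

(** * Loops and their Fourier coefficients *)

(** The automorphism of [G] underlying tau is abstract: to first order it is known only through
    [phi (mexp X) = mexp (L X)]. To see that tau exchanges the two discs, elements of [G] near 1
    must be written as exponentials of Lie algebra elements. Cartan's theorem, obtained by a Newton
    iteration, serves for this as well as for the root of P_0.

    Path integrals are replaced by averages over 2^M points of the circle, which are exact on z^l
    once |l| < 2^M. Identities between loops are checked on monomials and extended by density; after
    that, evaluation on the circle reduces them to matrix identities.

    The root k is picked separately at each point, so its smoothness has to come from the equation k
    k = P_0. Differentiating it gives the Sylvester equation k D + D k = P_0', whose solution near
    the identity is unique; the same uniqueness yields tau(k) = k^-1. For the Birkhoff factors, the
    differential of an analytic map is treated as an analytic map of the pair (point, direction), so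
    that an induction on the order of differentiability stays among maps of the same type. *)

Section ComplexAbs.
Context (R : realType).
Implicit Types z w : Cx R.

(** The norm of [Cx R] takes its values in [Cx R] itself; this real-valued modulus can be compared
    with [N] and enters real inequalities. *)
Definition cabs z : R := complex.Re `|z|.

Lemma cabsE z : `|z| = real_cx (cabs z).
Proof. exact: cx_normE. Qed.

Lemma cabs_ge0 z : 0 <= cabs z.
Proof. exact: le_trans (Re_le_cx_norm z). Qed.

Lemma cabsM z w : cabs (z * w) = cabs z * cabs w.
Proof.
by apply: (@complexI R); rewrite -[LHS]/(real_cx _) -cabsE normrM !cabsE -rmorphM.
Qed.

Lemma cabsD z w : cabs (z + w) <= cabs z + cabs w.
Proof.
by rewrite -lecR -[leLHS]/(real_cx _) rmorphD /= -/(real_cx _) -/(real_cx _)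
  -!cabsE ler_normD.
Qed.

Lemma cabs_real (t : R) : cabs (real_cx t) = `|t|.
Proof. by rewrite /cabs /real_cx normc_def /= expr0n addr0 sqrtr_sqr. Qed.

Lemma real_cx_nat (k : nat) : real_cx (k%:R : R) = k%:R.
Proof. by rewrite /real_cx rmorph_nat. Qed.

Lemma cabsN z : cabs (- z) = cabs z.
Proof. by rewrite /cabs normrN. Qed.

Lemma cabs0 : cabs 0 = 0.
Proof. by rewrite /cabs normr0. Qed.

Lemma cabs1 : cabs 1 = 1.
Proof. by rewrite /cabs normr1. Qed.

Lemma cabs_norm1 z : `|z| = 1 -> cabs z = 1.
Proof. by rewrite /cabs => ->. Qed.

Lemma norm1_cabs z : cabs z = 1 -> `|z| = 1.
Proof. by rewrite cabsE => ->. Qed.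

Lemma cabsV z : cabs z^-1 = (cabs z)^-1.
Proof.
apply: (@complexI R); rewrite -[LHS]/(real_cx _) -cabsE normfV cabsE.
by rewrite /real_cx fmorphV.
Qed.

Lemma cabsX z k : cabs (z ^+ k) = cabs z ^+ k.
Proof. by elim: k => [|k IH]; rewrite ?expr0 ?cabs1// !exprS cabsM IH. Qed.

Lemma cabs_eq0 z : (cabs z == 0) = (z == 0).
Proof.
apply/eqP/eqP => [z0|->]; last exact: cabs0.
by apply/normr0_eq0; rewrite cabsE z0.
Qed.

Lemma cabs_gt0 z : (0 < cabs z) = (z != 0).
Proof. by rewrite lt_def cabs_eq0 cabs_ge0 andbT. Qed.

Lemma cabs_conj z : cabs z^* = cabs z.
Proof. by rewrite /cabs norm_conjC. Qed.

Lemma cabs_exprz z (k : int) : cabs z = 1 -> cabs (z ^ k) = 1.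
Proof. by case: k => k z1; rewrite ?NegzE -?invr_expz ?cabsV /= cabsX z1 expr1n ?invr1. Qed.

Lemma real_cx_lt (s t : R) : (real_cx s < real_cx t) = (s < t).
Proof. exact: ltcR. Qed.

Lemma real_cx_le (s t : R) : (real_cx s <= real_cx t) = (s <= t).
Proof. exact: lecR. Qed.

Lemma cnorm_lt z (e : R) : (`|z| < real_cx e) = (cabs z < e).
Proof. by rewrite cabsE real_cx_lt. Qed.

Lemma cnorm_lt1 z : (`|z| < 1) = (cabs z < 1).
Proof. by rewrite cabsE -[1]/(real_cx 1) real_cx_lt. Qed.

Lemma cnorm_le1 z : (`|z| <= 1) = (cabs z <= 1).
Proof. by rewrite cabsE -[1]/(real_cx 1) real_cx_le. Qed.

(** Balls of [Cx R] have radii in [Cx R], but a positive element of that field is real. *)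
Lemma nbhs_cabsP (z0 : Cx R) (P : Cx R -> Prop) :
  (\forall z \near z0, P z) <->
  exists2 e : R, 0 < e & forall z, cabs (z - z0) < e -> P z.
Proof.
split=> [/nbhs_ballP[e /= e0 eP]|[e e0 eP]].
  have [er e0'] := @cx_gt0 R e e0; exists (complex.Re e) => // z ze.
  apply: eP; rewrite -ball_normE /ball_ /= distrC er.
  by rewrite -[X in _ < X]/(real_cx _) cnorm_lt.
apply/nbhs_ballP; exists (real_cx e) => /=; first by rewrite -[0]/(real_cx 0) real_cx_lt.
move=> z; rewrite -ball_normE /ball_ /= distrC cnorm_lt; exact: eP.
Qed.

End ComplexAbs.

(** * The matrix norm and the entrywise topology *)

Section MatrixNorm.
Context (R : realType) (n : nat) (N : matnorm R n).
Implicit Types A B X Y : 'M[Cx R]_n.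

Lemma mnormZabs (a : Cx R) A : N (a *: A) = cabs a * N A.
Proof. exact: mnormZc. Qed.

Lemma mnorm_distC A B : N (A - B) = N (B - A).
Proof. by rewrite -mnormN opprB. Qed.

Lemma mnormB A B : N (A - B) <= N A + N B.
Proof. by rewrite -(mnormN N B) mnormD. Qed.

(** Equivalence of norms in finite dimension: the topology of matrices is entrywise, and [C], the
    total norm of the elementary matrices, controls both comparisons with [N]. *)
Lemma nbhs_mnormP A (P : 'M[Cx R]_n -> Prop) :
  (\forall B \near A, P B) <->
  exists2 e : R, 0 < e & forall B, N (B - A) < e -> P B.
Proof.
pose C := \sum_p \sum_q N (delta_mx p q).
have C0 : 0 <= C.
  by apply: sumr_ge0 => p _; apply: sumr_ge0 => q _; exact: mnorm_ge0.
have C1 : 0 < C + 1 by rewrite ltr_wpDl.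
have leC p q : N (delta_mx q p) <= C.
  rewrite /C (bigD1 q)//= (bigD1 p)//= -addrA lerDl addr_ge0//.
    by apply: sumr_ge0 => ? _; exact: mnorm_ge0.
  by apply: sumr_ge0 => ? _; apply: sumr_ge0 => ? _; exact: mnorm_ge0.
split=> [/nbhs_ballP[e /= e0 eP]|[e e0 eP]].
  have [er e0'] := @cx_gt0 R e e0.
  exists (complex.Re e / (C + 1)); first by rewrite divr_gt0.
  move=> B BA; apply: eP; split=> // p q; rewrite -ball_normE /ball_ /= distrC er.
  rewrite -[X in _ < X]/(real_cx _) cnorm_lt.
  have -> : B p q - A p q = (B - A) p q by rewrite !mxE.
  rewrite (le_lt_trans (mnorm_entry N _ _ _))//.
  rewrite (@le_lt_trans _ _ ((C + 1) * N (B - A)))//.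
    by rewrite ler_wpM2r ?mnorm_ge0// (le_trans (leC _ _))// lerDl.
  by rewrite mulrC -ltr_pdivlMr.
apply/nbhs_ballP; exists (real_cx (e / (C + 1))) => /=.
  by rewrite -[0]/(real_cx 0) real_cx_lt divr_gt0.
move=> B [_ BA]; apply: eP; rewrite (le_lt_trans (mnorm_le_entries _ _))//.
rewrite (@le_lt_trans _ _ (\sum_p \sum_q (e / (C + 1)) * N (delta_mx p q)))//.
  apply: ler_sum => p _; apply: ler_sum => q _; rewrite ler_wpM2r ?mnorm_ge0//.
  have := BA p q; rewrite -ball_normE /ball_ /= distrC cnorm_lt !mxE => /ltW; exact.
under eq_bigr do rewrite -mulr_sumr.
by rewrite -mulr_sumr -/C mulrAC ltr_pdivrMr// ltr_pM2l// ltrDl.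
Qed.

Lemma cvg_mnormP (T : Type) (F : set_system T) (FF : Filter F)
    (f : T -> 'M[Cx R]_n) A :
  (f x @[x --> F] --> A) <-> forall e : R, 0 < e -> \forall x \near F, N (f x - A) < e.
Proof.
split=> [fA e e0|H P /nbhs_mnormP[e e0 eP]].
  by apply: (fA [set B | N (B - A) < e]); apply/nbhs_mnormP; exists e.
have /= := H e e0; rewrite nearE => He.
by change (F (f @^-1` P)); apply: filterS He => x; exact: eP.
Qed.

Lemma mnorm_lim_le (f : nat -> 'M[Cx R]_n) A (c : R) :
  f @ \oo --> A -> (\forall k \near \oo, N (f k) <= c) -> N A <= c.
Proof.
move=> /cvg_mnormP fA fc; apply/ler_addgt0Pr => e e0.
have [k [fe fk]] : exists k, N (f k - A) < e /\ N (f k) <= c.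
  near \oo => k; exists k; split; near: k; [exact: fA|exact: fc].
rewrite -(subrK (f k) A) (le_trans (mnormD _ _ _))// addrC lerD//.
by rewrite mnorm_distC ltW.
Unshelve. all: by end_near. Qed.

Lemma mnorm_eq0_small A : (forall e : R, 0 < e -> N A <= e) -> A = 0.
Proof.
move=> h; apply: (mnorm_eq0 (m := N)); apply/eqP; rewrite eq_le mnorm_ge0 andbT.
by apply/ler_addgt0Pr => e e0; rewrite add0r h.
Qed.

End MatrixNorm.

(** * Density of Laurent polynomials in the Wiener algebra *)

Section WienerDensity.
Context (R : realType) (n : nat) (N : matnorm R n).
Implicit Types (x y : wiener N) (A B : 'M[Cx R]_n) (i j k : int).

Lemma wnorm_ge0 x : 0 <= wnorm x.
Proof. exact: (@normr_ge0 _ (wiener N)). Qed.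

Lemma coef_sum (I : Type) (r : seq I) (P : pred I) (F : I -> wiener N) k :
  (\sum_(i <- r | P i) F i) k = \sum_(i <- r | P i) F i k.
Proof. by elim/big_rec2: _ => // i a b _ <-. Qed.

Lemma mnorm_coef x k : N (x k) <= wnorm x.
Proof.
rewrite -lee_fin wnormE; apply: esum_ge; exists [set k]; first by split.
by rewrite fsbig_set1.
Qed.

Lemma mono_summable A j : abs_summable N (fun k => if k == j then A else 0).
Proof.
rewrite /abs_summable (esumID [set j])//; last by move=> i _; rewrite lee_fin mnorm_ge0.
rewrite setTI esum_set1 ?lee_fin ?mnorm_ge0// esum1 ?adde0 ?ltry//.
by move=> i [_ /eqP/negbTE ->]; rewrite mnorm0.
Qed.

Definition mono A j : wiener N := Wiener (mono_summable A j).

Lemma monoE A j k : mono A j k = if k == j then A else 0.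
Proof. by []. Qed.

Lemma wone_mono : wone N = mono 1%:M 0.
Proof. by apply: wienerE. Qed.

Lemma monoD A B j : mono (A + B) j = mono A j + mono B j.
Proof. apply: wienerE => k; rewrite -[RHS]/(mono A j k + mono B j k) !monoE.
by case: ifP => // _; rewrite addr0. Qed.

Lemma wnorm_mono A j : wnorm (mono A j) = N A.
Proof.
apply: EFin_inj; rewrite wnormE (esumID [set j])//; last first.
  by move=> i _; rewrite lee_fin mnorm_ge0.
rewrite setTI esum_set1 ?lee_fin ?mnorm_ge0//= eqxx esum1 ?adde0//.
by move=> i [_ /eqP/negbTE ->]; rewrite mnorm0.
Qed.

Lemma sum_mono_coef x (r : seq int) k : uniq r ->
  (\sum_(i <- r) mono (x i) i) k = if k \in r then x k else 0.
Proof.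
move=> ur; rewrite coef_sum; case: ifPn => kr.
  rewrite (bigD1_seq k)//= eqxx big1 ?addr0// => i ik.
  by rewrite eq_sym (negbTE ik).
rewrite big_seq big1// => i ir /=; case: eqP => // ki.
by move: kr; rewrite ki ir.
Qed.

(** A finite set of indices that nearly attains the supremum defining the norm leaves a tail of mass
    below [e]. *)
Lemma sum_mono_dense x (e : R) : 0 < e ->
  exists2 r : seq int, uniq r & wnorm (x - \sum_(i <- r) mono (x i) i) < e.
Proof.
move=> e0; set T := (\esum_(i in [set: int]) (N (x i))%:E)%E.
have N0 i : (0 <= (N (x i))%:E)%E by rewrite lee_fin mnorm_ge0.
have Tfin : T \is a fin_num by rewrite /T -wnormE.
have [_ [A [finA _] <-] Te] := ub_ereal_sup_adherent e0 Tfin.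
set r := finmap.enum_fset (fset_set A).
exists r; first exact: finmap.fset_uniq.
have TE : T = (\esum_(i in A) (N (x i))%:E + \esum_(i in ~` A) (N (x i))%:E)%E.
  by rewrite /T (esumID A)// !setTI.
rewrite -lte_fin wnormE (_ : (\esum_(_ in _) _)%E =
    (\esum_(i in ~` A) (N (x i))%:E)%E).
  have : (T - e%:E < \esum_(i in A) (N (x i))%:E)%E by rewrite esum_fset.
  move: TE Tfin; set a := esum A _; set c := esum _ _ => ->.
  rewrite fin_numD => /andP[af cf]; rewrite -(fineK af) -(fineK cf).
  by rewrite -EFinN -!EFinD !lte_fin => ?; lra.
have rE i : (i \in r) = (i \in A).
  by rewrite in_fset_set.
have cE i : (x - \sum_(i <- r) mono (x i) i) i = if i \in A then 0 else x i.
  rewrite -[LHS]/(x i - (\sum_(i <- r) mono (x i) i) i) sum_mono_coef ?finmap.fset_uniq//.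
  by rewrite rE; case: ifP; rewrite ?subrr ?subr0.
rewrite (esumID A)//; last by move=> i _; rewrite lee_fin mnorm_ge0.
rewrite !setTI esum1 ?add0e; last first.
  by move=> i Ai; rewrite cE mem_set// mnorm0.
by apply: eq_esum => i Ai; rewrite cE memNset.
Qed.

(** Induction principle for closed additive properties. It takes the place of exchanging double
    series in the product formula for evaluation and in the computation of Fourier coefficients. *)
Lemma wiener_density_ind (P : wiener N -> Prop) :
  P 0 -> (forall x y, P x -> P y -> P (x + y)) -> (forall A j, P (mono A j)) ->
  (forall x, (forall e : R, 0 < e -> exists2 y, P y & wnorm (x - y) < e) -> P x) ->
  forall x, P x.
Proof.
move=> P0 PD Pm Pc x; apply: Pc => e e0.
have [r _ rx] := sum_mono_dense x e0; exists (\sum_(i <- r) mono (x i) i) => //.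
by elim/big_ind: _.
Qed.

Lemma zsumP (f : int -> 'M[Cx R]_n) A : abs_summable N f ->
  (forall e : R, 0 < e -> \forall m \near \oo,
     N (series (fun k : nat => f (Posz k) + f (Negz k)) m - A) < e) -> zsum f = A.
Proof.
move=> sf fA; have /cvg_mnormP-/(_ N) fz := cvg_zsum sf.
apply/eqP; rewrite -subr_eq0; apply/eqP; apply: (@mnorm_eq0_small _ _ N) => e e0.
have e20 : 0 < e / 2 by rewrite divr_gt0.
set s := series _ in fA; near \oo => m; rewrite -(subrK (s m) (zsum f)) -addrA.
rewrite (le_trans (mnormD _ _ _))// (splitr e) lerD// ltW//.
  rewrite mnorm_distC; near: m; exact: fz.
by near: m; exact: fA.
Unshelve. all: by end_near. Qed.

(** The partial sums over [-m, m) are constant once m > |j|. *)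
Lemma zsum_single (f : int -> 'M[Cx R]_n) j :
  (forall i, i != j -> f i = 0) -> zsum f = f j.
Proof.
move=> f0; have fE : f = mono (f j) j.
  by apply/funext => i; rewrite monoE; case: eqVneq => [->//|/f0].
have sf : abs_summable N f by rewrite fE; exact: mono_summable.
suff sE m : (`|j| < m)%N -> series (fun k : nat => f (Posz k) + f (Negz k)) m = f j.
  apply: zsumP sf _ => e e0; near=> m; rewrite sE ?subrr ?mnorm0//.
  by near: m; exact: nbhs_infty_gt.
move=> jm; rewrite /series /=; case: j f0 fE sf jm => j f0 fE _ jm.
  rewrite big_mkord (bigD1 (Ordinal jm))//= big1 ?addr0.
    by rewrite (f0 (Negz j)) ?addr0.
  move=> k kj; rewrite !f0 ?addr0//.
rewrite big_mkord (bigD1 (Ordinal (ltnW jm)))//= big1 ?addr0.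
  by rewrite (f0 (Posz j)) ?add0r.
by move=> k kj; rewrite !f0 ?addr0.
Unshelve. all: by end_near. Qed.

Lemma zsumD (f g : int -> 'M[Cx R]_n) : abs_summable N f -> abs_summable N g ->
  zsum (fun i => f i + g i) = zsum f + zsum g.
Proof.
move=> sf sg; apply: zsumP; first exact: abs_summableD.
have /cvg_mnormP-/(_ N) fz := cvg_zsum sf; have /cvg_mnormP-/(_ N) gz := cvg_zsum sg.
move=> e e0; have e20 : 0 < e / 2 by rewrite divr_gt0.
near=> m; set s := series _.
have -> : s m = series (fun k : nat => f (Posz k) + f (Negz k)) m +
                series (fun k : nat => g (Posz k) + g (Negz k)) m.
  by rewrite /s /series /= -big_split; apply: eq_bigr => i _; rewrite addrACA.
rewrite opprD addrACA (le_lt_trans (mnormD _ _ _))// [ltRHS]splitr ltrD//.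
  by near: m; exact: fz.
by near: m; exact: gz.
Unshelve. all: by end_near. Qed.

Lemma wnormM x y : wnorm (wmul x y) <= wnorm x * wnorm y.
Proof.
rewrite -lee_fin wnormE -esum_wconv_term; apply: le_esum => k _.
apply: (le_trans (mnorm_zsum (wconv_summable_term x y k))).
by apply: le_esum => i _; rewrite lee_fin mnormM.
Qed.

Lemma wmulDl x y z : wmul (x + y) z = wmul x z + wmul y z.
Proof.
apply: wienerE => k; rewrite -[RHS]/(wmul x z k + wmul y z k) /= /wconv -zsumD;
  [|exact: wconv_summable_term..].
by congr zsum; apply/funext => i; rewrite -mulmxDl.
Qed.

Lemma wmulDr x y z : wmul x (y + z) = wmul x y + wmul x z.
Proof.
apply: wienerE => k; rewrite -[RHS]/(wmul x y k + wmul x z k) /= /wconv -zsumD;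
  [|exact: wconv_summable_term..].
by congr zsum; apply/funext => i; rewrite -mulmxDr.
Qed.

Lemma wmul_mono A B i j : wmul (mono A i) (mono B j) = mono (A *m B) (i + j).
Proof.
apply: wienerE => k; rewrite /= /wconv (@zsum_single _ i) /=.
  rewrite eqxx (_ : (k - i == j) = (k == i + j)); last by rewrite subr_eq addrC.
  by case: ifP => // _; rewrite mulmx0.
by move=> l /negbTE ->; rewrite mul0mx.
Qed.

End WienerDensity.

(** * Evaluation of loops on the unit circle *)

Section LoopEval.
Context (R : realType) (n : nat) (N : matnorm R n).
Implicit Types (x y : wiener N) (A B : 'M[Cx R]_n) (z : Cx R).

Lemma loop_eval_summable x z : cabs z = 1 -> abs_summable N (fun k => z ^ k *: x k).
Proof.
move=> z1; rewrite /abs_summable; under eq_esum do rewrite mnormZabs cabs_exprz// mul1r.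
exact: wienerP.
Qed.

Lemma loop_evalD x y z : cabs z = 1 ->
  loop_eval (x + y) z = loop_eval x z + loop_eval y z.
Proof.
move=> z1; rewrite /loop_eval -(zsumD (loop_eval_summable x z1) (loop_eval_summable y z1)).
by congr zsum; apply/funext => i; rewrite -scalerDr.
Qed.

Lemma loop_eval_mono A j z : loop_eval (mono N A j) z = z ^ j *: A.
Proof.
rewrite /loop_eval (@zsum_single _ _ N _ j) ?monoE ?eqxx// => i /negbTE ij.
by rewrite monoE ij scaler0.
Qed.

Lemma loop_eval0 z : loop_eval (0 : wiener N) z = 0.
Proof.
rewrite (_ : 0 = mono N 0 0) ?loop_eval_mono ?scaler0//.
by apply: wienerE => k; rewrite monoE; case: ifP.
Qed.

Lemma loop_eval_one z : loop_eval (wone N) z = 1%:M.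
Proof. by rewrite wone_mono loop_eval_mono expr0z scale1r. Qed.

Lemma loop_evalN x z : cabs z = 1 -> loop_eval (- x) z = - loop_eval x z.
Proof.
move=> z1; apply/eqP; rewrite -subr_eq0 opprK -loop_evalD// addrC subrr.
by rewrite loop_eval0.
Qed.

Lemma loop_evalB x y z : cabs z = 1 ->
  loop_eval (x - y) z = loop_eval x z - loop_eval y z.
Proof. by move=> z1; rewrite loop_evalD// loop_evalN. Qed.

Lemma mnorm_loop_eval x z : cabs z = 1 -> N (loop_eval x z) <= wnorm x.
Proof.
move=> z1; rewrite -lee_fin wnormE (le_trans (mnorm_zsum (loop_eval_summable x z1)))//.
by apply: le_esum => i _; rewrite mnormZabs cabs_exprz// mul1r.
Qed.

Lemma wmul0l x : wmul 0 x = 0.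
Proof. by apply/(addrI (wmul 0 x)); rewrite -wmulDl !addr0. Qed.

Lemma wmul0r x : wmul x 0 = 0.
Proof. by apply/(addrI (wmul x 0)); rewrite -wmulDr !addr0. Qed.

Lemma wmulNl x y : wmul (- x) y = - wmul x y.
Proof. by apply/eqP; rewrite -subr_eq0 opprK -wmulDl addrC subrr wmul0l. Qed.

Lemma wmulNr x y : wmul x (- y) = - wmul x y.
Proof. by apply/eqP; rewrite -subr_eq0 opprK -wmulDr addrC subrr wmul0r. Qed.

Lemma wmulBl x y (z : wiener N) : wmul (x - y) z = wmul x z - wmul y z.
Proof. by rewrite wmulDl wmulNl. Qed.

Lemma wmulBr x y (z : wiener N) : wmul x (y - z) = wmul x y - wmul x z.
Proof. by rewrite wmulDr wmulNr. Qed.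

(** The defect [D] is additive and continuous in each argument and vanishes on pairs of monomials,
    so density applies to one argument after the other. *)
Lemma loop_evalM x y z : cabs z = 1 ->
  loop_eval (wmul x y) z = loop_eval x z *m loop_eval y z.
Proof.
move=> z1; have z0 : z != 0 by rewrite -cabs_gt0 z1.
pose D x y := loop_eval (wmul x y) z - loop_eval x z *m loop_eval y z.
suff D0 : D x y = 0 by apply/eqP; rewrite -subr_eq0 -/(D x y) D0.
have Dl a b c : D (a + b) c = D a c + D b c.
  by rewrite /D wmulDl !loop_evalD// mulmxDl opprD addrACA.
have Dr a b c : D a (b + c) = D a b + D a c.
  by rewrite /D wmulDr !loop_evalD// mulmxDr opprD addrACA.
have DN a b : N (D a b) <= 2 * wnorm a * wnorm b.
  rewrite -mulrA mulr_natl mulr2n (le_trans (mnormB _ _ _))// lerD//.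
    exact: le_trans (mnorm_loop_eval _ z1) (wnormM _ _).
  by rewrite (le_trans (mnormM _ _ _))// ler_pM ?mnorm_ge0 ?mnorm_loop_eval.
have Dsmall (a b : wiener N) (e : R) : 0 < e -> exists2 d : R, 0 < d &
    forall c, wnorm c < d -> N (D a c) <= e /\ N (D c b) <= e.
  move=> e0; set C := 2 * (wnorm a + wnorm b) + 1.
  have C0 : 0 < C by rewrite ltr_wpDl// mulr_ge0// addr_ge0 ?wnorm_ge0.
  exists (e / C) => [|c]; first by rewrite divr_gt0.
  rewrite ltr_pdivlMr// => /ltW cC.
  have := wnorm_ge0 a; have := wnorm_ge0 b; have := wnorm_ge0 c => c0 b0 a0.
  by split; rewrite (le_trans (DN _ _))// (le_trans _ cC)// /C; nra.
move: y; apply: (@wiener_density_ind _ _ N (fun y => D x y = 0)).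
- by rewrite /D wmul0r !loop_eval0 mulmx0 subrr.
- by move=> a b; rewrite Dr => -> ->; rewrite addr0.
- move=> B j; move: x; apply: (@wiener_density_ind _ _ N (fun x => D x _ = 0)).
  + by rewrite /D wmul0l !loop_eval0 mul0mx subrr.
  + by move=> a b; rewrite Dl => -> ->; rewrite addr0.
  + move=> A i; rewrite /D wmul_mono !loop_eval_mono -scalemxAl -scalemxAr.
    by rewrite scalerA expfzDr// subrr.
  + move=> a h; apply: (@mnorm_eq0_small _ _ N) => e e0.
    have [d d0 dP] := Dsmall 0 (mono N B j) e e0; have [c c0 ac] := h d d0.
    rewrite -(subrK c a) Dl c0 addr0; exact: (dP _ ac).2.
- move=> a h; apply: (@mnorm_eq0_small _ _ N) => e e0.
  have [d d0 dP] := Dsmall x 0 e e0; have [c c0 ac] := h d d0.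
  rewrite -(subrK c a) Dr c0 addr0; exact: (dP _ ac).1.
Qed.

End LoopEval.

(** * The complex exponential and roots of unity *)

Section ComplexExp.
Context (R : realType).
Implicit Types (z w : Cx R) (t : R).

Definition cexp z : Cx R := real_cx (expR (complex.Re z)) * cis (complex.Im z).

Definition icx : Cx R := (0 +i* 1)%C.

(** The period 2 pi i of [cexp]; it has nothing to do with the involution tau. *)
Definition tau2 : Cx R := real_cx (2 * pi) * icx.

Lemma cisD (s t : R) : cis (s + t) = cis s * cis t.
Proof.
rewrite /cis cosD sinD; apply/eqP.
by rewrite eq_complex /= eqxx /= addrC.
Qed.

Lemma cabs_cis t : cabs (cis t) = 1.
Proof. by rewrite /cabs normc_def /= cos2Dsin2 sqrtr1. Qed.

Lemma cexpD z w : cexp (z + w) = cexp z * cexp w.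
Proof.
rewrite /cexp (raddfD (@complex.Re R)) (raddfD (@complex.Im R)) expRD cisD.
by rewrite /real_cx rmorphM mulrACA.
Qed.

Lemma cexp0 : cexp 0 = 1.
Proof.
rewrite /cexp /= expR0 /cis cos0 sin0 /real_cx mul1r.
by apply/eqP; rewrite eq_complex /= !eqxx.
Qed.

Lemma cabs_cexp z : cabs (cexp z) = expR (complex.Re z).
Proof. by rewrite /cexp cabsM cabs_cis mulr1 cabs_real ger0_norm ?expR_ge0. Qed.

Lemma cexp_neq0 z : cexp z != 0.
Proof. by rewrite -cabs_gt0 cabs_cexp expR_gt0. Qed.

Lemma cexpN z : cexp (- z) = (cexp z)^-1.
Proof. by apply: (mulfI (cexp_neq0 z)); rewrite -cexpD subrr cexp0 divff ?cexp_neq0. Qed.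

Lemma cexpMn z (k : nat) : cexp (k%:R * z) = cexp z ^+ k.
Proof.
elim: k => [|k IH]; first by rewrite mul0r cexp0.
by rewrite -natr1 mulrDl mul1r cexpD IH exprSr.
Qed.

Lemma cexpMz z (k : int) : cexp (k%:~R * z) = cexp z ^ k.
Proof.
case: k => k; first exact: cexpMn.
by rewrite NegzE mulrNz mulNr cexpN cexpMn -exprnN.
Qed.

Lemma Re_realM t z : complex.Re (real_cx t * z) = t * complex.Re z.
Proof. by case: z => x y /=; rewrite mul0r subr0. Qed.

Lemma Im_realM t z : complex.Im (real_cx t * z) = t * complex.Im z.
Proof. by case: z => x y /=; rewrite mul0r addr0. Qed.

Lemma cexp_icx t : cexp (real_cx t * icx) = cis t.
Proof. by rewrite /cexp Re_realM Im_realM mulr0 mulr1 expR0 /real_cx mul1r. Qed.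

Lemma cexp_tau2 : cexp tau2 = 1.
Proof.
rewrite cexp_icx /cis mulr_natl cos2pi sin2pi.
by apply/eqP; rewrite eq_complex /= !eqxx.
Qed.

Lemma cabs_icx : cabs icx = 1.
Proof. by rewrite /cabs normc_def /= expr0n expr1n add0r sqrtr1. Qed.

Lemma cabs_tau2 : cabs tau2 = 2 * pi.
Proof. by rewrite cabsM cabs_icx mulr1 cabs_real ger0_norm// mulr_ge0// pi_ge0. Qed.

Lemma tau2_neq0 : tau2 != 0.
Proof. by rewrite -cabs_gt0 cabs_tau2 mulr_gt0// pi_gt0. Qed.

Lemma cabs_cexp_tau2 t : cabs (cexp (real_cx t * tau2)) = 1.
Proof. by rewrite cabs_cexp !Re_realM !mulr0 expR0. Qed.

(** By the half-angle formula cos t = 1 - 2 sin^2 (t / 2), and sin is positive between 0 and pi. *)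
Lemma cis_eq1 t : 0 < t < 2 * pi -> cis t != 1.
Proof.
move=> /andP[t0 t2]; rewrite eq_complex /= negb_and; apply/orP; left.
have t22 : 0 < t / 2 < pi by rewrite divr_gt0// ltr_pdivrMr// mulrC.
have : 0 < sin (t / 2) by apply: sin_gt0_pi.
have := cos2Dsin2 (t / 2) => h1 h2.
rewrite [t](_ : _ = t / 2 + t / 2); last by rewrite -splitr.
rewrite cosD; apply/eqP => h; nra.
Qed.

(** This is the l-th power of the primitive 2^M-th root of unity, and 2^M does not divide l. It is
    the condition under which a midpoint sum of exp (l z) over a full period vanishes exactly. *)
Lemma cexp_root_neq1 (l : int) M : l != 0 -> (`|l| < 2 ^ M)%N ->
  cexp (l%:~R * (tau2 / 2 ^+ M)) != 1.
Proof.
move=> l0 lM; wlog lp : l l0 lM / exists k : nat, l = k.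
  move=> H; case: l l0 lM => k l0 lM; first by apply: H => //; exists k.
  rewrite NegzE mulrNz mulNr cexpN invr_eq1; apply: (H (Posz k.+1)) => //.
  by exists k.+1.
case: lp => k lk; move: l0 lM; rewrite {}lk => k0 kM.
have -> : k%:~R * (tau2 / 2 ^+ M) = real_cx (k%:R * (2 * pi) / 2 ^+ M) * icx.
  rewrite /tau2 /real_cx !rmorphM fmorphV rmorphXn/= !rmorph_nat.
  by rewrite -[in LHS]pmulrn; ring.
rewrite cexp_icx cis_eq1//; have pi0 := pi_gt0 R.
have k0' : (0 : R) < k%:R by rewrite ltr0n lt0n.
have kM' : (k%:R : R) < 2 ^+ M by rewrite -natrX ltr_nat.
have M0 : (0 : R) < 2 ^+ M by rewrite exprn_gt0.
rewrite divr_gt0 ?mulr_gt0//= ltr_pdivrMr// mulrC ltr_pM2l// mulr_gt0//.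
Qed.

End ComplexExp.

(** * Midpoint sums in place of path integrals *)

Section MidpointSum.
Context (R : realType) (V : lmodType (Cx R)).
Implicit Types (f g : Cx R -> V) (a h : Cx R).

(* Midpoint sums over 2 ^ M pieces of [a, a + h] stand in for path integrals. *)
Fixpoint midsum M f a h : V :=
  if M is M'.+1 then midsum M' f a (h / 2) + midsum M' f (a + h / 2) (h / 2)
  else h *: f (a + h / 2).

Lemma midsumD M f g a h : midsum M (fun z => f z + g z) a h = midsum M f a h + midsum M g a h.
Proof. by elim: M a h => [|M IH] a h /=; rewrite ?scalerDr// !IH addrACA. Qed.

Lemma midsumZ M (c : Cx R) f a h : midsum M (fun z => c *: f z) a h = c *: midsum M f a h.
Proof.
elim: M a h => [|M IH] a h /=; first by rewrite !scalerA mulrC.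
by rewrite !IH scalerDr.
Qed.

Lemma midsumB M f g a h : midsum M (fun z => f z - g z) a h = midsum M f a h - midsum M g a h.
Proof.
rewrite -(scaleN1r (midsum M g a h)) -midsumZ -midsumD; congr midsum.
by apply/funext => z; rewrite scaleN1r.
Qed.

(** The midpoint rule is exact on affine functions, at every level of subdivision. This is what
    makes the linear part of a differentiable function disappear in the proof of Goursat's
    theorem. *)
Lemma midsum_affine M (A D : V) z0 a h :
  midsum M (fun z => A + (z - z0) *: D) a h =
  h *: A + (h * (a + h / 2 - z0)) *: D.
Proof.
elim: M a h => [|M IH] a h /=; first by rewrite scalerDr scalerA.
rewrite !IH addrACA -[_ *: A + _]scalerDl -[X in _ + X]scalerDl.
by congr (_ *: _ + _ *: _); field.
Qed.

Lemma midsum_cst M (A : V) a h : midsum M (fun=> A) a h = h *: A.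
Proof.
have := midsum_affine M A 0 0 a h; rewrite scaler0 addr0 => <-.
by congr midsum; apply/funext => z; rewrite scaler0 addr0.
Qed.

Lemma midsum_translate M f u a h : midsum M (fun z => f (z + u)) a h = midsum M f (a + u) h.
Proof.
elim: M a h => [|M IH] a h /=; first by rewrite addrAC.
by rewrite !IH addrAC.
Qed.

(** The second half of the sum is the first half times w = exp (l h / 2), and w^2 = 1. If w = -1 the
    halves cancel; if w = 1 the first half vanishes by induction. *)
Lemma midsum_cexp M (l : int) (A : V) a h :
  cexp (l%:~R * h) = 1 -> cexp (l%:~R * (h / 2 ^+ M)) != 1 ->
  midsum M (fun z => cexp (l%:~R * z) *: A) a h = 0.
Proof.
elim: M a h => [|M IH] a h h1 hM; first by move: hM; rewrite expr0 divr1 h1 eqxx.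
rewrite /= [X in _ + X](_ : _ = cexp (l%:~R * (h / 2)) *:
  midsum M (fun z => cexp (l%:~R * z) *: A) a (h / 2)); last first.
  rewrite -midsum_translate -midsumZ; congr midsum; apply/funext => z.
  by rewrite mulrDr cexpD scalerA mulrC.
have : cexp (l%:~R * (h / 2)) ^+ 2 == 1.
  by rewrite expr2 -cexpD -mulrDr -splitr h1.
rewrite sqrf_eq1 => /orP[/eqP e1|/eqP ->]; last by rewrite scaleN1r subrr.
rewrite IH ?scaler0 ?addr0//; move: hM; congr (cexp (_ * _) != 1).
by rewrite exprS invfM mulrA.
Qed.

End MidpointSum.

Section MidpointSumNorm.
Context (R : realType) (n : nat) (N : matnorm R n).
Implicit Types (f g : Cx R -> 'M[Cx R]_n) (a h : Cx R).

Lemma cabs_half h : cabs (h / 2) = cabs h / 2.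
Proof. by rewrite cabsM cabsV -(@real_cx_nat R 2) cabs_real ger0_norm. Qed.

Lemma mnorm_midsum M f a h (B : R) :
  (forall t : R, 0 <= t <= 1 -> N (f (a + real_cx t * h)) <= B) ->
  N (midsum M f a h) <= cabs h * B.
Proof.
have r2 : real_cx (1 / 2 : R) = 1 / 2 by rewrite /real_cx rmorphM fmorphV rmorph_nat rmorph1.
have rcM (s t : R) : real_cx (s * t) = real_cx s * real_cx t by rewrite /real_cx rmorphM.
have rcD (s t : R) : real_cx (s + t) = real_cx s + real_cx t by rewrite /real_cx rmorphD.
have rc1 : real_cx 1 = 1 :> Cx R by [].
elim: M a h => [|M IH] a h H.
  rewrite mnormZabs ler_wpM2l ?cabs_ge0// (_ : h / 2 = real_cx (1 / 2) * h).
    by apply: H; lra.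
  by rewrite r2 mulrC div1r.
rewrite (le_trans (mnormD _ _ _))// [leRHS](_ : _ = cabs (h / 2) * B + cabs (h / 2) * B).
  apply: lerD; apply: IH => t /andP[t0 t1].
    rewrite (_ : real_cx t * _ = real_cx (t * (1 / 2)) * h); first by apply: H; lra.
    by rewrite rcM r2; field.
  rewrite (_ : a + _ + _ = a + real_cx ((t + 1) * (1 / 2)) * h); first by apply: H; lra.
  by rewrite rcM rcD r2 rc1; field.
by rewrite cabs_half; field.
Qed.

Lemma midsum_ext M f g a h :
  (forall t : R, 0 <= t <= 1 -> f (a + real_cx t * h) = g (a + real_cx t * h)) ->
  midsum M f a h = midsum M g a h.
Proof.
move=> H; apply/eqP; rewrite -subr_eq0 -midsumB; apply/eqP/(mnorm_eq0 (m := N)).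
apply/eqP; rewrite eq_le mnorm_ge0 andbT -(mulr0 (cabs h)); apply: mnorm_midsum.
by move=> t /H ->; rewrite subrr mnorm0.
Qed.

End MidpointSumNorm.

(** * Fourier coefficients as averages, and the algebra laws *)

Section Fourier.
Context (R : realType) (n : nat) (N : matnorm R n).
Implicit Types (x y : wiener N) (f : Cx R -> 'M[Cx R]_n).

(** The mean of [f] over the 2^M points exp (2 pi i (2 j + 1) / 2^(M + 1)), written as a midpoint
    sum in the coordinate w of z = exp w so that contour sums apply to it. *)
Definition circ_avg M f : 'M[Cx R]_n :=
  (tau2 R)^-1 *: midsum M (fun w => f (cexp w)) 0 (tau2 R).

Lemma circ_avgD M f g : circ_avg M (fun z => f z + g z) = circ_avg M f + circ_avg M g.
Proof. by rewrite /circ_avg midsumD scalerDr. Qed.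

Lemma circ_avg_ext M f g : (forall z, cabs z = 1 -> f z = g z) ->
  circ_avg M f = circ_avg M g.
Proof.
move=> fg; rewrite /circ_avg; congr (_ *: _); apply: (@midsum_ext _ _ N) => t _.
by rewrite add0r fg// cabs_cexp_tau2.
Qed.

Lemma mnorm_circ_avg M f (B : R) : (forall z, cabs z = 1 -> N (f z) <= B) ->
  N (circ_avg M f) <= B.
Proof.
move=> fB; rewrite mnormZabs cabsV -ler_pdivlMl ?invr_gt0; last first.
  by rewrite cabs_gt0 tau2_neq0.
rewrite invrK; apply: mnorm_midsum => t _.
by rewrite add0r fB// cabs_cexp_tau2.
Qed.

Lemma circ_avg_exp M (l : int) A : (`|l| < 2 ^ M)%N ->
  circ_avg M (fun z => z ^ l *: A) = if l == 0 then A else 0.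
Proof.
move=> lM; rewrite /circ_avg (_ : (fun w => _) = (fun w => cexp (l%:~R * w) *: A)).
  case: eqVneq lM => [->|l0] lM.
    rewrite (_ : (fun w => _) = (fun=> A)).
      by rewrite midsum_cst scalerA mulVf ?tau2_neq0// scale1r.
    by apply/funext => w; rewrite mul0r cexp0 scale1r.
  rewrite midsum_cexp ?scaler0//; last exact: cexp_root_neq1.
  by rewrite cexpMz cexp_tau2 expr1n || rewrite cexpMz cexp_tau2 exp1rz.
by apply/funext => w; rewrite cexpMz.
Qed.

(** The rotation [c] and the exponent [j] cover the substitutions that occur in automorphisms and in
    the coordinate 1 / z. The error is exactly zero on a monomial for large M and bounded by twice
    the norm of the loop for every M, so density concludes. *)
Lemma fourier_coef (c : Cx R) (j k : int) x : cabs c = 1 -> j = 1 \/ j = -1 ->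
  forall e : R, 0 < e -> exists M0, forall M, (M0 <= M)%N ->
  N (circ_avg M (fun z => z ^ (- k) *: loop_eval x (c * z ^ j)) -
     c ^ (j * k) *: x (j * k)) < e.
Proof.
move=> c1 j1.
have jj : j * j = 1 by case: j1 => ->.
have cz z : cabs z = 1 -> cabs (c * z ^ j) = 1.
  by move=> z1; rewrite cabsM c1 mul1r cabs_exprz.
pose D M x := circ_avg M (fun z => z ^ (- k) *: loop_eval x (c * z ^ j)) -
     c ^ (j * k) *: x (j * k).
have DD M (a b : wiener N) : D M (a + b) = D M a + D M b.
  rewrite /D (_ : (a + b) (j * k) = a (j * k) + b (j * k))//.
  have -> : circ_avg M (fun z => z ^ (- k) *: loop_eval (a + b) (c * z ^ j)) =
      circ_avg M (fun z => z ^ (- k) *: loop_eval a (c * z ^ j)) +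
      circ_avg M (fun z => z ^ (- k) *: loop_eval b (c * z ^ j)).
    rewrite -circ_avgD; apply: circ_avg_ext => z z1.
    by rewrite loop_evalD ?cz// scalerDr.
  by rewrite scalerDr opprD addrACA.
have DN M (a : wiener N) : N (D M a) <= 2 * wnorm a.
  rewrite mulr_natl mulr2n (le_trans (mnormB _ _ _))// lerD//.
    apply: mnorm_circ_avg => z z1; rewrite mnormZabs cabs_exprz// mul1r.
    by rewrite mnorm_loop_eval// cz.
  by rewrite mnormZabs cabs_exprz// mul1r mnorm_coef.
move: x; apply: (@wiener_density_ind _ _ N (fun x => forall e : R, 0 < e ->
  exists M0, forall M, (M0 <= M)%N -> N (D M x) < e)).
- move=> e e0; exists 0 => M _; suff -> : D M 0 = 0 by rewrite mnorm0.
  by apply: (addrI (D M 0)); rewrite -DD !addr0.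
- move=> x y hx hy e e0; have e20 : 0 < e / 2 by rewrite divr_gt0.
  have [M1 h1] := hx _ e20; have [M2 h2] := hy _ e20.
  exists (maxn M1 M2) => M; rewrite geq_max => /andP[/h1 m1 /h2 m2].
  by rewrite DD (le_lt_trans (mnormD _ _ _))// [ltRHS]splitr ltrD.
(* The average is exact once 2^M > |j l - k|, and M < 2^M. *)
- move=> A l e e0; exists (absz (j * l - k)%R) => M lM.
  suff -> : D M (mono N A l) = 0 by rewrite mnorm0.
  apply/eqP; rewrite subr_eq0; apply/eqP; rewrite monoE.
  rewrite (@circ_avg_ext _ _ (fun z => z ^ (j * l - k) *: (c ^ l *: A))).
    rewrite circ_avg_exp; last by rewrite (leq_ltn_trans lM)// ltn_expl.
    rewrite subr_eq0 (_ : (j * l == k) = (j * k == l)); last first.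
      by apply/eqP/eqP => <-; rewrite mulrA jj mul1r.
    by case: eqP => [->|]; rewrite ?scaler0.
  move=> z z1; have z0 : z != 0 by rewrite -cabs_gt0 z1.
  have zE : z ^ (- k) * (c * z ^ j) ^ l = z ^ (j * l - k) * c ^ l.
    by rewrite expfzMl exprz_exp addrC expfzDr// -mulrA [c ^ l * _]mulrC.
  by rewrite loop_eval_mono scalerA zE -scalerA.
- move=> x h e e0; have [y hy xy] := h (e / 4) (divr_gt0 e0 (ltr0Sn _ _)).
  have [M0 hM] := hy (e / 4) (divr_gt0 e0 (ltr0Sn _ _)); exists M0 => M /hM MM.
  rewrite -(subrK y x) DD (le_lt_trans (mnormD _ _ _))//.
  by have := DN M (x - y); lra.
Qed.

(** Coefficients are limits of averages of values. From here on the laws of [wmul], associativity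
    first of all, are read off from matrices at each point of the circle. *)
Lemma loop_eval_inj x y : (forall z, cabs z = 1 -> loop_eval x z = loop_eval y z) ->
  x = y.
Proof.
move=> xy; apply/eqP; rewrite -subr_eq0; apply/eqP/wienerE => k.
apply: (@mnorm_eq0_small _ _ N) => e e0.
have [M0 /(_ M0 (leqnn _))] := @fourier_coef 1 1 k (x - y) (cabs1 R) (or_introl erefl) e e0.
rewrite exp1rz scale1r mul1r (@circ_avg_ext _ _ (fun=> 0)); last first.
  move=> z z1; rewrite mul1r expr1z loop_evalB// xy// subrr scaler0//.
rewrite /circ_avg midsum_cst !scaler0 add0r mnormN => /ltW; exact.
Qed.

Lemma wmulA x y z : wmul x (wmul y z) = wmul (wmul x y) z.
Proof. by apply: loop_eval_inj => t t1; rewrite !loop_evalM// mulmxA. Qed.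

Lemma wmul1 x : wmul x (wone N) = x.
Proof. by apply: loop_eval_inj => t t1; rewrite loop_evalM// loop_eval_one mulmx1. Qed.

Lemma wmul1l x : wmul (wone N) x = x.
Proof. by apply: loop_eval_inj => t t1; rewrite loop_evalM// loop_eval_one mul1mx. Qed.

Lemma winvE x y : wmul x y = wone N -> wmul y x = wone N -> winv x = y.
Proof.
move=> xy yx; rewrite /winv; case: xgetP => [w _ [xw wx]|/(_ y)]; last by case.
by rewrite -(wmul1 w) -xy wmulA wx wmul1l.
Qed.

End Fourier.

(** * Goursat's theorem *)

Section RealDeriveBound.
Context (R : realType).

Lemma is_derive_bound (f : R -> R) (x d : R) : is_derive x 1 f d ->
  forall e : R, 0 < e -> exists2 r : R, 0 < r &
    forall h, `|h| < r -> `|f (x + h) - f x - h * d| <= e * `|h|.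
Proof.
move=> [df dE] e e0; have := df; rewrite /derivable => /cvg_ex[l fl].
have ld : l = d by rewrite -dE; apply/esym/cvg_lim.
rewrite {}ld in fl; move/cvgrPdist_lt : fl => /(_ e e0)/nbhs_ballP[r /= r0 rP].
exists r => // h hr; have [->|h0] := eqVneq h 0.
  by rewrite addr0 subrr mul0r subr0 normr0 mulr0.
have := rP h; rewrite -ball_normE /ball_ /= sub0r normrN => /(_ hr h0) /ltW.
rewrite -(ler_pM2r (_ : 0 < `|h|)) ?normr_gt0// -normrM distrC; apply: le_trans.
rewrite le_eqVlt; apply/orP; left; apply/eqP; congr (`| _ |).
rewrite [h%:A]mulr1 [h + x]addrC mulrBl [_ *: _ * _]mulrAC mulVf// mul1r.
by rewrite mulrC.
Qed.

End RealDeriveBound.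

(** * The derivative of the complex exponential *)

Section CexpDerivative.
Context (R : realType).
Implicit Types (z w : Cx R).

Lemma cx_ReD z w : complex.Re (z + w) = complex.Re z + complex.Re w.
Proof. exact: (raddfD (@complex.Re R)). Qed.

Lemma cx_ImD z w : complex.Im (z + w) = complex.Im z + complex.Im w.
Proof. exact: (raddfD (@complex.Im R)). Qed.

Lemma Re_cabs z : `|complex.Re z| <= cabs z.
Proof. exact: Re_le_cx_norm. Qed.

Lemma Im_cabs z : `|complex.Im z| <= cabs z.
Proof. exact: Im_le_cx_norm. Qed.

Lemma cabs_le z : cabs z <= `|complex.Re z| + `|complex.Im z|.
Proof. exact: cx_norm_le. Qed.

Lemma cexp_diff0 (e : R) : 0 < e -> exists2 r : R, 0 < r &
  forall z, cabs z < r -> cabs (cexp z - 1 - z) <= e * cabs z.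
Proof.
(* The real part of the remainder collects three errors of size [e / 8 * cabs z] and the imaginary
   part four. *)
move=> e0; have e8 : 0 < e / 8 by lra.
have [r1 r10 H1] := is_derive_bound (is_derive_expR (0 : R)) e8.
have [r2 r20 H2] := is_derive_bound (is_derive_cos (0 : R)) e8.
have [r3 r30 H3] := is_derive_bound (is_derive_sin (0 : R)) e8.
exists (Num.min (Num.min r1 (Num.min r2 r3)) (Num.min 1 (e / 8))) => [|z].
  by rewrite !lt_min r10 r20 r30 ltr01 e8.
rewrite !lt_min => /andP[/andP[zr1 /andP[zr2 zr3]] /andP[z1 ze]].
set x := complex.Re z; set y := complex.Im z.
have xz : `|x| <= cabs z by exact: Re_cabs.
have yz : `|y| <= cabs z by exact: Im_cabs.
have := H1 x (le_lt_trans xz zr1); rewrite add0r expR0 mulr1 => {}H1.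
have := H2 y (le_lt_trans yz zr2); rewrite add0r cos0 sin0 oppr0 mulr0 subr0 => {}H2.
have := H3 y (le_lt_trans yz zr3); rewrite add0r cos0 sin0 mulr1 subr0 => {}H3.
have z0 := cabs_ge0 z.
rewrite (le_trans (cabs_le _))// cx_ReB cx_ReB cx_ImB cx_ImB.
rewrite [complex.Re (cexp z)]Re_realM [complex.Im (cexp z)]Im_realM /=.
rewrite -/x -/y subr0.
set E := expR x in H1 *; set c := cos y in H2 *; set s := sin y in H3 *.
have cz : `|c| <= 1 by exact: cos_max.
have sz : `|s| <= 1 by exact: sin_max.
have e8z : 0 <= e / 8 * cabs z by rewrite mulr_ge0// ltW.
have H1' : `|E - 1 - x| <= e / 8 * cabs z.
  by rewrite (le_trans H1)// ler_wpM2l// ltW.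
have H2' : `|c - 1| <= e / 8 * cabs z.
  by rewrite (le_trans H2)// ler_wpM2l// ltW.
have H3' : `|s - y| <= e / 8 * cabs z.
  by rewrite (le_trans H3)// ler_wpM2l// ltW.
have xc : `|x * (c - 1)| <= e / 8 * cabs z.
  rewrite normrM -[leRHS]mul1r ler_pM// (le_trans xz)// ltW//.
have xs : `|x * s| <= e / 8 * cabs z + cabs z * (e / 8 * cabs z).
  rewrite (_ : x * s = x * (s - y) + x * y); last by rewrite -mulrDr subrK.
  rewrite (le_trans (ler_normD _ _))// !normrM addrC lerD//.
    by rewrite ler_pM//; apply: (le_trans xz); apply: ltW.
  by apply: ler_pM.
have E1 : E * c - 1 - x = (E - 1 - x) * c + x * (c - 1) + (c - 1) by ring.
have E2 : E * s - y = (E - 1 - x) * s + x * s + (s - y) by ring.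
have A1 : `|E * c - 1 - x| <= 3 * (e / 8 * cabs z).
  rewrite E1 (le_trans (ler_normD _ _))// [leRHS](_ : _ = 2 * (e / 8 * cabs z) + e / 8 * cabs z); last by ring.
  rewrite lerD// (le_trans (ler_normD _ _))// [leRHS](_ : _ = (e / 8 * cabs z) + e / 8 * cabs z); last by ring.
  by rewrite lerD// normrM -[leRHS]mulr1 ler_pM.
have A2 : `|E * s - y| <= 4 * (e / 8 * cabs z).
  rewrite E2 (le_trans (ler_normD _ _))// [leRHS](_ : _ = 3 * (e / 8 * cabs z) + e / 8 * cabs z); last by ring.
  rewrite lerD// (le_trans (ler_normD _ _))// [leRHS](_ : _ = (e / 8 * cabs z) + 2 * (e / 8 * cabs z)); last by ring.
  rewrite lerD//; first by rewrite normrM -[leRHS]mulr1 ler_pM.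
  rewrite (le_trans xs)// [leRHS](_ : _ = e / 8 * cabs z + e / 8 * cabs z); last by ring.
  by rewrite lerD// -[leRHS]mul1r ler_wpM2r// ltW.
by rewrite (le_trans (lerD A1 A2))//; lra.
Qed.

Lemma cexp_continuous z0 (e : R) : 0 < e -> exists2 r : R, 0 < r &
  forall z, cabs (z - z0) < r -> cabs (cexp z - cexp z0) < e.
Proof.
move=> e0; have [r r0 H] := cexp_diff0 ltr01.
have C0 : 0 < 3 * cabs (cexp z0) by rewrite mulr_gt0// cabs_gt0 cexp_neq0.
exists (Num.min r (e / (3 * cabs (cexp z0)))); first by rewrite lt_min r0 divr_gt0.
move=> z; rewrite lt_min ltr_pdivlMr// => /andP[/H + zz].
rewrite (_ : cexp z - cexp z0 = cexp z0 * (cexp (z - z0) - 1)); last first.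
  by rewrite mulrBr mulr1 -cexpD addrCA subrr addr0.
rewrite cabsM mul1r => h; have := cabsD (cexp (z - z0) - 1 - (z - z0)) (z - z0).
by rewrite subrK; have := cabs_ge0 (z - z0); have := cabs_ge0 (cexp z0); nra.
Qed.

End CexpDerivative.

(** * Contour sums over rectangles and circles *)

Section Goursat.
Context (R : realType) (n : nat) (N : matnorm R n).
Implicit Types (f h : Cx R -> 'M[Cx R]_n) (a z w : Cx R) (u v : R).

Definition cdiff f z := exists D : 'M[Cx R]_n, forall e : R, 0 < e ->
  exists2 r : R, 0 < r & forall w, cabs (w - z) < r ->
    N (f w - (f z + (w - z) *: D)) <= e * cabs (w - z).

(** The counterclockwise boundary sum of the rectangle with lower left corner [a] and sides [u],
    [v]. *)
Definition rect M f a u v := midsum M f a (real_cx u) + midsum M f (a + real_cx u) (real_cx v * icx R)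
  - midsum M f (a + real_cx v * icx R) (real_cx u) - midsum M f a (real_cx v * icx R).

Lemma real_cx_half u : real_cx (u / 2) = real_cx u / 2.
Proof. by rewrite /real_cx rmorphM fmorphV rmorph_nat. Qed.

(** Exact, because [midsum] at level [M.+1] is by definition the sum of two halves at level [M]; the
    inner edges cancel in pairs. *)
Lemma rect_split M f a u v : rect M.+1 f a u v =
  rect M f a (u / 2) (v / 2) + rect M f (a + real_cx (u / 2)) (u / 2) (v / 2) +
  rect M f (a + real_cx (v / 2) * icx R) (u / 2) (v / 2) +
  rect M f (a + (real_cx (u / 2) + real_cx (v / 2) * icx R)) (u / 2) (v / 2).
Proof.
rewrite /rect /= !real_cx_half.
set p := real_cx u / 2; set q := real_cx v / 2 * icx R.
rewrite (_ : real_cx v * icx R / 2 = q); last by rewrite /q mulrAC.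
have pp : real_cx u = p + p by rewrite /p; field.
have qq : real_cx v * icx R = q + q by rewrite /q; field.
rewrite pp qq -!addrA [q + p]addrC !(addrCA q p).
apply/matrixP => i j; rewrite !mxE; ring.
Qed.

Lemma rect_affine M (A D : 'M[Cx R]_n) z0 a u v :
  rect M (fun z => A + (z - z0) *: D) a u v = 0.
Proof.
rewrite /rect !midsum_affine; apply/matrixP => i j; rewrite !mxE.
by field.
Qed.

Lemma rectB M f h a u v : rect M (fun z => f z - h z) a u v = rect M f a u v - rect M h a u v.
Proof. by rewrite /rect !midsumB; apply/matrixP => i j; rewrite !mxE; ring. Qed.

Lemma rect_bound M f a u v (B : R) : 0 <= u -> 0 <= v ->
  (forall s t : R, 0 <= s <= 1 -> 0 <= t <= 1 ->
    N (f (a + real_cx (s * u) + real_cx (t * v) * icx R)) <= B) ->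
  N (rect M f a u v) <= 2 * (u + v) * B.
Proof.
move=> u0 v0 H.
have rcM (s t : R) : real_cx (s * t) = real_cx s * real_cx t by rewrite /real_cx rmorphM.
have h01 : 0 <= (0 : R) <= 1 by rewrite lexx ler01.
have h11 : 0 <= (1 : R) <= 1 by rewrite lexx ler01.
have cu : cabs (real_cx u) = u by rewrite cabs_real ger0_norm.
have cv : cabs (real_cx v * icx R) = v by rewrite cabsM cabs_icx mulr1 cabs_real ger0_norm.
rewrite [leRHS](_ : _ = u * B + v * B + u * B + v * B); last by ring.
rewrite (le_trans (mnormB _ _ _))// lerD//; last first.
  rewrite -{2}cv; apply: mnorm_midsum => t t01; rewrite mulrA -rcM.
  by have := H 0 t h01 t01; rewrite mul0r (_ : real_cx 0 = 0)// addr0.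
rewrite (le_trans (mnormB _ _ _))// lerD//; last first.
  rewrite -{2}cu; apply: mnorm_midsum => t t01; rewrite -rcM.
  by have := H t 1 t01 h11; rewrite mul1r addrAC.
rewrite (le_trans (mnormD _ _ _))// lerD//.
  rewrite -{2}cu; apply: mnorm_midsum => t t01; rewrite -rcM.
  by have := H t 0 t01 h01; rewrite mul0r (_ : real_cx 0 = 0)// mul0r addr0.
rewrite -{2}cv; apply: mnorm_midsum => t t01; rewrite mulrA -rcM.
by have := H 1 t h11 t01; rewrite mul1r.
Qed.

(** Goursat's quartering argument. The bound is additive over the four quarters, so a rectangle that
    violates it has a quarter that does, and the nested rectangles shrink to a point of
    differentiability. Since each subdivision consumes one level of [midsum], the bound is asked
    only for all large [M], with a threshold depending on the rectangle. *)
Lemma goursat f a u v : 0 < u -> 0 < v ->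
  (forall z, complex.Re a <= complex.Re z <= complex.Re a + u ->
     complex.Im a <= complex.Im z <= complex.Im a + v -> cdiff f z) ->
  forall e : R, 0 < e -> exists M0, forall M, (M0 <= M)%N ->
    N (rect M f a u v) <= e * (u ^+ 2 + v ^+ 2).
Proof.
move=> u0 v0 fd e e0.
pose good (s : nat * Cx R) := exists M0, forall M, (M0 <= M)%N ->
  N (rect M f s.2 (u / 2 ^+ s.1) (v / 2 ^+ s.1)) <=
  e * ((u / 2 ^+ s.1) ^+ 2 + (v / 2 ^+ s.1) ^+ 2).
apply: contrapT => bad0; pose S := {s | ~ good s}.
have b0 : ~ good (0%N, a) by move: bad0; rewrite /good /= expr0 !divr1.
pose child (s s' : nat * Cx R) := s'.1 = s.1.+1 /\ exists i j : bool,
  s'.2 = s.2 + (real_cx (i%:R * (u / 2 ^+ s.1.+1)) + real_cx (j%:R * (v / 2 ^+ s.1.+1)) * icx R).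
have step (s : S) : {s' : S | child (sval s) (sval s')}.
  apply: cid; case: s => [[k b] /= kb]; apply: contrapT => H; apply: kb.
  have {}H (i j : bool) : good (k.+1, b + (real_cx (i%:R * (u / 2 ^+ k.+1)) +
      real_cx (j%:R * (v / 2 ^+ k.+1)) * icx R)).
    apply: contrapT => nb; apply: H; exists (exist (fun s => ~ good s) _ nb); split=> //=.
    by exists i, j.
  have [M1 H1] := H false false; have [M2 H2] := H true false.
  have [M3 H3] := H false true; have [M4 H4] := H true true.
  exists (maxn (maxn M1 M2) (maxn M3 M4)).+1 => -[//|M]; rewrite ltnS !geq_max.
  move=> /andP[/andP[/H1 {}H1 /H2 {}H2] /andP[/H3 {}H3 /H4 {}H4]].
  have half (t : R) : t / 2 ^+ k.+1 = t / 2 ^+ k / 2 by rewrite exprSr invfM mulrA.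
  have E0 (t : R) : real_cx (false%:R * t) = 0 by rewrite mul0r.
  have E1 (t : R) : real_cx (true%:R * t) = real_cx t by rewrite mul1r.
  move: H1 H2 H3 H4; rewrite /= !E0 !E1 !mul0r !addr0 !add0r.
  rewrite !half rect_split => H1 H2 H3 H4.
  rewrite (le_trans (mnormD _ _ _))// (le_trans (lerD (le_trans (mnormD _ _ _)
    (lerD (le_trans (mnormD _ _ _) (lerD H1 H2)) H3)) H4))//.
  by rewrite le_eqVlt; apply/orP; left; apply/eqP; field.
have [F [F0 FS]] := @dependent_choice S (fun s s' => child (sval s) (sval s')) step
  (exist (fun s => ~ good s) _ b0).
pose b k := (sval (F k)).2.
have F1 k : (sval (F k)).1 = k.
  by elim: k => [|k IH]; [rewrite F0|rewrite (FS k).1 IH].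
have Fbad k : ~ good (k, b k).
  by have := svalP (F k); rewrite [sval (F k)]surjective_pairing F1.
have bS k : exists i j : bool, b k.+1 = b k + (real_cx (i%:R * (u / 2 ^+ k.+1)) +
    real_cx (j%:R * (v / 2 ^+ k.+1)) * icx R).
  by have [_ [i [j ij]]] := FS k; exists i, j; rewrite /b ij F1.
have b00 : b 0%N = a by rewrite /b F0.
(* The corners converge coordinatewise to a point of all the nested rectangles. *)
have nested (p : Cx R -> R) (w : R) : 0 < w -> (forall k, exists i : bool,
    p (b k.+1) = p (b k) + i%:R * (w / 2 ^+ k.+1)) ->
    exists x, forall k, p (b k) <= x <= p (b k) + w / 2 ^+ k.
  move=> w0 pS.
  have hw k : 0 < w / 2 ^+ k by rewrite divr_gt0// exprn_gt0.
  have half k : w / 2 ^+ k = w / 2 ^+ k.+1 + w / 2 ^+ k.+1.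
    by rewrite exprSr invfM mulrA -splitr.
  have mono k m : p (b k) <= p (b (k + m)%N).
    elim: m => [|m IH]; first by rewrite addn0.
    rewrite addnS (le_trans IH)//; have [[] ->] := pS (k + m)%N.
      by rewrite mul1r lerDl ltW.
    by rewrite mul0r addr0.
  have mono' k m : p (b (k + m)%N) + w / 2 ^+ (k + m) <= p (b k) + w / 2 ^+ k.
    elim: m => [|m IH]; first by rewrite addn0.
    rewrite addnS (le_trans _ IH)//; have [[] ->] := pS (k + m)%N.
      by rewrite mul1r -addrA -half.
    by rewrite mul0r addr0 lerD2l [leRHS]half lerDl ltW.
  have ub k : ubound (range (p \o b)) (p (b k) + w / 2 ^+ k).
    move=> _ [m _ <-] /=; have [km|mk] := leqP k m.
      rewrite -(subnKC km) (le_trans _ (mono' k (m - k)%N))// lerDl ltW//.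
    by rewrite -(subnKC (ltnW mk)) (le_trans (mono m (k - m)%N))// lerDl ltW.
  exists (sup (range (p \o b))) => k; apply/andP; split.
    by apply: ub_le_sup; [exists (p (b 0%N) + w / 2 ^+ 0); exact: ub|exists k].
  by apply: ge_sup; [exists (p (b 0%N)); exists 0%N|exact: ub].
have [x xP] : exists x, forall k, complex.Re (b k) <= x <= complex.Re (b k) + u / 2 ^+ k.
  apply: nested => // k; have [i [j ->]] := bS k; exists i.
  by rewrite !cx_ReD Re_realM /= mulr0 addr0.
have [y yP] : exists y, forall k, complex.Im (b k) <= y <= complex.Im (b k) + v / 2 ^+ k.
  apply: nested => // k; have [i [j ->]] := bS k; exists j.
  by rewrite !cx_ImD Im_realM /= mulr1 add0r.
pose z0 : Cx R := (x +i* y)%C.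
have [D Dz] : cdiff f z0.
  by apply: fd; [have := xP 0%N|have := yP 0%N]; rewrite b00 expr0 divr1.
(* The perimeter 2 (U + V) times the error (e / 4)(U + V) is at most e (U^2 + V^2). *)
have [r r0 Dr] := Dz (e / 4) (divr_gt0 e0 (ltr0Sn _ _)).
have [k kr] : exists k, (u + v) / 2 ^+ k < r.
  have uv0 : 0 < u + v by rewrite addr_gt0.
  exists (Num.truncn ((u + v) / r)).+1; rewrite ltr_pdivrMr ?exprn_gt0//.
  rewrite mulrC -ltr_pdivrMr//; apply: (lt_trans (truncnS_gt _)).
  by rewrite -natrX ltr_nat ltn_expl.
apply: (Fbad k); exists 0%N => M _ /=.
set U := u / 2 ^+ k; set V := v / 2 ^+ k.
have U0 : 0 < U by rewrite divr_gt0// exprn_gt0.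
have V0 : 0 < V by rewrite divr_gt0// exprn_gt0.
rewrite -[rect _ _ _ _ _]subr0 -(rect_affine M (f z0) D z0 (b k) U V) -rectB.
apply: (@le_trans _ _ (2 * (U + V) * (e / 4 * (U + V)))); last first.
  by have : 0 <= (U - V) ^+ 2 := sqr_ge0 _; rewrite sqrrB => h; nra.
apply: rect_bound => [||s t /andP[s0 s1] /andP[t0 t1]]; [exact: ltW..|].
set w := _ + _ * icx R.
have wz : cabs (w - z0) <= U + V.
  rewrite (le_trans (cabs_le _))// cx_ReB cx_ImB /w.
  rewrite !cx_ReD !cx_ImD Re_realM Im_realM /=.
  have /andP[x1 x2] := xP k; have /andP[y1 y2] := yP k.
  rewrite -/U in x2; rewrite -/V in y2; rewrite mulr0 mulr1 !addr0.
  by apply: lerD; rewrite ler_norml; apply/andP; split; nra.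
rewrite (le_trans (Dr _ _))//; last by rewrite ler_wpM2l// divr_ge0// ltW.
by rewrite (le_lt_trans wz)// -mulrDl.
Qed.

Lemma cdiff_cexp f z : cdiff f (cexp z) -> cdiff (fun w => f (cexp w)) z.
Proof.
move=> [D fD]; exists (cexp z *: D) => e e0; set K := cabs (cexp z).
have K0 : 0 < K by rewrite cabs_gt0 cexp_neq0.
have ND := mnorm_ge0 N D.
have K2 : 0 < 2 * K * (N D + 1) by rewrite !mulr_gt0// ltr_wpDl.
have [r1 r10 H1] := fD _ (divr_gt0 e0 (mulr_gt0 (ltr0Sn R 3) K0)).
have [r2 r20 H2] := cexp_continuous z r10.
have [r3 r30 H3] := cexp_diff0 (divr_gt0 e0 K2).
have [r4 r40 H4] := cexp_diff0 (@ltr01 R).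
exists (Num.min r2 (Num.min r3 r4)) => [|w]; first by rewrite !lt_min r20 r30 r40.
rewrite !lt_min => /andP[/H2 w2 /andP[/H3 w3 /H4 w4]]; rewrite mul1r in w4.
have wz : cexp w - cexp z = cexp z * (cexp (w - z) - 1).
  by rewrite mulrBr mulr1 -cexpD addrCA subrr addr0.
have lip : cabs (cexp w - cexp z) <= K * (2 * cabs (w - z)).
  rewrite wz cabsM ler_wpM2l//; first by rewrite ltW.
  rewrite -(subrK (w - z) (cexp (w - z) - 1)).
  by rewrite (le_trans (cabsD _ _))// mulr_natl mulr2n lerD2r.
rewrite (_ : f (cexp w) - _ = (f (cexp w) - (f (cexp z) + (cexp w - cexp z) *: D)) +
   (cexp z * (cexp (w - z) - 1 - (w - z))) *: D); last first.
  by rewrite wz scalerA; apply/matrixP => i j; rewrite !mxE; ring.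
rewrite (le_trans (mnormD _ _ _))// mnormZabs cabsM (splitr e) mulrDl lerD//.
  apply: (le_trans (H1 _ w2)); apply: (le_trans (ler_wpM2l _ lip)).
    by rewrite ltW// divr_gt0// mulr_gt0.
  rewrite le_eqVlt; apply/orP; left; apply/eqP; rewrite -/K; field.
  by rewrite gt_eqF.
rewrite -/K (@le_trans _ _ (K * (e / (2 * K * (N D + 1)) * cabs (w - z)) * (N D + 1)))//.
  apply: ler_pM => //; [|by rewrite ler_wpM2l// ltW|by rewrite lerDl].
  by rewrite mulr_ge0 ?cabs_ge0// ltW.
rewrite le_eqVlt; apply/orP; left; apply/eqP; field.
by rewrite !gt_eqF// ltr_wpDl.
Qed.

Lemma midsum_period M f a u : (forall z, f (z + tau2 R) = f z) ->
  rect M f a u (2 * pi) = midsum M f (a + real_cx u) (tau2 R) - midsum M f a (tau2 R).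
Proof.
move=> fp; rewrite /rect -/(tau2 R) -(midsum_translate M f (tau2 R) a).
rewrite (_ : (fun z => f (z + tau2 R)) = f); last by apply/funext => z; rewrite fp.
by apply/matrixP => i j; rewrite !mxE; ring.
Qed.

(* The integral of f (cexp w) around a rectangle of height 2 pi is small: the
   horizontal sides cancel by periodicity, the vertical ones are averages of f over a
   tiny circle around 0 and over a circle close to the unit circle. *)
Lemma circ_avg_center f : (forall z, cabs z < 1 -> cdiff f z) ->
  (forall e : R, 0 < e -> exists2 r : R, 0 < r &
    forall s t : R, - r < s < 0 -> 0 <= t <= 1 ->
    N (f (cexp (real_cx s + real_cx t * tau2 R)) - f (cexp (real_cx t * tau2 R))) <= e) ->
  forall e : R, 0 < e -> exists M0, forall M, (M0 <= M)%N ->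
    N (circ_avg M f - f 0) <= e.
Proof.
move=> fd fb e e0; have e30 : 0 < e / 3 by lra.
have T0 : 0 < 2 * pi :> R by rewrite mulr_gt0// pi_gt0.
(* [A M s] is the average of [f] over the circle of radius exp s. It will be compared with
   [circ_avg] for [s1] near 0 and with [f 0] for a very negative [s0]. *)
pose A M s := (tau2 R)^-1 *: midsum M (fun w => f (cexp w)) (real_cx s) (tau2 R).
have AE M B s (c : R) : (forall t, 0 <= t <= 1 ->
    N (f (cexp (real_cx s + real_cx t * tau2 R)) - B (real_cx t * tau2 R)) <= c) ->
    N (A M s - (tau2 R)^-1 *: midsum M B 0 (tau2 R)) <= c.
  move=> H; rewrite /A -scalerBr -[real_cx s]add0r.
  rewrite -(midsum_translate M (fun w => f (cexp w)) (real_cx s) 0) -midsumB.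
  rewrite mnormZabs cabsV -ler_pdivlMl ?invr_gt0 ?cabs_tau2// invrK -cabs_tau2.
  by apply: mnorm_midsum => t /H; rewrite add0r [_ + real_cx s]addrC.
have [r1 r10 H1] := fb _ e30.
have [r2 r20 H2] : exists2 r : R, 0 < r & forall z, cabs z < r -> N (f z - f 0) <= e / 3.
  have [D /(_ 1 ltr01)[r r0 Dr]] := fd 0 (eq_ind_r (fun x => is_true (x < 1)) ltr01 (cabs0 R)).
  have ND := mnorm_ge0 N D; have ND2 : 0 < 1 + N D by rewrite ltr_pwDl.
  exists (Num.min r (e / 3 / (1 + N D))); first by rewrite lt_min r0 divr_gt0.
  move=> z; rewrite lt_min ltr_pdivlMr// => /andP[zr ze].
  have := Dr z; rewrite !subr0 => /(_ zr); rewrite mul1r => Dz.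
  rewrite (_ : f z - f 0 = f z - (f 0 + z *: D) + z *: D); last first.
    by apply/matrixP => i j; rewrite !mxE; ring.
  rewrite (le_trans (mnormD _ _ _))// mnormZabs.
  by rewrite (le_trans (lerD Dz (lexx _)))// ltW//; nra.
pose s1 := - (r1 / 2); have s10 : - r1 < s1 < 0 by rewrite /s1; lra.
(* Any s0 <= - 1 / r2 gives a small enough radius, because exp (1 / r2) >= 1 + 1 / r2 > 1 / r2. *)
have [s0 s00 s01] : exists2 s0, s0 < s1 & expR s0 < r2.
  pose s0 := Num.min (s1 - 1) (- (1 / r2)); exists s0.
    by rewrite /s0 gt_min; apply/orP; left; lra.
  have : s0 <= - (1 / r2) by rewrite /s0 ge_min lexx orbT.
  rewrite -ler_expR expRN => /le_lt_trans; apply.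
  rewrite -[ltRHS]invrK ltf_pV2 ?posrE ?expR_gt0 ?invr_gt0// -div1r.
  apply: (@lt_le_trans _ _ (1 + 1 / r2)); first by rewrite ltrDr.
  by rewrite !mul1r expR_ge1Dx.
pose g := fun w => f (cexp w).
have gper z : g (z + tau2 R) = g z by rewrite /g cexpD cexp_tau2 mulr1.
have u0 : 0 < s1 - s0 by lra.
have gd z : complex.Re (real_cx s0) <= complex.Re z <= complex.Re (real_cx s0) + (s1 - s0) ->
    complex.Im (real_cx s0) <= complex.Im z <= complex.Im (real_cx s0) + 2 * pi -> cdiff g z.
  move=> /= /andP[_ zs] _; apply: cdiff_cexp; apply: fd.
  by rewrite cabs_cexp expR_lt1 (le_lt_trans zs)//; lra.
have S0 : 0 < (s1 - s0) ^+ 2 + (2 * pi) ^+ 2 by rewrite addr_gt0 ?exprn_gt0.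
have [M0 HM] := goursat u0 T0 gd (divr_gt0 (mulr_gt0 e30 T0) S0).
exists M0 => M /HM; rewrite midsum_period// divfK; last first.
  by rewrite gt_eqF// addr_gt0// exprn_gt0.
rewrite -/(real_cx _) -[real_cx s0 + _]/(real_cx s0 + real_cx (s1 - s0)).
have -> : real_cx s0 + real_cx (s1 - s0) = real_cx s1.
  by rewrite /real_cx -rmorphD addrC subrK.
move=> h; have A10 : N (A M s1 - A M s0) <= e / 3.
  rewrite /A -scalerBr mnormZabs cabsV -ler_pdivlMl ?invr_gt0 ?cabs_tau2// invrK.
  by rewrite mulrC.
have A1 : N (A M s1 - circ_avg M f) <= e / 3.
  by apply: AE => t t01; apply: H1.
have A0 : N (A M s0 - f 0) <= e / 3.
  rewrite (_ : f 0 = (tau2 R)^-1 *: midsum M (fun=> f 0) 0 (tau2 R)); last first.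
    by rewrite midsum_cst scalerA mulVf ?scale1r// tau2_neq0.
  apply: AE => t t01; apply: H2.
  by rewrite cabs_cexp cx_ReD !Re_realM /= mulr0 mulr0 addr0.
rewrite (_ : _ - _ = (A M s0 - f 0) + ((A M s1 - A M s0) - (A M s1 - circ_avg M f))); last first.
  by apply/matrixP => i j; rewrite !mxE; ring.
rewrite (le_trans (mnormD _ _ _))// (le_trans (lerD A0 (le_trans (mnormB _ _ _) (lerD A10 A1))))//.
by clear -e0; lra.
Qed.

End Goursat.

(** * Fourier coefficients of loops that extend to a disc *)

Section HolomorphicLoops.
Context (R : realType) (n : nat) (N : matnorm R n) (G : set 'M[Cx R]_n).
Implicit Types (x : wiener N) (f h u : Cx R -> 'M[Cx R]_n) (z w : Cx R).

(** The scalars are complex, so a derivative in the direction 1 is already a complex derivative. *)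
Lemma derivable_cdiff h z : derivable h z 1 -> cdiff N h z.
Proof.
move=> /cvg_ex[D hD]; exists D => e e0.
move/(cvg_mnormP N) : hD => /(_ e e0); rewrite nearE /dnbhs /within /= => hD.
have [r r0 rP] := (nbhs_cabsP _ _).1 hD.
exists r => // w wr; have [->|wz] := eqVneq w z.
  by rewrite subrr scale0r addr0 subrr mnorm0 cabs0 mulr0.
have wz0 : w - z != 0 by rewrite subr_eq0.
have := rP (w - z); rewrite subr0 => /(_ wr wz0) /ltW.
rewrite [(w - z)%:A]mulr1 subrK -(ler_pM2l (_ : 0 < cabs (w - z))) ?cabs_gt0//.
rewrite -mnormZabs scalerBr scalerA divff// scale1r mulrC => /(le_trans _); apply.
by rewrite opprD addrA.
Qed.

Definition disc_continuous f := forall z0, cabs z0 <= 1 -> forall e : R, 0 < e ->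
  exists2 r : R, 0 < r &
    forall w, cabs w <= 1 -> cabs (w - z0) < r -> N (f w - f z0) < e.

Lemma cdiff_scale f z : cdiff N f z -> cdiff N (fun w => w *: f w) z.
Proof.
move=> [D fD]; exists (f z + z *: D) => e e0.
have z0 := cabs_ge0 z; have z1 : 0 < cabs z + 1 by rewrite ltr_wpDl.
have D0 := mnorm_ge0 N D; have D1 : 0 < N D + 1 by rewrite ltr_wpDl.
have e1 : 0 < e / 2 / (cabs z + 1) by rewrite !divr_gt0.
have e2 : 0 < e / 2 / (N D + 1) by rewrite !divr_gt0.
have [r r0 Hr] := fD _ e1.
exists (Num.min r (Num.min 1 (e / 2 / (N D + 1)))); first by rewrite !lt_min r0 ltr01 e2.
move=> w; rewrite !lt_min => /andP[/Hr {}Hr /andP[w1 w2]].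
rewrite (_ : _ - _ = w *: (f w - (f z + (w - z) *: D)) +
    (w - z) *: ((w - z) *: D)); last first.
  by apply/matrixP => i j; rewrite !mxE; ring.
have wz := cabs_ge0 (w - z).
have cw : cabs w <= cabs z + 1.
  by rewrite -[w in leLHS](subrK z w) (le_trans (cabsD _ _))// addrC lerD2l ltW.
rewrite (le_trans (mnormD _ _ _))// !mnormZabs (splitr e) mulrDl lerD//.
  apply: (@le_trans _ _ ((cabs z + 1) * (e / 2 / (cabs z + 1) * cabs (w - z)))).
    by apply: ler_pM => //; [exact: cabs_ge0|exact: mnorm_ge0].
  by rewrite mulrA mulrCA divff ?mulr1// gt_eqF.
rewrite mulrC ler_wpM2r//; move: w2; rewrite ltr_pdivlMr// => /ltW.
by apply: le_trans; rewrite ler_wpM2l// lerDl.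
Qed.

Lemma disc_continuous_scale f : disc_continuous f -> disc_continuous (fun w => w *: f w).
Proof.
move=> fc z0 z01 e e0; have e20 : 0 < e / 2 by rewrite divr_gt0.
have [r r0 Hr] := fc z0 z01 _ e20.
have F0 := mnorm_ge0 N (f z0); have F1 : 0 < N (f z0) + 1 by rewrite ltr_wpDl.
exists (Num.min r (e / 2 / (N (f z0) + 1))) => [|w w1]; first by rewrite lt_min r0 divr_gt0.
rewrite lt_min ltr_pdivlMr// => /andP[/(Hr w w1) h wz].
rewrite (_ : _ - _ = w *: (f w - f z0) + (w - z0) *: f z0); last first.
  by apply/matrixP => i j; rewrite !mxE; ring.
rewrite (le_lt_trans (mnormD _ _ _))// !mnormZabs (splitr e) ltr_leD//.
  by rewrite (le_lt_trans _ h)// ler_piMl// mnorm_ge0.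
by rewrite (le_trans _ (ltW wz))// ler_wpM2l ?cabs_ge0// lerDl.
Qed.

(** Uniformity in the angle, from compactness of [0, 1]. The extension is differentiable only inside
    the disc, so the passage from circles of radius below 1 to the unit circle rests on continuity
    alone. *)
Lemma disc_continuous_radial f : disc_continuous f -> forall e : R, 0 < e ->
  exists2 r : R, 0 < r & forall s t : R, - r < s < 0 -> 0 <= t <= 1 ->
    N (f (cexp (real_cx s + real_cx t * tau2 R)) - f (cexp (real_cx t * tau2 R))) <= e.
Proof.
move=> fc e e0.
pose P (s t : R) := s < 0 ->
  N (f (cexp (real_cx s + real_cx t * tau2 R)) - f (cexp (real_cx t * tau2 R))) <= e.
have := (compact_near_coveringP _).1 (@segment_compact R 0 1) R (nbhs (0 : R)) P _.
case.
  move=> t0 _; set z0 := cexp (real_cx t0 * tau2 R).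
  have z01 : cabs z0 <= 1 by rewrite cabs_cexp_tau2.
  have [r r0 Hr] := fc z0 z01 _ (divr_gt0 e0 (ltr0Sn _ 1)).
  have [q q0 Hq] := cexp_continuous (real_cx t0 * tau2 R) r0.
  have K0 : 0 < 1 + 2 * pi :> R by rewrite addr_gt0// mulr_gt0// pi_gt0.
  have d0 : 0 < q / (1 + 2 * pi) by rewrite divr_gt0.
  exists (ball t0 (q / (1 + 2 * pi)), ball 0 (q / (1 + 2 * pi))) => /=.
    by split; exact: nbhsx_ballx.
  move=> [t s] /= []; rewrite /ball /= sub0r normrN ltr_pdivlMr// => tt ss s0.
  rewrite distrC in tt; rewrite ltr_pdivlMr// in ss.
  have pi0 : 0 < 2 * pi :> R by rewrite mulr_gt0// pi_gt0.
  have tq : cabs (real_cx t * tau2 R - real_cx t0 * tau2 R) <= `|t - t0| * (2 * pi).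
    rewrite -mulrBl cabsM cabs_tau2; set u := real_cx t - _.
    by rewrite (_ : u = real_cx (t - t0)) ?cabs_real// /u /real_cx rmorphB.
  have h1 : N (f (cexp (real_cx s + real_cx t * tau2 R)) - f z0) < e / 2.
    apply: Hr; first by rewrite cabs_cexp expR_le1 cx_ReD !Re_realM /= !mulr0 addr0 ltW.
    apply: Hq; rewrite -addrA (le_lt_trans (cabsD _ _))// cabs_real.
    rewrite (le_lt_trans (lerD (lexx _) tq))//.
    by have := normr_ge0 s; have := normr_ge0 (t - t0); nra.
  have h2 : N (f (cexp (real_cx t * tau2 R)) - f z0) < e / 2.
    apply: Hr; first by rewrite cabs_cexp_tau2.
    apply: Hq; rewrite (le_lt_trans tq)//.
    by have := normr_ge0 (t - t0); nra.
  rewrite (_ : _ - _ = f (cexp (real_cx s + real_cx t * tau2 R)) - f z0 -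
     (f (cexp (real_cx t * tau2 R)) - f z0)); last first.
    by apply/matrixP => i j; rewrite !mxE; ring.
  by rewrite (le_trans (mnormB _ _ _))// (splitr e) lerD// ltW.
move=> r /= r0 rP; exists r => // s t /andP[s1 s2] t01.
have sr : ball_ Num.Def.normr 0 r s by rewrite /ball_ /= sub0r normrN ltr_norml; lra.
by apply: (rP s sr t _ s2); rewrite /= in_itv.
Qed.

(** The mean of z^k h(z) over the circle is its value at the centre, which is 0 since k > 0. *)
Lemma holomorphic_circ_avg u h (k : nat) : holomorphic_extension G u h -> (0 < k)%N ->
  forall e : R, 0 < e -> exists M0, forall M, (M0 <= M)%N ->
    N (circ_avg M (fun z => z ^+ k *: u z)) <= e.
Proof.
move=> [hd hc hu] k0 e e0.
pose f j := fun z => z ^+ j *: h z.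
have fS j : f j.+1 = fun z => z *: f j z.
  by apply/funext => z; rewrite /f exprS scalerA.
have f0 : f 0%N = h by apply/funext => z; rewrite /f expr0 scale1r.
have fd j z : cabs z < 1 -> cdiff N (f j) z.
  move=> z1; elim: j => [|j IH]; last by rewrite fS; exact: cdiff_scale.
  by rewrite f0; apply: derivable_cdiff; apply: (hd z _).1; rewrite cnorm_lt1.
have fc j : disc_continuous (f j).
  elim: j => [|j IH]; last by rewrite fS; exact: disc_continuous_scale.
  rewrite f0 => z0 z01 e' e'0.
  have hz : h z @[z --> within [set z | `|z| <= 1] (nbhs z0)] --> h z0.
    by apply: ((subspace_continuousP _ _).1 hc z0); rewrite /= cnorm_le1.
  have /cvg_mnormP-/(_ N e' e'0) := hz; rewrite nearE /within /= => H.
  have [r r0 rP] := (nbhs_cabsP _ _).1 H.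
  by exists r => // w w1 /rP; apply; rewrite cnorm_le1.
have fk0 : f k 0 = 0 by rewrite /f expr0n gtn_eqF// scale0r.
have fE M : circ_avg M (fun z => z ^+ k *: u z) = circ_avg M (f k) - f k 0.
  rewrite fk0 subr0; apply: (circ_avg_ext N) => z z1.
  by rewrite /f hu//; apply: norm1_cabs.
have [M0 HM] := circ_avg_center (fd k) (disc_continuous_radial (fc k)) e0.
by exists M0 => M /HM; rewrite fE.
Qed.

(** The averages of z^k x(z) tend to this coefficient by [fourier_coef] and to 0 by
    [holomorphic_circ_avg]. *)
Lemma LambdaP_coef x (k : nat) : LambdaP G x -> (0 < k)%N -> x (- k%:Z) = 0.
Proof.
move=> [_ [h xh]] k0; apply: (@mnorm_eq0_small _ _ N) => e e0.
have e20 : 0 < e / 2 by rewrite divr_gt0.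
have [M1 H1] := holomorphic_circ_avg xh k0 e20.
have [M2 H2] := fourier_coef (- k%:Z) x (cabs1 R) (or_introl erefl) e20.
move: H1 H2 => /(_ _ (leq_maxl M1 M2)) + /(_ _ (leq_maxr M1 M2)).
move: (maxn M1 M2) => M H1 H2.
rewrite exp1rz scale1r mul1r opprK in H2.
rewrite -(subrK (circ_avg M (fun z => z ^+ k *: loop_eval x z)) (x _)).
rewrite (le_trans (mnormD _ _ _))// (splitr e) lerD//.
have E : (fun z : Cx R => z ^ k%:Z *: loop_eval x (1 * z ^ 1)) =
  (fun z => z ^+ k *: loop_eval x z) by apply/funext => z; rewrite mul1r expr1z.
rewrite E in H2.
rewrite (mnorm_distC N (x _)).
exact: ltW H2.
Qed.

(** The coordinate 1 / z exchanges the coefficients of index k and -k, hence [fourier_coef] with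
    [j = -1]. *)
Lemma LambdaM_coef x (k : nat) : LambdaM G x -> (0 < k)%N -> x k%:Z = 0.
Proof.
move=> [_ [h xh]] k0; apply: (@mnorm_eq0_small _ _ N) => e e0.
have e20 : 0 < e / 2 by rewrite divr_gt0.
have [M1 H1] := holomorphic_circ_avg xh k0 e20.
have [M2 H2] := fourier_coef (- k%:Z) x (cabs1 R) (or_intror erefl) e20.
move: H1 H2 => /(_ _ (leq_maxl M1 M2)) + /(_ _ (leq_maxr M1 M2)).
move: (maxn M1 M2) => M H1 H2.
rewrite exp1rz scale1r mulN1r opprK in H2.
rewrite -(subrK (circ_avg M (fun z => z ^+ k *: loop_eval x z^-1)) (x _)).
rewrite (le_trans (mnormD _ _ _))// (splitr e) lerD//.
have E : (fun z : Cx R => z ^ k%:Z *: loop_eval x (1 * z ^ (-1))) =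
  (fun z => z ^+ k *: loop_eval x z^-1) by apply/funext => z; rewrite mul1r exprN1.
rewrite E in H2.
rewrite (mnorm_distC N (x _)).
exact: ltW H2.
Qed.

End HolomorphicLoops.

(** * Closed matrix groups *)

Section MatrixExp.
Context (R : realType) (n : nat) (N : matnorm R n).
Implicit Types (A B X Y Z : 'M[Cx R]_n) (r c : R).

Lemma cvg_mx_series (u : nat -> 'M[Cx R]_n) (b : nat -> R) :
  (forall k, N (u k) <= b k) -> cvgn (series b) ->
  series u @ \oo --> limn (series u).
Proof.
move=> ub cb.
have entry p q k : cabs (u k p q) <= N (delta_mx q p) * b k.
  by rewrite (le_trans (mnorm_entry N _ _ _))// ler_wpM2l ?mnorm_ge0.
have b0 k : 0 <= b k by exact: le_trans (mnorm_ge0 _ _) (ub k).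
have cB p q : cvgn (series (fun k => N (delta_mx q p) * b k)).
  exact: (@is_cvg_seriesZ _ _ (N (delta_mx q p)) cb).
have cpart p q (f : Cx R -> R) : (forall z, `|f z| <= cabs z) ->
    cvgn (series (fun k => f (u k p q))).
  move=> fz; apply: normed_cvg; apply: series_le_cvg (cB p q) => k /=.
  - exact: normr_ge0.
  - by rewrite mulr_ge0 ?mnorm_ge0.
  - exact: le_trans (fz _) (entry _ _ _).
apply: cvgP; apply: (@cvg_mx_ReIm _ _ _ (\matrix_(p, q)
  (limn (series (fun k => complex.Re (u k p q))) +i*
   limn (series (fun k => complex.Im (u k p q))))%C)) => p q; rewrite mxE /=.
  rewrite [X in X @ _](_ : _ = series (fun k => complex.Re (u k p q))).
    by apply: (cpart _ _ (@complex.Re R)) => z; exact: Re_cabs.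
  by apply/funext => m; rewrite /series/= summxE raddf_sum.
rewrite [X in X @ _](_ : _ = series (fun k => complex.Im (u k p q))).
  by apply: (cpart _ _ (@complex.Im R)) => z; exact: Im_cabs.
by apply/funext => m; rewrite /series/= summxE raddf_sum.
Qed.

Lemma mnormMX X Y k : N (X ^+ k *m Y) <= N X ^+ k * N Y.
Proof.
elim: k => [|k IH]; first by rewrite !expr0 mul1r mul1mx.
rewrite !exprS -mulrA -mulmxA (le_trans (mnormM _ _ _))// ler_wpM2l ?mnorm_ge0//.
Qed.

Lemma mnormX X k : N (X ^+ k) <= N X ^+ k.
Proof.
by have := mnormMX X 1%:M k; rewrite mulmx1 mnorm1 mulr1.
Qed.

Lemma expmxZ (a : Cx R) X k : (a *: X) ^+ k = a ^+ k *: X ^+ k.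
Proof.
elim: k => [|k IH]; first by rewrite !expr0 scale1r.
by rewrite !exprS IH -!mulmxE -scalemxAl -scalemxAr scalerA.
Qed.

Lemma natr_inv (k : nat) : (k%:R^-1 : Cx R) = real_cx (k%:R^-1).
Proof. by rewrite /real_cx fmorphV rmorph_nat. Qed.

Lemma mnorm_exp_term X k : N (k`!%:R^-1 *: X ^+ k) <= exp_coeff (N X) k.
Proof.
rewrite natr_inv mnormZr ger0_norm ?invr_ge0// /exp_coeff /= mulrC.
by rewrite ler_wpM2r ?invr_ge0// mnormX.
Qed.

Lemma cvg_mexp X : series (fun k : nat => k`!%:R^-1 *: X ^+ k) @ \oo --> mexp X.
Proof. exact: cvg_mx_series (mnorm_exp_term X) (is_cvg_series_exp_coeff _). Qed.

#[local] Opaque mexp.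

Lemma series_exp_le r m : 0 <= r -> series (exp_coeff r) m <= expR r.
Proof.
move=> r0; apply: nondecreasing_cvgn_le; last exact: is_cvg_series_exp_coeff.
by apply: nondecreasing_series => k _ _; exact: exp_coeff_ge0.
Qed.

(** The coefficients 1 / k! - C(m, k) / m^k of the difference are nonnegative, so the scalar series
    at [N X] is a majorant. *)
Lemma mexp_pow_dist X m : (0 < m)%N ->
  N (mexp X - (1%:M + m%:R^-1 *: X) ^+ m) <= expR (N X) - (1 + N X / m%:R) ^+ m.
Proof.
move=> m0; pose c k : R := 'C(m, k)%:R / m%:R ^+ k.
have mR : (0 : R) < m%:R by rewrite ltr0n.
have c0 k : (m < k)%N -> c k = 0 by move=> mk; rewrite /c bin_small// mul0r.
have cle k : 0 <= k`!%:R^-1 - c k.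
  rewrite subr_ge0 /c ler_pdivrMr ?exprn_gt0// mulrC ler_pdivlMr ?ltr0n ?fact_gt0//.
  rewrite -natrM bin_ffact -natrX ler_nat; elim: k => // k IH.
  by rewrite ffactnSr expnSr leq_mul// leq_subr.
have powE : (1%:M + m%:R^-1 *: X) ^+ m = \sum_(k < m.+1) real_cx (c k) *: X ^+ k.
  rewrite GRing.exprDn_comm; last by rewrite /GRing.comm -!mulmxE mul1mx mulmx1.
  apply: eq_bigr => k _; rewrite expr1n mul1r expmxZ -scaler_nat scalerA /c.
  by rewrite exprVn /real_cx rmorphM fmorphV rmorphXn !rmorph_nat.
have powE' : (1 + N X / m%:R) ^+ m = \sum_(k < m.+1) c k * N X ^+ k.
  rewrite exprDn; apply: eq_bigr => k _; rewrite expr1n mul1r expr_div_n /c.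
  by rewrite -mulr_natl; ring.
rewrite powE powE'.
apply: (mnorm_lim_le (f := fun M => series (fun k : nat => k`!%:R^-1 *: X ^+ k) M -
  \sum_(k < m.+1) real_cx (c k) *: X ^+ k)).
  apply: cvgB; first exact: cvg_mexp.
  exact: cvg_cst.
near=> M; have mM : (m < M)%N by near: M; exact: nbhs_infty_gt.
have ext (V : zmodType) (F : nat -> V) : (forall k, (m < k)%N -> F k = 0) ->
    \sum_(k < m.+1) F k = \sum_(0 <= k < M) F k.
  move=> F0; rewrite -(big_mkord xpredT F) (big_cat_nat (n := m.+1) (p := M))//=.
  by rewrite [X in _ + X]big_nat_cond [X in _ + X]big1 ?addr0// => k /andP[/andP[/F0]].
rewrite (ext _ (fun k => real_cx (c k) *: X ^+ k)); last first.
  by move=> k /c0 ->; rewrite scale0r.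
rewrite (ext _ (fun k => c k * N X ^+ k)); last by move=> k /c0 ->; rewrite mul0r.
apply: (@le_trans _ _ (series (exp_coeff (N X)) M - \sum_(0 <= k < M) c k * N X ^+ k)).
  rewrite /series /= -!sumrB (le_trans (mnorm_sum _ _ _ _))// ler_sum// => k _.
  rewrite natr_inv -scalerBl (_ : real_cx _ - real_cx _ = real_cx (k`!%:R^-1 - c k)); last first.
    by rewrite /real_cx rmorphB.
  rewrite mnormZr ger0_norm ?cle// (le_trans (ler_wpM2l (cle k) (mnormX _ _)))//.
  by rewrite mulrBl /exp_coeff /= [in leLHS]mulrC.
by rewrite lerD2r series_exp_le// mnorm_ge0.
Unshelve. all: by end_near. Qed.

(** From exp (-r) >= 1 - r one gets exp r <= 1 / (1 - r). *)
Lemma expR_sub1_le r : 0 <= r <= 1 / 2 -> expR r - 1 - r <= 2 * r ^+ 2.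
Proof.
move=> /andP[r0 r1]; have := expR_ge1Dx (- r); rewrite expRN => h.
have e0 := expR_gt0 r.
have : (1 - r) * expR r <= 1 by rewrite -ler_pdivlMr// div1r.
nra.
Qed.

(** With q = r / m this compares the m-th powers of exp q and 1 + q: telescoping yields the factor m
    exp r, and exp q - 1 - q is of order q^2. *)
Lemma expR_pow_dist r m : (0 < m)%N -> 0 <= r -> 2 * r <= m%:R ->
  expR r - (1 + r / m%:R) ^+ m <= 2 * expR r * r ^+ 2 / m%:R.
Proof.
move=> m0 r0 rm; have mR : (0 : R) < m%:R by rewrite ltr0n.
set q := r / m%:R; have q0 : 0 <= q by rewrite divr_ge0.
have q2 : q <= 1 / 2 by rewrite /q ler_pdivrMr//; lra.
have E : expR r = expR q ^+ m by rewrite -expRM_natl mulrC divfK// gt_eqF.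
have eq1 : 1 <= expR q by rewrite -expR0 ler_expR.
have pw k : expR q ^+ k - (1 + q) ^+ k <= k%:R * expR q ^+ k * (expR q - 1 - q).
  have d0 : 0 <= expR q - 1 - q by rewrite -addrA -opprD subr_ge0 expR_ge1Dx.
  elim: k => [|k IH]; first by rewrite !expr0 subrr !mul0r.
  have ek : 1 <= expR q ^+ k by rewrite exprn_ege1.
  have qk : (1 + q) ^+ k <= expR q ^+ k by rewrite lerXn2r ?nnegrE ?addr_ge0 ?expR_ge0// expR_ge1Dx.
  have : 0 <= (1 + q) ^+ k by rewrite exprn_ge0// addr_ge0.
  move: IH; rewrite !exprS -natr1; set a := expR q ^+ k in ek qk *; set b := (1 + q) ^+ k in qk *.
  move=> IH b0.
  have -> : expR q * a - (1 + q) * b = expR q * (a - b) + (expR q - 1 - q) * b by ring.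
  have H1 : expR q * (a - b) <= expR q * (k%:R * a * (expR q - 1 - q)).
    by rewrite ler_wpM2l// expR_ge0.
  have H2 : (expR q - 1 - q) * b <= (expR q - 1 - q) * (expR q * a).
    by rewrite ler_wpM2l// (le_trans qk)// ler_peMl// (le_trans ler01).
  rewrite (le_trans (lerD H1 H2))// le_eqVlt; apply/orP; left; apply/eqP; ring.
rewrite {1}E (le_trans (pw m))// -E.
have : expR q - 1 - q <= 2 * q ^+ 2 by apply: expR_sub1_le; rewrite q0.
move=> /(ler_wpM2l (_ : 0 <= m%:R * expR r)) => /(_ (mulr_ge0 (ltW mR) (expR_ge0 _))).
move=> /le_trans; apply; rewrite le_eqVlt; apply/orP; left; apply/eqP.
by rewrite /q; field; rewrite gt_eqF.
Qed.

Lemma mnorm_pow_dist A B r m : N A <= r -> N B <= r -> 1 <= r ->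
  N (A ^+ m - B ^+ m) <= m%:R * r ^+ m * N (A - B).
Proof.
move=> Ar Br r1; have r0 : 0 <= r by exact: le_trans r1.
elim: m => [|m IH]; first by rewrite !expr0 subrr mnorm0 !mul0r.
rewrite !exprS -!mulmxE.
rewrite (_ : _ - _ = A *m (A ^+ m - B ^+ m) + (A - B) *m B ^+ m); last first.
  by rewrite mulmxBr mulmxBl addrA subrK.
rewrite (le_trans (mnormD _ _ _))// -natr1 mulrDl mulrDl mul1r lerD//.
  rewrite (le_trans (mnormM _ _ _))// mulrCA -mulrA ler_pM ?mnorm_ge0//.
rewrite (le_trans (mnormM _ _ _))// mulrC ler_wpM2r ?mnorm_ge0//.
rewrite (le_trans (mnormX _ _))//.
have rX : N B ^+ m <= r ^+ m by rewrite lerXn2r ?nnegrE ?mnorm_ge0.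
by rewrite (le_trans rX)// ler_peMl// exprn_ge0.
Qed.

Lemma pow_le_expR r m : 0 <= r -> (0 < m)%N -> (1 + r / m%:R) ^+ m <= expR r.
Proof.
move=> r0 m0; have mR : (0 : R) < m%:R by rewrite ltr0n.
have q0 : 0 <= r / m%:R by rewrite divr_ge0.
rewrite (_ : expR r = expR (r / m%:R) ^+ m); last by rewrite -expRM_natl mulrC divfK// gt_eqF.
by rewrite lerXn2r ?nnegrE ?addr_ge0 ?expR_ge0// expR_ge1Dx.
Qed.

(** Powers of an element near 1 follow the exponential of its rescaled displacement m (B - 1). The
    comparison goes through the m-th power of 1 + Z / m. *)
Lemma mpow_mexp_dist B Z c m : (0 < m)%N -> 2 * c <= m%:R ->
  N Z <= c -> N (m%:R *: (B - 1%:M)) <= c ->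
  N (B ^+ m - mexp Z) <= expR c * N (m%:R *: (B - 1%:M) - Z) + 2 * expR c * c ^+ 2 / m%:R.
Proof.
move=> m0 cm Zc Bc; have mR : (0 : R) < m%:R by rewrite ltr0n.
have mC : (m%:R : Cx R) != 0 by rewrite pnatr_eq0 -lt0n.
have c0 : 0 <= c by exact: le_trans (mnorm_ge0 _ _) Zc.
pose A := 1%:M + m%:R^-1 *: Z.
have mnormZn k X : N (k%:R *: X) = k%:R * N X.
  by rewrite -real_cx_nat mnormZr ger0_norm.
have NA : N A <= 1 + c / m%:R.
  rewrite (le_trans (mnormD _ _ _))// mnorm1 lerD2l natr_inv mnormZr.
  by rewrite ger0_norm ?invr_ge0 ?ler0n// mulrC ler_wpM2r ?invr_ge0.
have NB : N B <= 1 + c / m%:R.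
  rewrite -(subrK 1%:M B) addrC (le_trans (mnormD _ _ _))// mnorm1 lerD2l.
  by rewrite ler_pdivlMr// mulrC -mnormZn.
have c1 : 1 <= 1 + c / m%:R by rewrite lerDl divr_ge0.
have cE := pow_le_expR c0 m0.
have Ac0 : 0 <= N Z <= c by rewrite mnorm_ge0.
rewrite -(subrK (A ^+ m) (B ^+ m)) -addrA (le_trans (mnormD _ _ _))// lerD//.
  rewrite (le_trans (mnorm_pow_dist m NB NA c1))//.
  rewrite (_ : m%:R *: (B - 1%:M) - Z = m%:R *: (B - A)); last first.
    by rewrite /A opprD addrA [RHS]scalerBr scalerA divff// scale1r.
  rewrite mnormZn (_ : _ * _ * _ = (1 + c / m%:R) ^+ m * (m%:R * N (B - A))).
    by rewrite ler_wpM2r// mulr_ge0 ?mnorm_ge0.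
  by ring.
rewrite mnorm_distC (le_trans (mexp_pow_dist Z m0))//.
have Nm : 2 * N Z <= m%:R by rewrite (le_trans _ cm)// ler_wpM2l.
rewrite (le_trans (expR_pow_dist m0 (mnorm_ge0 N Z) Nm))//.
rewrite ler_wpM2r ?invr_ge0// -!mulrA ler_wpM2l// ler_pM ?expR_ge0 ?exprn_ge0 ?mnorm_ge0//.
  by rewrite ler_expR.
by rewrite lerXn2r ?nnegrE ?mnorm_ge0.
Qed.

(** Without its constant and linear terms the series has Lipschitz constant at most the sum over k
    >= 1 of r^k / k!. This is both the derivative of [mexp] at 0 and the contraction estimate of the
    Newton iteration. *)
Lemma mexp_lipschitz X Y r : N X <= r -> N Y <= r ->
  N (mexp X - mexp Y - (X - Y)) <= (expR r - 1) * N (X - Y).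
Proof.
move=> Xr Yr; have r0 : 0 <= r by exact: le_trans (mnorm_ge0 _ _) Xr.
have pw k : N (X ^+ k.+1 - Y ^+ k.+1) <= k.+1%:R * r ^+ k * N (X - Y).
  elim: k => [|k IH]; first by rewrite !expr1 mulr1 mul1r.
  rewrite exprS [Y ^+ _]exprS -!mulmxE.
  rewrite (_ : _ - _ = X *m (X ^+ k.+1 - Y ^+ k.+1) + (X - Y) *m Y ^+ k.+1); last first.
    by rewrite mulmxBr mulmxBl addrA subrK.
  rewrite (le_trans (mnormD _ _ _))// -[k.+2%:R]natr1 mulrDl mulrDl mul1r lerD//.
    apply: (le_trans (mnormM _ _ _)).
    apply: (le_trans (ler_pM (mnorm_ge0 _ _) (mnorm_ge0 _ _) Xr IH)).
    by rewrite le_eqVlt; apply/orP; left; apply/eqP; rewrite exprS; ring.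
  rewrite (le_trans (mnormM _ _ _))// mulrC ler_wpM2r ?mnorm_ge0//.
  by rewrite (le_trans (mnormX _ _))// lerXn2r ?nnegrE ?mnorm_ge0.
apply: (mnorm_lim_le (f := fun M => series (fun k : nat => k`!%:R^-1 *: X ^+ k) M -
  series (fun k : nat => k`!%:R^-1 *: Y ^+ k) M - (X - Y))).
  apply: cvgB; last exact: cvg_cst.
  by apply: cvgB; exact: cvg_mexp.
suff H M : (1 < M)%N -> N (series (fun k : nat => k`!%:R^-1 *: X ^+ k) M -
    series (fun k : nat => k`!%:R^-1 *: Y ^+ k) M - (X - Y)) <= (expR r - 1) * N (X - Y).
  by near=> M; apply: H; near: M; exact: nbhs_infty_gt.
case: M => [//|[//|M]] _.
rewrite /series /= -sumrB big_nat_recl//= big_nat_recl//= !expr0 !expr1 fact0 invr1.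
rewrite !scale1r subrr add0r addrAC subrr add0r.
rewrite (le_trans (mnorm_sum _ _ _ _))//.
apply: (@le_trans _ _ ((series (exp_coeff r) M.+1 - 1) * N (X - Y))); last first.
  by rewrite ler_wpM2r ?mnorm_ge0// lerD2r series_exp_le.
rewrite /series /= big_nat_recl//= /exp_coeff /= expr0 fact0 divr1 addrAC subrr add0r.
rewrite mulr_suml; apply: ler_sum => k _.
rewrite -scalerBr natr_inv mnormZr ger0_norm ?invr_ge0//.
rewrite (le_trans (ler_wpM2l _ (pw k.+1)))// ?invr_ge0//.
rewrite le_eqVlt; apply/orP; left; apply/eqP; rewrite [k.+2`!]factS natrM.
have Q0 : (k.+1)`!%:R != 0 :> R by rewrite pnatr_eq0 -lt0n fact_gt0.
have P0 : k.+2%:R != 0 :> R by rewrite pnatr_eq0.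
move: Q0 P0; set Q := _`!%:R; set P := _%:R; move: Q P => Q P Q0 P0.
by field; rewrite Q0 P0.
Unshelve. all: by end_near. Qed.

Lemma mexp0 : mexp (0 : 'M[Cx R]_n) = 1%:M.
Proof.
apply/eqP; rewrite -subr_eq0; apply/eqP/(mnorm_eq0 (m := N)).
apply/eqP; rewrite eq_le mnorm_ge0 andbT.
have := mexp_pow_dist 0 (ltn0Sn 0); rewrite scaler0 addr0 mnorm0 mul0r addr0.
by rewrite expR0 !expr1 subrr.
Qed.

Lemma mexp_approx X r : N X <= r -> N (mexp X - 1%:M - X) <= (expR r - 1) * N X.
Proof.
move=> Xr; have r0 : 0 <= r by exact: le_trans (mnorm_ge0 _ _) Xr.
have := @mexp_lipschitz X 0 r Xr; rewrite mnorm0 => /(_ r0).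
by rewrite mexp0 subr0.
Qed.

Lemma near_divn_lt (C e : R) : 0 < e -> \forall m \near \oo, C / m%:R < e.
Proof.
move=> e0; near=> m; have m0 : (0 < m)%N by near: m; exact: nbhs_infty_gt.
rewrite ltr_pdivrMr ?ltr0n// mulrC -ltr_pdivrMr//.
by near: m; exact: nbhs_infty_gtr.
Unshelve. all: by end_near. Qed.

Lemma near_mexp X e : 0 < e ->
  \forall m \near \oo, N (mexp X - (1%:M + m%:R^-1 *: X) ^+ m) < e.
Proof.
move=> e0; near=> m; have m0 : (0 < m)%N by near: m; exact: nbhs_infty_gt.
rewrite (le_lt_trans (mexp_pow_dist _ m0))//.
have rm : 2 * N X <= m%:R by apply: ltW; near: m; exact: nbhs_infty_gtr.
rewrite (le_lt_trans (expR_pow_dist m0 (mnorm_ge0 _ _) rm))//.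
by near: m; exact: near_divn_lt.
Unshelve. all: by end_near. Qed.

(** The 2m-th power of 1 + 2 X / (2m) is the square of the m-th power of 1 + X / m. It will make
    [mexp] of half a logarithm a square root. *)
Lemma mexp_double X : mexp (X + X) = mexp X *m mexp X.
Proof.
apply/eqP; rewrite -subr_eq0; apply/eqP; apply: (@mnorm_eq0_small _ _ N) => e e0.
set E := mexp X; set r := N E + 1.
have r0 : 0 < r by rewrite ltr_wpDl// mnorm_ge0.
have e1 : 0 < e / 2 by rewrite divr_gt0.
have e2 : 0 < Num.min 1 (e / 2 / (2 * r)) by rewrite lt_min ltr01 !divr_gt0// mulr_gt0.
near \oo => m; have m0 : (0 < m)%N by near: m; exact: nbhs_infty_gt.
have : N (E - (1%:M + m%:R^-1 *: X) ^+ m) < Num.min 1 (e / 2 / (2 * r)).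
  by near: m; exact: (near_mexp X e2).
set B := (1%:M + m%:R^-1 *: X) ^+ m => BE.
have BB : N (mexp (X + X) - B *m B) < e / 2.
  have -> : B *m B = (1%:M + (m.*2)%:R^-1 *: (X + X)) ^+ m.*2.
    rewrite mulmxE -expr2 -exprM muln2; congr ((_ + _) ^+ _).
    have -> : X + X = 2 *: X by rewrite scaler_nat mulr2n.
    rewrite scalerA -muln2 natrM invfM -mulrA mulVf ?mulr1//.
  near: m; have [M _ HM] := near_mexp (X + X) e1.
  by exists M => // m /= Mm; apply: HM; rewrite /= (leq_trans Mm)// -addnn leq_addr.
move: BE; rewrite lt_min => /andP[BE1 /ltW]; rewrite ler_pdivlMr ?mulr_gt0// => BE2.
have NB : N B <= r.
  rewrite -(subrK E B) (le_trans (mnormD _ _ _))// mnorm_distC addrC lerD2l ltW//.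
have NE : N E <= r by rewrite lerDl.
rewrite (_ : _ - _ = (mexp (X + X) - B *m B) - ((E - B) *m E + B *m (E - B))); last first.
  by rewrite mulmxBl mulmxBr addrA subrK opprB addrA subrK.
rewrite (le_trans (mnormB _ _ _))// (splitr e) lerD// ?(ltW BB)//.
rewrite (le_trans (mnormD _ _ _))// (le_trans _ BE2)//.
rewrite (le_trans (lerD (mnormM _ _ _) (mnormM _ _ _)))//.
by have := mnorm_ge0 N (E - B); nra.
Unshelve. all: by end_near. Qed.

(** The factors 1 + X / m and 1 - X / m commute, with product 1 - X^2 / m^2; its m-th power tends to
    the exponential of 0. *)
Lemma mexpN X Y : Y = - X -> mexp X *m mexp Y = 1%:M.
Proof.
move=> YX; apply/eqP; rewrite -subr_eq0; apply/eqP; apply: (@mnorm_eq0_small _ _ N) => e e0.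
set E := mexp X; set E' := mexp Y; set r := N E + N E' + 1.
have r0 : 0 < r by rewrite ltr_wpDl// addr_ge0// mnorm_ge0.
have e1 : 0 < e / 2 by rewrite divr_gt0.
have e2 : 0 < Num.min 1 (e / 2 / (2 * r)) by rewrite lt_min ltr01 !divr_gt0// mulr_gt0.
set c := N (X *m X); have c0 : 0 <= c by exact: mnorm_ge0.
pose F k : 'M[Cx R]_n := (1%:M + k%:R^-1 *: X) ^+ k.
pose F' k : 'M[Cx R]_n := (1%:M + k%:R^-1 *: Y) ^+ k.
have nE : \forall k \near \oo, N (E - F k) < Num.min 1 (e / 2 / (2 * r)).
  exact: near_mexp.
have nE' : \forall k \near \oo, N (E' - F' k) < Num.min 1 (e / 2 / (2 * r)).
  exact: near_mexp.
have FE k : F k = (1%:M + k%:R^-1 *: X) ^+ k by [].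
have FE' k : F' k = (1%:M + k%:R^-1 *: Y) ^+ k by [].
move: E E' F F' @r r0 e2 nE nE' FE FE' => E E' F F' r r0 e2 nE nE' FE FE'.
near \oo => m; have m0 : (0 < m)%N by near: m; exact: nbhs_infty_gt.
have mR : (1 : R) <= m%:R by rewrite ler1n.
have mC : (m%:R : Cx R) != 0 by rewrite pnatr_eq0 -lt0n.
have BE : N (E - F m) < Num.min 1 (e / 2 / (2 * r)) by near: m; exact: nE.
have BE' : N (E' - F' m) < Num.min 1 (e / 2 / (2 * r)) by near: m; exact: nE'.
move: BE BE'; rewrite FE FE'; set B := (_ + _ *: X) ^+ m; set B' := (_ + _ *: Y) ^+ m.
move=> BE BE'.
have BB : N (B *m B' - 1%:M) < e / 2.
  pose D := 1%:M - (m%:R^-1 ^+ 2) *: (X *m X).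
  have -> : B *m B' = D ^+ m.
    rewrite mulmxE -exprMn_comm.
      congr (_ ^+ _); rewrite YX -mulmxE mulmxDl mul1mx mulmxDr mulmx1 scalerN.
      rewrite mulmxN -scalemxAl -scalemxAr scalerA -expr2 /D.
      by rewrite addrA subrK.
    rewrite YX /GRing.comm -!mulmxE mulmxDl mul1mx mulmxDl mul1mx !mulmxDr !mulmx1.
    rewrite !scalerN mulmxN mulNmx -scalemxAl -scalemxAr.
    by rewrite !addrA; congr (_ - _); rewrite -!addrA; congr (_ + _); rewrite addrC.
  rewrite -mexp0 (le_lt_trans (mpow_mexp_dist (c := c) m0 _ _ _))//.
  - by apply: ltW; near: m; exact: nbhs_infty_gtr.
  - by rewrite mnorm0.
  - rewrite /D addrAC subrr add0r scalerN mnormN scalerA expr2 mulrA divff// mul1r.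
    by rewrite natr_inv mnormZr ger0_norm ?invr_ge0 ?ler0n// ler_piMl// invf_le1// ltr0n.
  rewrite subr0 /D addrAC subrr add0r scalerN mnormN scalerA expr2 mulrA divff// mul1r.
  rewrite natr_inv mnormZr ger0_norm ?invr_ge0 ?ler0n// -/c.
  rewrite (_ : _ + _ = (expR c * c + 2 * expR c * c ^+ 2) / m%:R); last by ring.
  by near: m; exact: near_divn_lt.
move: B B' BE BE' BB => B B'.
rewrite !lt_min => /andP[BE1 /ltW BE2] /andP[BE1' /ltW BE2'] BB.
move: BE2 BE2'.
rewrite !ler_pdivlMr ?mulr_gt0// => BE2 BE2'.
have NE : N E <= r by rewrite /r; have := mnorm_ge0 N E'; lra.
have NE' : N E' <= r by rewrite /r; have := mnorm_ge0 N E; lra.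
have NB : N B <= r.
  rewrite -(subrK E B) (le_trans (mnormD _ _ _))// mnorm_distC.
  by have := mnorm_ge0 N E'; rewrite /r; lra.
rewrite (_ : _ - _ = (B *m B' - 1%:M) + ((E - B) *m E' + B *m (E' - B'))); last first.
  by rewrite mulmxBl mulmxBr [RHS]addrC addrA addrA !subrK.
rewrite (le_trans (mnormD _ _ _))// (splitr e) lerD// ?(ltW BB)//.
rewrite (le_trans (mnormD _ _ _))//.
rewrite (le_trans (lerD (mnormM _ _ _) (mnormM _ _ _)))//.
have := mnorm_ge0 N (E - B); have := mnorm_ge0 N (E' - B').
have := mnorm_ge0 N E'; have := mnorm_ge0 N B; nra.
Unshelve. all: by end_near. Qed.

Lemma mexp_unit X : mexp X \in unitmx.
Proof. exact: (mulmx1_unit (mexpN (erefl (- X)))).1. Qed.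

End MatrixExp.

(** * The Lie algebra of a closed matrix group *)

Section ClosedSubgroup.
Context (R : realType) (n : nat) (N : matnorm R n) (K : set 'M[Cx R]_n).
Hypothesis hK : matrix_lie_group K.
#[local] Opaque mexp.
Implicit Types (A B X Y : 'M[Cx R]_n).

Lemma real_cxD (s t : R) : real_cx (s + t) = real_cx s + real_cx t.
Proof. by rewrite /real_cx rmorphD. Qed.

Lemma real_cxM (s t : R) : real_cx (s * t) = real_cx s * real_cx t.
Proof. by rewrite /real_cx rmorphM. Qed.

Lemma real_cx1 : real_cx 1 = 1 :> Cx R.
Proof. by []. Qed.

Lemma real_cx0 : real_cx 0 = 0 :> Cx R.
Proof. by []. Qed.

Lemma mlg_pow A k : K A -> K (A ^+ k).
Proof.
move=> KA; have [K1 KM _ _] := hK.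
elim: k => [|k IH]; first by rewrite expr0; exact: K1.
by rewrite exprS -mulmxE; exact: KM.
Qed.

Lemma mlg_closed A : A \in unitmx ->
  (forall e : R, 0 < e -> exists2 B, K B & N (B - A) < e) -> K A.
Proof.
move=> uA h; have [_ _ _ Kc] := hK; apply: Kc; split=> // P /(nbhs_mnormP N)[e e0 eP].
by have [B KB BA] := h e e0; exists B; split=> //; exact: eP.
Qed.

(** A limit direction of elements of [K] tending to 1 is tangent: if (B - 1) / r is close to Y, then
    B^m with m the integer part of t / r is close to exp (t Y), and [K] is closed among invertible
    matrices. *)
Lemma lie_limit Y :
  (forall e : R, 0 < e -> exists r B, [/\ 0 < r < e, K B &
     N (real_cx r^-1 *: (B - 1%:M) - Y) < e]) -> lie_algebra K Y.
Proof.
move=> H; have [K1 KM KV _] := hK.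
suff Hpos (t : R) : 0 < t -> K (mexp (real_cx t *: Y)).
  move=> t; have [t0|t0|->] := ltgtP t 0; last 1 first.
  - by rewrite real_cx0 scale0r (mexp0 N).
  - have [|_ ] := KV _ (Hpos (- t) _); first by rewrite oppr_gt0.
    suff -> : mexp (real_cx t *: Y) = invmx (mexp (real_cx (- t) *: Y)) by [].
    rewrite -[RHS]mulmx1; set Z := real_cx (- t) *: Y.
    rewrite -(@mexpN _ _ N Z (real_cx t *: Y)) ?mulKmx ?(mexp_unit N)//.
    by rewrite /Z (_ : real_cx (- t) = - real_cx t) ?scaleNr ?opprK// /real_cx rmorphN.
  - exact: Hpos.
move=> t0; apply: mlg_closed => [|e e0]; first exact: (mexp_unit N).
set a := N Y; have a0 : 0 <= a by exact: mnorm_ge0.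
(* [c] bounds the norms of both t Y and m (B - 1). Below, [d] brings the first error term of
   [mpow_mexp_dist] under [e / 2], and [q] makes m large enough for the second. *)
set c := (t + 1) * (a + 1).
have c0 : 0 < c by rewrite mulr_gt0// ltr_wpDl// ltW.
have E0 := expR_gt0 c.
have e20 : 0 < e / 2 by rewrite divr_gt0.
set d := e / 2 / (expR c * (t + a + 1)).
have ta : 0 < t + a + 1 by rewrite -addrA ltr_wpDr// addr_ge0.
have d0 : 0 < d by rewrite divr_gt0// mulr_gt0.
set q := t / (2 * c + 1 + (2 * expR c * c ^+ 2) / (e / 2)).
have C0 : 0 <= (2 * expR c * c ^+ 2) / (e / 2).
  apply: divr_ge0; last exact: ltW.
  by have := mulr_gt0 E0 (exprn_gt0 2 c0); rewrite -mulrA; lra.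
have D0 : 0 < 2 * c + 1 + (2 * expR c * c ^+ 2) / (e / 2).
  by move: C0; set x := _ / (e / 2); lra.
have q0 : 0 < q by rewrite divr_gt0.
have m0 : 0 < Num.min (Num.min 1 d) q by rewrite !lt_min ltr01 d0 q0.
have [r [B [/andP[r0]]]] := H _ m0.
rewrite !lt_min => /andP[/andP[r1 rd] rq] KB /andP[/andP[BY1 BYd] _].
set m := Num.truncn (t / r).
have tr0 : 0 <= t / r by rewrite divr_ge0// ltW.
have mle : m%:R <= t / r by rewrite truncn_le.
have mgt : t / r < m%:R + 1 by rewrite natr1 truncnS_gt.
have qle : 2 * c + 1 + (2 * expR c * c ^+ 2) / (e / 2) <= t / r.
  rewrite ler_pdivlMr// -ler_pdivlMl// mulrC ltW//.
have mr : (m%:R * r <= t) by rewrite -ler_pdivlMr.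
have mr' : t - m%:R * r <= r.
  by move: mgt; rewrite ltr_pdivrMr// mulrDl mul1r => /ltW; rewrite lerBlDl.
have m2 : 2 * c <= m%:R by lra.
have m1 : 0 < (m%:R : R) by lra.
have mpos : (0 < m)%N by rewrite -(ltr0n R).
have mE : m%:R *: (B - 1%:M) = real_cx (m%:R * r) *: (real_cx r^-1 *: (B - 1%:M)).
  by rewrite scalerA -real_cxM mulfK ?gt_eqF// real_cx_nat.
have mr0 : 0 <= m%:R * r by rewrite mulr_ge0// ltW.
have NB : N (real_cx r^-1 *: (B - 1%:M)) <= a + 1.
  rewrite -(subrK Y (real_cx _ *: _)) (le_trans (mnormD _ _ _))// addrC lerD2l.
  exact: ltW.
exists (B ^+ m); first exact: mlg_pow.
rewrite (le_lt_trans (mpow_mexp_dist (c := c) mpos m2 _ _))//.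
- rewrite mnormZr ger0_norm ?(ltW t0)// -/a /c; nra.
- by rewrite mE mnormZr ger0_norm// /c ler_pM// ?mnorm_ge0//; lra.
rewrite (splitr e) ler_ltD//; last first.
  rewrite ltr_pdivrMr// [X in _ < X]mulrC -ltr_pdivrMr//.
  by move: qle mgt; set x := _ / (e / 2); lra.
rewrite -ler_pdivlMl// mulrC mE.
rewrite (_ : _ - _ = real_cx (m%:R * r) *: (real_cx r^-1 *: (B - 1%:M) - Y) -
   real_cx (t - m%:R * r) *: Y); last first.
  rewrite (_ : real_cx (t - _) = real_cx t - real_cx (m%:R * r)); last first.
    by rewrite /real_cx rmorphB.
  set Z := _ *: (B - _); clearbody Z.
  by rewrite scalerBl scalerBr opprB addrA subrK.
rewrite (le_trans (mnormB _ _ _))// !mnormZr !ger0_norm ?subr_ge0//.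
have dE : d * (t + a + 1) = e / 2 / expR c by rewrite /d; field; rewrite !gt_eqF.
rewrite -dE; have := mnorm_ge0 N (real_cx r^-1 *: (B - 1%:M) - Y).
rewrite -/a; set b := N _ => b0.
have h1 : m%:R * r * b <= t * d by rewrite ler_pM// ltW.
have h2 : (t - m%:R * r) * a <= d * a by rewrite ler_wpM2r// (le_trans mr')// ltW.
by rewrite (le_trans (lerD h1 h2))//; nra.
Qed.

Lemma lieZ X (t : R) : lie_algebra K X -> lie_algebra K (real_cx t *: X).
Proof. by move=> LX s; rewrite scalerA -real_cxM. Qed.

Lemma lie_mexp X : lie_algebra K X -> K (mexp X).
Proof. by move=> /(_ 1); rewrite real_cx1 scale1r. Qed.

Lemma lie0 : lie_algebra K 0.
Proof. by move=> t; rewrite scaler0 (mexp0 N); have [] := hK. Qed.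

Lemma mexp_small_ratio (C e : R) : 0 <= C -> 0 < e -> exists2 d : R, 0 < d &
  forall (r : R) X, 0 < r < d -> N X <= C ->
    N (real_cx r^-1 *: (mexp (real_cx r *: X) - 1%:M) - X) <= e.
Proof.
move=> C0 e0; have C1 : 0 < C + 1 by rewrite ltr_wpDl.
have h2 : 0 < 2^-1 :> R by rewrite invr_gt0.
exists (Num.min (2^-1 / (C + 1)) (e / (4 * (C + 1) ^+ 2))).
  by rewrite lt_min !divr_gt0// mulr_gt0// exprn_gt0.
move=> r X /andP[r0]; rewrite lt_min !ltr_pdivlMr ?mulr_gt0 ?exprn_gt0// => /andP[r1 r2] XC.
have X0 := mnorm_ge0 N X.
have NrX : N (real_cx r *: X) <= r * C.
  by rewrite mnormZr ger0_norm ?ler_wpM2l// ltW.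
have := mexp_approx NrX; set D := _ - _ - _ => h.
rewrite (_ : _ - X = real_cx r^-1 *: D); last first.
  by rewrite /D [RHS]scalerBr scalerA -real_cxM mulVf ?gt_eqF// real_cx1 scale1r.
rewrite mnormZr ger0_norm ?invr_ge0 ?(ltW r0)// ler_pdivrMl// (le_trans h)//.
have rC : 0 <= r * C by rewrite mulr_ge0// ltW.
have : expR (r * C) - 1 - r * C <= 2 * (r * C) ^+ 2.
  by apply: expR_sub1_le; rewrite rC/=; nra.
move=> h3; have h4 : expR (r * C) - 1 <= 2 * (r * C) by nra.
have : (expR (r * C) - 1) * N (real_cx r *: X) <= 2 * (r * C) * (r * C).
  by rewrite ler_pM ?mnorm_ge0// subr_ge0 -expR0 ler_expR.
by move=> /le_trans; apply; nra.
Qed.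

Lemma ratio_mul (s s' : Cx R) A B X Y : s' * s = 1 -> s * s' = 1 ->
  s' *: (A *m B - 1%:M) - (X + Y) =
  (s' *: (A - 1%:M) - X) + (s' *: (B - 1%:M) - Y) +
  s *: ((s' *: (A - 1%:M)) *m (s' *: (B - 1%:M))).
Proof.
move=> ss ss'; rewrite -scalemxAl -scalemxAr !scalerA ss' mul1r.
rewrite mulmxBl mulmxBr mulmx1 mul1mx.
apply/matrixP => i j.
by rewrite !mxE; ring.
Qed.

Lemma ratio_mul_le (r e c : R) A B X Y : 0 < r ->
  N (real_cx r^-1 *: (A - 1%:M) - X) <= e ->
  N (real_cx r^-1 *: (B - 1%:M) - Y) <= e -> N X + e <= c -> N Y + e <= c ->
  N (real_cx r^-1 *: (A *m B - 1%:M) - (X + Y)) <= 2 * e + r * c ^+ 2.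
Proof.
move=> r0 HX HY Xc Yc; rewrite (ratio_mul (s := real_cx r)); last 2 first.
- by rewrite -real_cxM mulVf ?gt_eqF.
- by rewrite -real_cxM divff ?gt_eqF.
move: HX HY; set A' := _ *: _; set B' := _ *: (B - _) => HX HY.
have NA : N A' <= c.
  by rewrite -(subrK X A') (le_trans (mnormD _ _ _))// (le_trans _ Xc)// addrC lerD2l.
have NB : N B' <= c.
  by rewrite -(subrK Y B') (le_trans (mnormD _ _ _))// (le_trans _ Yc)// addrC lerD2l.
apply: (le_trans (mnormD _ _ _)); rewrite mulr_natl mulr2n.
apply: lerD; first exact: le_trans (mnormD _ _ _) (lerD HX HY).
rewrite mnormZr ger0_norm ?(ltW r0)// ler_wpM2l ?(ltW r0)//.
by rewrite (le_trans (mnormM _ _ _))// expr2 ler_pM ?mnorm_ge0.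
Qed.

(** To first order in r, exp (r X) exp (r Y) is 1 + r (X + Y); [lie_limit] does the rest. *)
Lemma lieD X Y : lie_algebra K X -> lie_algebra K Y -> lie_algebra K (X + Y).
Proof.
move=> LX LY; have [_ KM _ _] := hK; apply: lie_limit => e e0.
set C := N X + N Y; have X0 := mnorm_ge0 N X; have Y0 := mnorm_ge0 N Y.
have C0 : 0 <= C by rewrite addr_ge0.
set e' := Num.min 1 (e / 4); have e'0 : 0 < e' by rewrite lt_min ltr01 divr_gt0.
have e'1 : e' <= 1 by rewrite ge_min lexx.
have e'4 : e' <= e / 4 by rewrite ge_min lexx orbT.
have [d d0 dP] := mexp_small_ratio C0 e'0.
have C1 : 0 < 4 * (C + 1) ^+ 2 by rewrite mulr_gt0// exprn_gt0// ltr_wpDl.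
set q := Num.min d (Num.min e (e / (4 * (C + 1) ^+ 2))).
have q0 : 0 < q by rewrite !lt_min d0 e0 divr_gt0.
set r := q / 2; have r0 : 0 < r by rewrite divr_gt0.
have rq : r < q by rewrite /r ltr_pdivrMr//; lra.
move: (rq); rewrite !lt_min ltr_pdivlMr// => /andP[rd /andP[re rC]].
have rd' : 0 < r < d by rewrite r0.
exists r, (mexp (real_cx r *: X) *m mexp (real_cx r *: Y)); split.
- by rewrite r0.
- by apply: KM; [exact: LX|exact: LY].
apply: (@le_lt_trans _ _ (2 * e' + r * (C + 1) ^+ 2)); last by lra.
apply: ratio_mul_le => //.
- by apply: dP => //; rewrite /C; lra.
- by apply: dP => //; rewrite /C; lra.
- by rewrite /C; lra.
- by rewrite /C; lra.
Qed.

Lemma lie_closed X : (forall e : R, 0 < e -> exists2 Y, lie_algebra K Y & N (Y - X) < e) ->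
  lie_algebra K X.
Proof.
move=> H; apply: lie_limit => e e0; have e20 : 0 < e / 2 by rewrite divr_gt0.
have [Y LY YX] := H _ e20.
have [d d0 dP] := mexp_small_ratio (mnorm_ge0 N Y) (divr_gt0 e0 (ltr0Sn _ 3)).
set r := Num.min d e / 2; have de0 : 0 < Num.min d e by rewrite lt_min d0.
have : r < Num.min d e by rewrite /r ltr_pdivrMr//; lra.
have r0 : 0 < r by rewrite divr_gt0.
rewrite lt_min => /andP[rd re].
exists r, (mexp (real_cx r *: Y)); split; [by rewrite r0|exact: LY|].
rewrite -(subrK Y (real_cx _ *: _)) -addrA (le_lt_trans (mnormD _ _ _))//.
have : N (real_cx r^-1 *: (mexp (real_cx r *: Y) - 1%:M) - Y) <= e / 4.
  by apply: dP; rewrite ?r0.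
lra.
Qed.

End ClosedSubgroup.

(** * Cartan's closed subgroup theorem *)

Section Cartan.
Context (R : realType) (n : nat) (N : matnorm R n).
Implicit Types (A B X Y : 'M[Cx R]_n).
#[local] Opaque mexp.

Lemma compact_disc (C : R) :
  exists2 D : set (Cx R), compact D & forall z, cabs z <= C -> D z.
Proof.
pose f (p : R * R) : Cx R := (p.1 +i* p.2)%C.
have fE p q : f p - f q = ((p.1 - q.1) +i* (p.2 - q.2))%C by [].
have fc : continuous f.
  move=> p; apply/(cvgrPdist_lt (V := Cx R)) => e e0.
  have [er e0'] := @cx_gt0 R e e0.
  have e20 : 0 < complex.Re e / 2 by rewrite divr_gt0.
  near=> q; rewrite er -/(real_cx _) cnorm_lt (le_lt_trans (cabs_le _))// fE /=.
  rewrite [ltRHS]splitr ltrD//.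
    near: q; exists (ball p.1 (complex.Re e / 2), setT) => /=; last by move=> q [].
    by split; [exact: nbhsx_ballx|exact: filterT].
  near: q; exists (setT, ball p.2 (complex.Re e / 2)) => /=; last by move=> q [].
  by split; [exact: filterT|exact: nbhsx_ballx].
exists (f @` (`[- C, C] `*` `[- C, C])).
  apply: continuous_compact; last by apply: compact_setX; exact: segment_compact.
  exact: continuous_subspaceT.
move=> z zC; exists (complex.Re z, complex.Im z); last by case: (z).
have := Re_cabs z; have := Im_cabs z; rewrite /= !in_itv /= !ler_norml.
by move=> /andP[? ?] /andP[? ?]; split; apply/andP; split; lra.
Unshelve. all: by end_near. Qed.

(** The entries are bounded by [mnorm_entry], so the ball lies in the image under [vec_mx] of a
    product of compact discs. *)
Lemma compact_mnorm (C : R) :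
  exists2 D : set 'M[Cx R]_n, compact D & forall A, N A <= C -> D A.
Proof.
pose c := \sum_p \sum_q N (delta_mx p q).
have leC p q : N (delta_mx q p) <= c.
  rewrite /c (bigD1 q)//= (bigD1 p)//= -addrA lerDl addr_ge0//.
    by apply: sumr_ge0 => ? _; exact: mnorm_ge0.
  by apply: sumr_ge0 => ? _; apply: sumr_ge0 => ? _; exact: mnorm_ge0.
have [D cD DP] := compact_disc (c * C).
have cV := @rV_compact (Cx R) (n * n) (fun=> D) (fun=> cD).
exists (@vec_mx _ n n @` [set v : 'rV[Cx R]_(n * n) | forall i, D (v ord0 i)]).
  apply: continuous_compact (cV); apply: continuous_subspaceT => v.
  apply/(@cvg_mnormP _ _ N _ _ (nbhs_filter (v : 'rV[Cx R]_(n * n))) _ _) => e e0.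
  have /nbhs_ballP[d /= d0 dP] : nbhs (vec_mx v) [set B : 'M[Cx R]_n | N (B - vec_mx v) < e].
    by apply/(nbhs_mnormP N); exists e.
  change (nbhs (v : 'rV[Cx R]_(n * n)) [set x | N (vec_mx x - vec_mx v) < e]).
  apply/nbhs_ballP; exists d => //= w [_ vw]; apply: dP; split=> // p q.
  by rewrite !mxE; exact: vw.
move=> A AC; exists (mxvec A); last by rewrite mxvecK.
move=> i /=; case/mxvec_indexP: i => p q; rewrite mxvecE; apply: DP.
by apply: (le_trans (mnorm_entry N _ _ _)); rewrite ler_pM ?mnorm_ge0.
Qed.

Variables (K : set 'M[Cx R]_n).
Hypothesis hK : matrix_lie_group K.
#[local] Opaque lie_algebra.

(** Compactness of the set of directions (B - 1) / |B - 1|. By [lie_limit], a direction outside the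
    Lie algebra has a neighbourhood that no element of [K] close to 1 can follow; near a direction
    inside, that direction is itself the approximation. *)
Lemma lie_tangent (e : R) : 0 < e -> exists2 d : R, 0 < d &
  forall B, K B -> N (B - 1%:M) < d ->
    exists2 X, lie_algebra K X & N (B - 1%:M - X) <= e * N (B - 1%:M).
Proof.
move=> e0; have [D cD DP] := compact_mnorm 1.
pose P (r : R) (Y : 'M[Cx R]_n) := 0 < r -> K (1%:M + real_cx r *: Y) ->
  exists2 X, lie_algebra K X & N (Y - X) <= e.
have := (compact_near_coveringP _).1 cD R (nbhs (0 : R)) P _.
case.
  move=> Y0 _; have [LY|nLY] := pselect (lie_algebra K Y0).
    exists ([set Y | N (Y - Y0) < e], setT) => /=.
      by split; [apply/(nbhs_mnormP N); exists e|exact: filterT].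
    by move=> [Y r] /= [YY0 _] _ _; exists Y0 => //; exact: ltW.
  have [q q0 qP] : exists2 q : R, 0 < q & forall r B, 0 < r < q -> K B ->
      ~ N (real_cx r^-1 *: (B - 1%:M) - Y0) < q.
    apply: contrapT => H; apply: nLY; apply: (lie_limit (N := N) hK) => q q0.
    apply: contrapT => H'; apply: H; exists q => // r B rq KB BY; apply: H'.
    by exists r, B.
  exists ([set Y | N (Y - Y0) < q], ball 0 q) => /=.
    by split; [apply/(nbhs_mnormP N); exists q|exact: nbhsx_ballx].
  move=> [Y r] /= [YY0]; rewrite /ball /= sub0r normrN => rq r0 KB.
  have rq' : 0 < r < q by rewrite r0 (le_lt_trans (ler_norm _)).
  have [] := qP _ _ rq' KB.
  by rewrite addrAC subrr add0r scalerA -real_cxM mulVf ?gt_eqF// real_cx1 scale1r.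
move=> d /= d0 dP; exists d => // B KB Bd.
have [B1|B1] := eqVneq (B - 1%:M) 0.
  by exists 0; [exact: (lie0 N hK)|rewrite B1 subr0 mnorm0 mulr0].
set r := N (B - 1%:M) in Bd *; have r0 : 0 < r.
  by rewrite lt_neqAle mnorm_ge0 andbT eq_sym; apply/eqP => /(mnorm_eq0)/eqP; apply/negP.
have rd : ball_ Num.Def.normr 0 d r by rewrite /ball_ /= sub0r normrN ger0_norm// ltW.
set Y := real_cx r^-1 *: (B - 1%:M).
have rY : real_cx r *: Y = B - 1%:M.
  by rewrite /Y scalerA -real_cxM divff ?gt_eqF// real_cx1 scale1r.
have DY : D Y by apply: DP; rewrite mnormZr ger0_norm ?invr_ge0 ?(ltW r0)// -/r mulVf ?gt_eqF.
have [|X LX XY] := dP r rd Y DY r0; first by rewrite rY addrC subrK.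
exists (real_cx r *: X); first exact: lieZ.
by rewrite -rY -scalerBr mnormZr ger0_norm ?(ltW r0)// mulrC ler_wpM2r// ltW.
Qed.

(** [lie_tangent] supplies only approximate logarithms, but the correction can be repeated on exp
    (X) A^-1, which stays in [K]. Every iterate is in the Lie algebra, which is closed under sums
    and limits. *)
Lemma cartan : exists2 d : R, 0 < d & forall A, K A -> N (A - 1%:M) < d ->
  exists X, [/\ lie_algebra K X, mexp X = A & N X <= 2 * N (A - 1%:M)].
Proof.
have [K1 KM KV _] := hK.
have [d1 d10 T1] := lie_tangent (divr_gt0 (@ltr01 R) (ltr0Sn R 7)).
(* With the tangent error 1 / 8, this [q] and s < q / 32, one step leaves errors of at most b / 8, b
   / 256 and b / 4 for a residual b, in total less than b / 2. *)
pose q : R := 16^-1; have q0 : 0 < q by rewrite invr_gt0.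
have er (r : R) : 0 <= r <= q / 4 -> expR r - 1 <= q.
  move=> /andP[r0 rq]; have := @expR_sub1_le _ r.
  by rewrite /q in rq *; move=> h; have := h _; nra.
set s0 := Num.min (d1 / 2) (q / 32).
have s00 : 0 < s0 by rewrite lt_min !divr_gt0.
(* Newton iteration for mexp X *m invmx A = 1. *)
have newton A' : N (A' - 1%:M) < s0 -> K A' ->
    exists2 X, lie_algebra K X /\ N X <= 4 * N (A' - 1%:M) & mexp X *m A' = 1%:M.
  move=> A's KA'; set s := N (A' - 1%:M) in A's *.
  have ss0 : 0 <= s by exact: mnorm_ge0.
  have sd1 : s < d1 by have := A's; rewrite lt_min => /andP[? _]; lra.
  have sq : s < q / 32 by have := A's; rewrite lt_min => /andP[_].
  (* The residual is halved at each step, and the k-th correction is at most twice the residual s /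
     2^k; these corrections sum to 4 s (1 - 2^-k). *)
  pose good (k : nat) X := [/\ lie_algebra K X, N X <= 4 * s * (1 - 2^-1 ^+ k) &
    N (mexp X *m A' - 1%:M) <= s * 2^-1 ^+ k].
  have half k : 0 < 2^-1 ^+ k :> R by rewrite exprn_gt0// invr_gt0.
  have half1 k : 2^-1 ^+ k <= 1 :> R by rewrite exprn_ile1// ?invr_ge0// invf_le1// ler1n.
  have step k X : good k X -> exists X', good k.+1 X' /\ N (X' - X) <= 2 * s * 2^-1 ^+ k.
    move=> [LX XN XB]; set B := mexp X *m A' in XB; set t := 2^-1 ^+ k in XN XB *.
    have t0 : 0 < t := half k; have t1 : t <= 1 := half1 k.
    have [|Y LY YB] := T1 B (KM _ _ (lie_mexp LX) KA').
      by rewrite (le_lt_trans XB)// (le_lt_trans _ sd1)// ler_piMr// ltW.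
    set b := N (B - 1%:M) in XB YB; have b0 : 0 <= b by exact: mnorm_ge0.
    have NY : N Y <= 2 * b.
      rewrite -(subKr (B - 1%:M) Y) (le_trans (mnormB _ _ _))// -/b.
      by rewrite (le_trans (lerD (lexx _) YB)); lra.
    have Yst : N Y <= 2 * s * t by rewrite (le_trans NY)// -mulrA ler_wpM2l.
    have tS : 2^-1 ^+ k.+1 = t / 2 :> R by rewrite exprSr.
    exists (X - Y); split; last by rewrite addrAC subrr add0r mnormN.
    have X'N : N (X - Y) <= 4 * s * (1 - t / 2).
      by rewrite (le_trans (mnormB _ _ _))//; move: XN Yst; lra.
    rewrite /good tS; split; [|exact: X'N|].
      apply: (lieD N hK LX); rewrite -[Y]opprK.
      rewrite opprK -scaleN1r (_ : -1 = real_cx (-1)); first exact: lieZ.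
      by rewrite /real_cx rmorphN rmorph1.
    have r1 : 4 * s <= q / 4 by lra.
    have XN' : N X <= 4 * s by rewrite (le_trans XN)// ler_piMr//; lra.
    have X'N' : N (X - Y) <= 4 * s.
      by rewrite (le_trans X'N)// ler_piMr//; lra.
    have := mexp_lipschitz X'N' XN'; set D := _ - _ - _ => HD.
    have DY : N D <= q * N Y.
      rewrite (le_trans HD)// (_ : X - Y - X = - Y); last by rewrite addrAC subrr add0r.
      by rewrite mnormN ler_wpM2r ?mnorm_ge0// er// r1 mulr_ge0.
    have -> : mexp (X - Y) *m A' - 1%:M = (B - 1%:M - Y) - Y *m (A' - 1%:M) + D *m A'.
      have -> : mexp (X - Y) = D - Y + mexp X.
        rewrite /D (_ : X - Y - X = - Y); last by rewrite addrAC subrr add0r.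
        by rewrite subrK subrK.
      rewrite mulmxDl mulmxBl -/B mulmxBr mulmx1.
      by apply/matrixP => i j; rewrite !mxE; ring.
    have NA' : N A' <= 2.
      rewrite -(subrK 1%:M A') (le_trans (mnormD _ _ _))// mnorm1 -/s.
      by move: sq; rewrite /q; lra.
    rewrite (le_trans (mnormD _ _ _))// (le_trans (lerD (mnormB _ _ _) (lexx _)))//.
    have H2 : N (Y *m (A' - 1%:M)) <= 2 * b * s.
      by rewrite (le_trans (mnormM _ _ _))// ler_pM ?mnorm_ge0.
    have H3 : N (D *m A') <= q * (2 * b) * 2.
      rewrite (le_trans (mnormM _ _ _))// ler_pM ?mnorm_ge0// (le_trans DY)//.
      by rewrite ler_wpM2l// ltW.
    rewrite (le_trans (lerD (lerD YB H2) H3))//.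
    have bs : b * s <= b * (q / 32) by rewrite ler_wpM2l// ltW.
    by move: XB bs; rewrite /q; lra.
  have [F [F0 FS]] : exists F : nat -> 'M[Cx R]_n, F 0%N = 0 /\
      forall k, good k (F k) /\ N (F k.+1 - F k) <= 2 * s * 2^-1 ^+ k.
    pose S := {p : nat * 'M[Cx R]_n | good p.1 p.2}.
    pose next (p p' : S) := (sval p').1 = (sval p).1.+1 /\
      N ((sval p').2 - (sval p).2) <= 2 * s * 2^-1 ^+ (sval p).1.
    have nx (p : S) : {p' : S | next p p'}.
      apply: cid; case: p => -[k X] /= gX; have [X' [gX' XX']] := step k X gX.
      by exists (exist (fun p => good p.1 p.2) (k.+1, X') gX').
    have g0 : good 0%N 0.
      split; first exact: (lie0 N hK).
        by rewrite mnorm0 expr0 subrr mulr0.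
      by rewrite (mexp0 N) mul1mx expr0 mulr1.
    have [f [f0 fS]] := @dependent_choice S next nx (exist (fun p => good p.1 p.2) (0%N, 0) g0).
    have f1 k : (sval (f k)).1 = k.
      by elim: k => [|k IH]; [rewrite f0|rewrite (fS k).1 IH].
    exists (fun k => (sval (f k)).2); split; first by rewrite f0.
    move=> k; split; first by have := svalP (f k); rewrite f1.
    by have [_] := fS k; rewrite f1.
  pose u k := F k.+1 - F k.
  have ub k : N (u k) <= geometric (2 * s) 2^-1 k by rewrite /geometric /=; exact: (FS k).2.
  have cg : cvgn (series (geometric (2 * s) (2^-1 : R))).
    by apply: is_cvg_geometric_series; rewrite ger0_norm ?invr_ge0// invf_lt1// ltr1n.
  pose X : 'M[Cx R]_n := limn (series u).
  have FX : F @ \oo --> X.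
    rewrite (_ : F = series u); first exact: cvg_mx_series ub cg.
    by apply/funext => k; rewrite /series /= telescope_sumr// F0 subr0.
  have NX : N X <= 4 * s.
    apply: (mnorm_lim_le FX); near=> k; have [[_ h _] _] := FS k.
    by rewrite (le_trans h)// ler_piMr//; have := half k; lra.
  exists X; first split=> //.
    apply: (lie_closed (N := N) hK) => e e0; have /(cvg_mnormP N)/(_ e e0) := FX.
    move=> [M _ HM]; exists (F M); first by have [[]] := FS M.
    by apply: HM => /=.
  apply/eqP; rewrite -subr_eq0; apply/eqP; apply: (@mnorm_eq0_small _ _ N) => e e0.
  have NA' : N A' <= 2.
    rewrite -(subrK 1%:M A') (le_trans (mnormD _ _ _))// mnorm1 -/s.
    by move: sq; rewrite /q; lra.
  have e80 : 0 < e / 8 by rewrite divr_gt0.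
  near \oo => k; have FXk : N (F k - X) < e / 8.
    by near: k; apply: (cvg_mnormP N _ _ _).1 e80.
  have [[_ Fk Bk] _] := FS k.
  have Fk' : N (F k) <= 4 * s.
    by rewrite (le_trans Fk)// ler_piMr//; have := half k; lra.
  have r1 : 4 * s <= q / 4 by lra.
  have := mexp_lipschitz Fk' NX; set D := _ - _ - _ => HD.
  have qle1 : expR (4 * s) - 1 <= 1.
    by rewrite (le_trans (er _ _))//; [rewrite r1 mulr_ge0|rewrite /q; lra].
  have DF : N D <= e / 8.
    by rewrite (le_trans HD)// (le_trans _ (ltW FXk))// ler_piMl// mnorm_ge0.
  have -> : mexp X = mexp (F k) - D - (F k - X) by rewrite /D -[_ - _ - (F k - X)]addrA -opprD subKr addrK.
  have st : s * 2^-1 ^+ k <= e / 4.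
    rewrite exprVn (@le_trans _ _ (s / k%:R))//; last first.
      by apply: ltW; near: k; apply: near_divn_lt; rewrite divr_gt0.
    have k0 : (0 < k)%N by near: k; exact: nbhs_infty_gt.
    rewrite ler_wpM2l// lef_pV2 ?posrE ?ltr0n ?exprn_gt0//.
    by rewrite -natrX ler_nat ltnW// ltn_expl.
  rewrite !mulmxBl [X in N X]addrAC [X in N (X - _)]addrAC.
  apply: (le_trans (mnormB _ _ _)); apply: (le_trans (lerD (mnormB _ _ _) (lexx _))).
  have H1 : N (D *m A') <= e / 8 * 2.
    by rewrite (le_trans (mnormM _ _ _))// ler_pM ?mnorm_ge0.
  have H2 : N ((F k - X) *m A') <= e / 8 * 2.
    by rewrite (le_trans (mnormM _ _ _))// ler_pM ?mnorm_ge0// ltW.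
  rewrite !mulmxBl in H1 H2.
  rewrite (le_trans (lerD (lerD (le_trans Bk st) H1) H2))//; lra.
have NV A : N (A - 1%:M) < 1 / 2 -> K A -> N (invmx A - 1%:M) <= 2 * N (A - 1%:M).
  move=> A1 /KV[uA _]; set B := invmx A.
  have BA : B - 1%:M = - (B *m (A - 1%:M)) by rewrite mulmxBr mulVmx// mulmx1 opprB.
  have NB : N B <= 2.
    have : N B <= N (B - 1%:M) + 1.
      by rewrite -{1}(subrK 1%:M B) (le_trans (mnormD _ _ _))// mnorm1.
    have : N (B - 1%:M) <= N B * (1 / 2).
      by rewrite BA mnormN (le_trans (mnormM _ _ _))// ler_wpM2l ?mnorm_ge0// ltW.
    lra.
  by rewrite BA mnormN (le_trans (mnormM _ _ _))// ler_wpM2r ?mnorm_ge0.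
(* The iteration is run on the inverse of A, which is at most twice as far from 1 as A. *)
set d := Num.min (1 / 2) (s0 / 2).
have d0 : 0 < d by rewrite lt_min !divr_gt0.
exists d => // A KA; rewrite lt_min => /andP[A2 As].
have NA' := NV A A2 KA; have [uA KA'] := KV A KA.
have A's : N (invmx A - 1%:M) < s0 by rewrite (le_lt_trans NA')//; lra.
have [X [LX NX] XA] := newton _ A's KA'; exists X.
have XE : mexp X = A by rewrite -[mexp X]mulmx1 -(mulVmx uA) mulmxA XA mul1mx.
split=> //; rewrite -XE; have := mexp_approx NX; rewrite XE.
have s4 : N (invmx A - 1%:M) < q / 32 by have := A's; rewrite lt_min => /andP[_].
have : expR (4 * N (invmx A - 1%:M)) - 1 <= 1 / 2.
  rewrite (le_trans (er _ _))//; last by rewrite /q; lra.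
  by rewrite mulr_ge0 ?mnorm_ge0//=; lra.
move=> h1 h2; have X0 := mnorm_ge0 N X.
have : N X <= N (A - 1%:M - X) + N (A - 1%:M).
  by rewrite -{1}(subKr (A - 1%:M) X) (le_trans (mnormB _ _ _))// addrC.
have : (expR (4 * N (invmx A - 1%:M)) - 1) * N X <= 1 / 2 * N X by rewrite ler_wpM2r.
lra.
Unshelve. all: by end_near. Qed.

End Cartan.

(** * Automorphisms of the second kind *)

Section GroupAutomorphism.
Context (R : realType) (n : nat) (N : matnorm R n) (G : set 'M[Cx R]_n).
Context (g : {vspace 'M[Cx R]_n}) (s : Cx R -> Cx R).
Context (phi L : 'M[Cx R]_n -> 'M[Cx R]_n).
Hypothesis hG : matrix_lie_group G.
Hypothesis hg : forall X, X \in g <-> lie_algebra G X.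
Hypothesis hs : s = id \/ s = Num.conj.
Hypothesis phi_bij : set_bij G G phi.
Hypothesis phiM : forall A B, G A -> G B -> phi (A *m B) = phi A *m phi B.
Hypothesis phi_exp : forall X, X \in g -> L X \in g /\ phi (mexp X) = mexp (L X).
Hypothesis L_lin : forall c X Y, X \in g -> Y \in g ->
  L (c *: X + Y) = s c *: L X + L Y.
Implicit Types (A B X Y : 'M[Cx R]_n) (z w c : Cx R).
#[local] Opaque mexp lie_algebra.

Lemma semi1 : s 1 = 1.
Proof. by case: hs => ->; rewrite ?rmorph1. Qed.

Lemma semi0 : s 0 = 0.
Proof. by case: hs => ->; rewrite ?rmorph0. Qed.

Lemma semiB z w : s (z - w) = s z - s w.
Proof. by case: hs => ->; rewrite ?rmorphB. Qed.

Lemma semiK z : s (s z) = z.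
Proof. by case: hs => ->; rewrite ?conjCK. Qed.

Lemma cabs_semi z : cabs (s z) = cabs z.
Proof. by case: hs => ->; rewrite ?cabs_conj. Qed.

Lemma semiV z : s z^-1 = (s z)^-1.
Proof. by case: hs => ->; rewrite ?fmorphV. Qed.

Lemma semi_real (t : R) : s (real_cx t) = real_cx t.
Proof.
case: hs => -> //; apply: CrealP; rewrite realE.
by rewrite -[0]/(real_cx 0) !real_cx_le; exact: num_real.
Qed.

Lemma semilin0 : L 0 = 0.
Proof.
have := L_lin 1 (mem0v g) (mem0v g); rewrite scaler0 addr0 semi1 scale1r.
by move/eqP; rewrite -subr_eq0 opprD addrA subrr add0r oppr_eq0 => /eqP.
Qed.

Lemma semilinZ c X : X \in g -> L (c *: X) = s c *: L X.
Proof. by move=> LX; rewrite -[c *: X]addr0 (L_lin _ LX (mem0v g)) semilin0 addr0. Qed.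

Lemma semilinD X Y : X \in g -> Y \in g -> L (X + Y) = L X + L Y.
Proof. by move=> LX LY; rewrite -[X in LHS]scale1r L_lin// semi1 scale1r. Qed.

Lemma semilinB X Y : X \in g -> Y \in g -> L (X - Y) = L X - L Y.
Proof.
by move=> LX LY; apply/(addIr (L Y)); rewrite -semilinD ?subrK// memvB.
Qed.

Lemma mx_functional_bound (f : {linear 'M[Cx R]_n -> Cx R^o}) :
  exists2 C : R, 0 <= C & forall X, cabs (f X) <= C * N X.
Proof.
pose C := \sum_p \sum_q N (delta_mx q p) * cabs (f (delta_mx p q)).
exists C.
  by apply: sumr_ge0 => p _; apply: sumr_ge0 => q _; rewrite mulr_ge0 ?mnorm_ge0 ?cabs_ge0.
have cabs_sum (I : Type) (r : seq I) (F : I -> Cx R) :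
    cabs (\sum_(i <- r) F i) <= \sum_(i <- r) cabs (F i).
  elim/big_ind2: _ => [|x1 x2 y1 y2 h1 h2|//]; first by rewrite cabs0.
  by rewrite (le_trans (cabsD _ _))// lerD.
move=> X; rewrite {1}(matrix_sum_delta X) linear_sum (le_trans (cabs_sum _ _ _))//.
rewrite mulr_suml ler_sum// => p _.
rewrite linear_sum (le_trans (cabs_sum _ _ _))// mulr_suml ler_sum// => q _.
rewrite linearZ /= cabsM mulrAC ler_wpM2r ?cabs_ge0//; exact: mnorm_entry.
Qed.

(** [L] is semilinear on [g] only, so its continuity is read off in the coordinates of a basis of
    [g]. *)
Lemma semilin_bound : exists2 C : R, 0 <= C & forall X, X \in g -> N (L X) <= C * N X.
Proof.
pose e := vbasis g.
have eg i : e`_i \in g.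
  have [ig|ig] := ltnP i (\dim g); last by rewrite nth_default ?size_tuple// mem0v.
  by apply/vbasis_mem/mem_nth; rewrite size_tuple.
pose f i : 'M[Cx R]_n -> Cx R^o := coord e i.
have [C C0 HC] : exists2 C : R, 0 <= C & forall i X, cabs (f i X) <= C * N X.
  have h i := mx_functional_bound (f i).
  pose c i := sval (cid2 (h i)).
  have [c0 cP] : (forall i, 0 <= c i) /\ (forall i X, cabs (f i X) <= c i * N X).
    by split=> i; rewrite /c; case: (cid2 (h i)).
  exists (\sum_i c i); first by apply: sumr_ge0 => i _.
  move=> i X; rewrite (le_trans (cP i X))// ler_wpM2r ?mnorm_ge0// (bigD1 i)//= lerDl.
  by apply: sumr_ge0.
have Lsum (I : Type) (r : seq I) (F : I -> 'M[Cx R]_n) : (forall i, F i \in g) ->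
    L (\sum_(i <- r) F i) = \sum_(i <- r) L (F i).
  move=> LF; elim: r => [|i r IH]; first by rewrite !big_nil semilin0.
  by rewrite !big_cons semilinD// ?IH// memv_suml.
exists (\sum_(i < \dim g) C * N (L e`_i)).
  by apply: sumr_ge0 => i _; rewrite mulr_ge0 ?mnorm_ge0.
move=> X LX; rewrite {1}(coord_vbasis LX) Lsum; last by move=> i; rewrite memvZ.
rewrite (le_trans (mnorm_sum _ _ _ _))// mulr_suml ler_sum// => i _.
by rewrite semilinZ// mnormZabs cabs_semi mulrAC ler_wpM2r ?mnorm_ge0.
Qed.

Lemma auto1 : phi 1%:M = 1%:M.
Proof.
have [G1 _ GV _] := hG; have [phiG _ _] := phi_bij.
have [u _] := GV _ (phiG _ G1).
have := phiM G1 G1; rewrite mulmx1 => /(congr1 (mulmx (invmx (phi 1%:M)))).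
by rewrite mulVmx// mulKmx.
Qed.

(** Differentiability of [phi] at 1. [cartan] writes A as exp X with X of size at most 2 |A - 1|,
    and then phi (A) = exp (L X). *)
Lemma auto_diff (e : R) : 0 < e -> exists2 d : R, 0 < d &
  forall A, G A -> N (A - 1%:M) < d -> exists X, [/\ X \in g,
     N X <= 2 * N (A - 1%:M), N (A - 1%:M - X) <= e * N (A - 1%:M) &
     N (phi A - 1%:M - L X) <= e * N (A - 1%:M)].
Proof.
move=> e0; have [C C0 HC] := semilin_bound.
have [d1 d10 H1] := cartan N hG.
(* For y at most 2 (1 + C) a, the quadratic remainder 2 y^2 is at most K a^2. *)
pose K := 8 * (1 + C) ^+ 2.
have K0 : 0 < K by rewrite mulr_gt0// exprn_gt0// ltr_pwDl.
exists (Num.min d1 (Num.min (e / K) (1 / (4 * (1 + C))))).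
  by rewrite !lt_min d10 !divr_gt0// mulr_gt0// ltr_pwDl.
move=> A GA; rewrite !lt_min !ltr_pdivlMr ?mulr_gt0 ?ltr_pwDl// => /andP[/(H1 _ GA)].
move=> [X [/hg LX XA NX]] /andP[AK AC]; exists X.
set a := N (A - 1%:M) in NX AK AC *; have a0 : 0 <= a by exact: mnorm_ge0.
have est Y (y : R) : N Y <= y -> y <= 2 * (1 + C) * a -> N (mexp Y - 1%:M - Y) <= e * a.
  move=> Yy ya; have y0 : 0 <= y by exact: le_trans (mnorm_ge0 _ _) Yy.
  rewrite (le_trans (mexp_approx Yy))//.
  have y2 : y <= 1 / 2 by rewrite (le_trans ya)//; lra.
  have := @expR_sub1_le _ y; rewrite y0 y2 => /(_ isT) h.
  have h2 : expR y - 1 <= 2 * y by nra.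
  have h3 : 0 <= expR y - 1 by rewrite subr_ge0 -expR0 ler_expR.
  rewrite (le_trans (ler_pM _ _ h2 Yy))// ?mnorm_ge0//.
  have : 2 * y * y <= 2 * (2 * (1 + C) * a) * (2 * (1 + C) * a).
    by rewrite ler_pM// ?mulr_ge0// ler_wpM2l.
  move=> /le_trans; apply.
  rewrite (_ : _ * _ = a * K * a); last by rewrite /K; ring.
  by rewrite ler_wpM2r// ltW.
split=> //; first by rewrite -XA; apply: (est _ (2 * a)) => //; nra.
rewrite -XA (phi_exp LX).2; apply: (est _ (C * (2 * a))); last by nra.
by rewrite (le_trans (HC _ LX))// ler_wpM2l.
Qed.

(** Writing B = B0 A moves the question to the identity. *)
Lemma auto_continuous B0 (e : R) : G B0 -> 0 < e -> exists2 d : R, 0 < d &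
  forall B, G B -> N (B - B0) < d -> N (phi B - phi B0) < e.
Proof.
move=> GB0 e0; have [_ GM GV _] := hG; have [u0 GV0] := GV _ GB0.
have [C C0 HC] := semilin_bound; have [d d0 H] := auto_diff (@ltr01 R).
have p0 := mnorm_ge0 N (phi B0); have v0 := mnorm_ge0 N (invmx B0).
have P1 : 0 < N (phi B0) + 1 by rewrite ltr_wpDl.
have V1 : 0 < N (invmx B0) + 1 by rewrite ltr_wpDl.
have D1 : 0 < 1 + 2 * C by rewrite ltr_pwDl// mulr_ge0.
set q := Num.min d (e / (N (phi B0) + 1) / (1 + 2 * C)).
have q0 : 0 < q by rewrite lt_min d0 !divr_gt0.
exists (q / (N (invmx B0) + 1)); first by rewrite divr_gt0.
move=> B GB; rewrite ltr_pdivlMr// => BB0.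
set A := invmx B0 *m B; have GA : G A by apply: GM.
have BA : B = B0 *m A by rewrite /A mulKVmx.
have NA : N (A - 1%:M) < q.
  rewrite (_ : A - 1%:M = invmx B0 *m (B - B0)); last by rewrite mulmxBr mulVmx.
  rewrite (le_lt_trans (mnormM _ _ _))// (le_lt_trans _ BB0)// mulrC ler_wpM2l ?mnorm_ge0//.
  by rewrite lerDl.
move: NA; rewrite lt_min => /andP[/(H _ GA)[X [LX NX _ NphiA]]].
rewrite !ltr_pdivlMr// => NA; rewrite mul1r in NphiA.
have a0 := mnorm_ge0 N (A - 1%:M).
rewrite {1}BA phiM// -[X in _ - X]mulmx1 -mulmxBr (le_lt_trans (mnormM _ _ _))//.
have : N (phi A - 1%:M) <= (1 + 2 * C) * N (A - 1%:M).
  rewrite -(subrK (L X) (_ - _)) (le_trans (mnormD _ _ _))// mulrDl mul1r lerD//.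
  by rewrite (le_trans (HC _ LX))// mulrAC -mulrA [leRHS]mulrC -[leRHS]mulrA mulrCA ler_wpM2l// mulrC.
have := mnorm_ge0 N (phi A - 1%:M); nra.
Qed.

Lemma cdiff_derivable (f : Cx R -> 'M[Cx R]_n) z : cdiff N f z -> derivable f z 1.
Proof.
move=> [D fD]; apply/cvg_ex; exists D; apply/(cvg_mnormP N) => e e0.
have [r r0 H] := fD _ (divr_gt0 e0 (ltr0Sn R 1)).
rewrite nearE /dnbhs /within /=; apply/nbhs_cabsP; exists r => // w.
rewrite subr0 => wr w0; have cw : 0 < cabs w by rewrite cabs_gt0.
have := H (w + z); rewrite addrK => /(_ wr) h.
rewrite [w%:A]mulr1 (_ : _ - D = w^-1 *: (f (w + z) - (f z + w *: D))); last first.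
  by rewrite opprD addrA [RHS]scalerBr scalerA mulVf// scale1r.
rewrite mnormZabs cabsV ltr_pdivrMl// (le_lt_trans h)// mulrC ltr_pM2l//.
by lra.
Qed.

Lemma disc_continuousP (f : Cx R -> 'M[Cx R]_n) :
  {within [set z | `|z| <= 1], continuous f} <-> disc_continuous N f.
Proof.
split=> [fc z0 z01 e e0|fc].
  have hz : f z @[z --> within [set z | `|z| <= 1] (nbhs z0)] --> f z0.
    by apply: ((subspace_continuousP _ _).1 fc z0); rewrite /= cnorm_le1.
  have /cvg_mnormP-/(_ N e e0) := hz; rewrite nearE /within /= => H.
  have [r r0 rP] := (nbhs_cabsP _ _).1 H.
  by exists r => // w w1 /rP; apply; rewrite cnorm_le1.
apply/subspace_continuousP => z0; rewrite /= cnorm_le1 => z01.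
apply/(cvg_mnormP N) => e e0; rewrite nearE /within /=; apply/nbhs_cabsP.
by have [r r0 rP] := fc z0 z01 e e0; exists r => // w wr; rewrite cnorm_le1 => /rP; apply.
Qed.

Lemma ext_closed_disc u h z : (forall z, `|z| = 1 -> G (u z)) ->
  holomorphic_extension G u h -> cabs z <= 1 -> G (h z).
Proof.
move=> Gu [hd _ hu]; rewrite le_eqVlt => /orP[/eqP z1|z1].
  by rewrite hu; [apply: Gu|]; apply: norm1_cabs.
by apply: (hd z _).2; rewrite cnorm_lt1.
Qed.

(** When [phi] is antilinear, the conjugation in the argument compensates the one in [L], so the
    composite is again complex differentiable; its logarithmic derivative is [L Y], with Y that of h
    at the reflected point, rescaled by c. *)
Lemma auto_extension u h c : (forall z, `|z| = 1 -> G (u z)) -> cabs c = 1 ->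
  holomorphic_extension G u h ->
  holomorphic_extension G (fun z => phi (u (c * s z))) (fun z => phi (h (c * s z))).
Proof.
move=> Gu c1 uh; have [hd hc hu] := uh; have [_ GM GV _] := hG; have [phiG _ _] := phi_bij.
have k1 z : cabs (c * s z) = cabs z by rewrite cabsM c1 mul1r cabs_semi.
have kB w z : c * s w - c * s z = c * s (w - z) by rewrite semiB mulrBr.
have Gh z : cabs z <= 1 -> G (h (c * s z)).
  by move=> z1; apply: (ext_closed_disc Gu uh); rewrite k1.
split; last 2 first.
- apply/disc_continuousP => z0 z01 e e0.
  have [d d0 dP] := auto_continuous (Gh z0 z01) e0.
  have z01' : cabs (c * s z0) <= 1 by rewrite k1.
  have [r r0 rP] := (disc_continuousP h).1 hc (c * s z0) z01' d d0.
  exists r => // w w1 wr; apply: dP; first exact: Gh.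
  by apply: rP; rewrite ?kB k1.
- by move=> z z1; rewrite hu//; apply: norm1_cabs; rewrite k1; exact: cabs_norm1.
move=> z; rewrite cnorm_lt1 => z1; split; last by apply: phiG; exact: Gh (ltW z1).
set h0 := h (c * s z); have Gh0 : G h0 by exact: Gh (ltW z1).
have [u0 GV0] := GV _ Gh0.
have [D HD] : cdiff N h (c * s z).
  by apply/derivable_cdiff/(hd _ _).1; rewrite cnorm_lt1 k1.
pose Y := c *: (invmx h0 *m D).
set V := N (invmx h0); have V0 : 0 <= V by exact: mnorm_ge0.
(* The logarithmic derivative of h at c * s z is tangent to G. *)
have Yg : Y \in g.
  apply/hg/(lie_limit (N := N) hG) => e e0.
  have e1 : 0 < e / (V + 1) / 2 by rewrite !divr_gt0// ltr_wpDl.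
  have [r r0 Hr] := HD _ e1.
  set t := Num.min e (Num.min r (1 - cabs z)) / 2.
  have m0 : 0 < Num.min e (Num.min r (1 - cabs z)) by rewrite !lt_min e0 r0 subr_gt0.
  have t0 : 0 < t by rewrite divr_gt0.
  have : t < Num.min e (Num.min r (1 - cabs z)) by rewrite /t ltr_pdivrMr//; lra.
  rewrite !lt_min => /andP[te /andP[tr tz]].
  have ct : cabs (real_cx t) = t by rewrite cabs_real ger0_norm// ltW.
  have zt : cabs (z + real_cx t) <= 1 by rewrite (le_trans (cabsD _ _))// ct; lra.
  exists t, (invmx h0 *m h (c * s (z + real_cx t))); split; first by rewrite t0.
    by apply: GM => //; exact: Gh.
  have := Hr (c * s (z + real_cx t)); rewrite kB addrAC subrr add0r semi_real.
  rewrite cabsM c1 mul1r ct => /(_ tr); set E := _ - _ => NE.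
  rewrite (_ : _ - Y = real_cx t^-1 *: (invmx h0 *m E)); last first.
    rewrite /E mulmxBr mulmxDr mulVmx// opprD addrA [RHS]scalerBr; congr (_ - _).
    rewrite -scalemxAr scalerA mulrCA -real_cxM mulVf ?gt_eqF// real_cx1 mulr1.
    by [].
  rewrite mnormZr ger0_norm ?invr_ge0 ?(ltW t0)// ltr_pdivrMl//.
  rewrite (le_lt_trans (mnormM _ _ _))// (le_lt_trans (ler_wpM2l (mnorm_ge0 _ _) NE))//.
  rewrite -/V mulrA mulrC ltr_pM2l// mulrA mulrA ltr_pdivrMr//.
  by rewrite -mulrA mulrCA ltr_pM2l// ltr_pdivrMr ?ltr_wpDl//; lra.
apply: cdiff_derivable; exists (phi h0 *m L Y) => e e0.
have [C C0 HC] := semilin_bound; set P := N (phi h0).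
have P0 : 0 <= P by exact: mnorm_ge0.
set y := N Y; have y0 : 0 <= y by exact: mnorm_ge0.
(* The final error is e1 P (1 + C) (y + 2 V) |w - z|; [K] dominates the factor of [e1] and is
   positive even when that factor is 0. *)
set K := (P + 1) * (1 + C) * (y + 2 * V + 1).
have K0 : 0 < K by rewrite /K !mulr_gt0//; lra.
pose e1 := Num.min 1 (e / K); have e10 : 0 < e1 by rewrite lt_min ltr01 divr_gt0.
have e11 : e1 <= 1 by rewrite ge_min lexx.
have e1K : e1 * K <= e by rewrite -ler_pdivlMr// ge_min lexx orbT.
have [d d0 Hd] := auto_diff e10; have [r r0 Hr] := HD _ e10.
have yV : 0 < y + V + 1 by rewrite ltr_wpDl// addr_ge0.
exists (Num.min (Num.min r (1 - cabs z)) (d / (y + V + 1))).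
  by rewrite !lt_min r0 subr_gt0 z1 divr_gt0.
move=> w; rewrite !lt_min ltr_pdivlMr// => /andP[/andP[wr wz] wd].
have w1 : cabs w <= 1.
  by rewrite -(subrK z w) (le_trans (cabsD _ _))//; lra.
have := Hr (c * s w); rewrite kB k1 => /(_ wr); set E := _ - _ => NE.
(* Translation to the identity, where [auto_diff] applies. *)
set A := invmx h0 *m h (c * s w).
have AE : A - 1%:M = s (w - z) *: Y + invmx h0 *m E.
  rewrite /E mulmxBr mulmxDr mulVmx// -scalemxAr /Y scalerA [s _ * c]mulrC.
  by rewrite [1%:M + _]addrC opprD addrCA addNKr.
have GA : G A by apply: GM => //; exact: Gh.
set q := cabs (w - z) in wr wz wd NE *; have q0 : 0 <= q by exact: cabs_ge0.
have NVE : N (invmx h0 *m E) <= V * (e1 * q).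
  by rewrite (le_trans (mnormM _ _ _))// ler_wpM2l.
have NA : N (A - 1%:M) <= (y + V) * q.
  rewrite AE (le_trans (mnormD _ _ _))// mnormZabs cabs_semi -/q mulrDl [y * q]mulrC lerD//.
  by rewrite (le_trans NVE)// ler_wpM2l// ler_piMl.
have [|X [Xg NX AX phiX]] := Hd _ GA; first by rewrite (le_lt_trans NA)//; nra.
set Z := X - s (w - z) *: Y; have Zg : Z \in g by rewrite memvB// memvZ.
have NZ : N Z <= e1 * (y + 2 * V) * q.
  rewrite (_ : Z = invmx h0 *m E - (A - 1%:M - X)); last first.
    by rewrite /Z AE [_ *: _ + _]addrC opprB addrCA opprD addNKr.
  rewrite (le_trans (mnormB _ _ _))// (le_trans (lerD NVE AX))//.
  by have := ler_wpM2l (ltW e10) NA; nra.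
have hE : h (c * s w) = h0 *m A by rewrite mulKVmx.
have LXE : L X = L Z + (w - z) *: L Y.
  have XE : X = Z + s (w - z) *: Y by rewrite /Z subrK.
  by rewrite {1}XE (semilinD Zg (memvZ _ Yg)) (semilinZ _ Yg) semiK.
rewrite hE phiM// (_ : _ - _ = phi h0 *m ((phi A - 1%:M - L X) + L Z)); last first.
  have -> : phi A - 1%:M - L X + L Z = phi A - 1%:M - (w - z) *: L Y.
    by rewrite LXE; move: (phi A - 1%:M) => a; rewrite opprD addrA addrAC subrK.
  rewrite mulmxBr mulmxBr mulmx1 -scalemxAr.
  by rewrite opprD addrA.
rewrite (le_trans (mnormM _ _ _))// -/P.
have : N (phi A - 1%:M - L X + L Z) <= e1 * ((1 + C) * (y + 2 * V)) * q.
  rewrite (le_trans (mnormD _ _ _))// (le_trans (lerD phiX (HC _ Zg)))//.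
  have := ler_wpM2l C0 NZ; have := ler_wpM2l (ltW e10) NA.
  have : 0 <= e1 * V * q by rewrite !mulr_ge0// ltW.
  lra.
move=> /(ler_wpM2l P0) /le_trans; apply.
rewrite [leLHS](_ : _ = e1 * (P * (1 + C) * (y + 2 * V)) * q); last by ring.
rewrite ler_wpM2r// (le_trans _ e1K)// ler_wpM2l ?(ltW e10)// /K.
rewrite ler_pM ?mulr_ge0 ?addr_ge0 ?mulr_ge0//; last by rewrite lerDl.
by rewrite ler_wpM2r ?addr_ge0// lerDl.
Qed.

End GroupAutomorphism.

(** * Reflection of Fourier coefficients by a semilinear map *)

Section CircleAverageSemilinear.
Context (R : realType) (n : nat) (N : matnorm R n).
Context (g : {vspace 'M[Cx R]_n}) (s : Cx R -> Cx R) (L : 'M[Cx R]_n -> 'M[Cx R]_n).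
Hypothesis hs : s = id \/ s = Num.conj.
Hypothesis L_lin : forall c X Y, X \in g -> Y \in g ->
  L (c *: X + Y) = s c *: L X + L Y.
Implicit Types (X Y : wiener N) (f : Cx R -> 'M[Cx R]_n).

(* The midpoint sum divided by h, so that all the weights are real. *)
Fixpoint midmean M f (a h : Cx R) : 'M[Cx R]_n :=
  if M is M'.+1 then
    real_cx (1 / 2) *: (midmean M' f a (h / 2) + midmean M' f (a + h / 2) (h / 2))
  else f (a + h / 2).

Lemma midsum_mean M f a h : midsum M f a h = h *: midmean M f a h.
Proof.
elim: M a h => [//|M IH] a h /=; rewrite !IH -scalerDr scalerA; congr (_ *: _).
by rewrite real_cx_half real_cx1 div1r.
Qed.

Lemma circ_avg_mean M f : circ_avg M f = midmean M (fun w => f (cexp w)) 0 (tau2 R).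
Proof. by rewrite /circ_avg midsum_mean scalerA mulVf ?scale1r// tau2_neq0. Qed.

(** [s] fixes real weights, so [L] passes through the mean even when it is antilinear. *)
Lemma midmean_semilin M f a (t : R) :
  (forall u : R, f (a + real_cx u * tau2 R) \in g) ->
  midmean M f a (real_cx t * tau2 R) \in g /\
  L (midmean M f a (real_cx t * tau2 R)) =
  midmean M (fun z => L (f z)) a (real_cx t * tau2 R).
Proof.
have h2 (u : R) : real_cx u * tau2 R / 2 = real_cx (u / 2) * tau2 R.
  by rewrite real_cx_half mulrAC.
elim: M a t => [|M IH] a t fg /=; rewrite h2; first by split.
have [g1 L1] := IH a (t / 2) fg.
have [|g2 L2] := IH (a + real_cx (t / 2) * tau2 R) (t / 2).
  by move=> u; rewrite -addrA -mulrDl -real_cxD.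
have g12 := memvD g1 g2; split; first exact: memvZ.
rewrite (semilinZ hs L_lin _ g12) (semilinD hs L_lin g1 g2) L1 L2.
by rewrite (semi_real hs).
Qed.

Lemma circ_avg_semilin M f : (forall z, cabs z = 1 -> f z \in g) ->
  circ_avg M f \in g /\ L (circ_avg M f) = circ_avg M (fun z => L (f z)).
Proof.
move=> fg; rewrite !circ_avg_mean -[tau2 R]mul1r.
have := @midmean_semilin M (fun w => f (cexp w)) 0 1; apply=> u.
by rewrite add0r fg// cabs_cexp_tau2.
Qed.

#[local] Opaque circ_avg loop_eval.

(* Comparing coefficients, X_(-k) is a multiple of L (X_k), up to conjugation. *)
Lemma tangent_reflect X c (k : nat) : cabs c = 1 ->
  (forall z, cabs z = 1 -> loop_eval X z \in g) ->
  (forall z, cabs z = 1 -> loop_eval X z = L (loop_eval X (c * (s z)^-1))) ->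
  X k%:Z = 0 -> X (- k%:Z) = 0.
Proof.
move=> c1 Xg XL Xk; apply: (@mnorm_eq0_small _ _ N) => e e0.
have [C C0 HC] := semilin_bound N hs L_lin.
have C1 : 0 < C + 1 by rewrite ltr_wpDl.
have e1 : 0 < e / 2 / (C + 1) by rewrite !divr_gt0.
have e20 : 0 < e / 2 by rewrite divr_gt0.
have [M1 H1] := fourier_coef (- k%:Z) X (cabs1 R) (or_introl erefl) e20.
(* The averages tend to c^k X_k = 0 in both cases. For [s = id] this is [fourier_coef] at index -k
   with the argument c / z; for conjugation, the inverse of z on the circle is its conjugate, so the
   argument is c z and the index k. *)
have [M2 H2] : exists M2, forall M, (M2 <= M)%N ->
    N (circ_avg M (fun z => s (z ^ k%:Z) *: loop_eval X (c * (s z)^-1))) < e / 2 / (C + 1).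
  have [sE|sE] := hs.
    have [M2 H2] := fourier_coef (- k%:Z) X c1 (or_intror erefl) e1.
    exists M2 => M /H2; rewrite mulN1r opprK Xk scaler0 subr0 => h.
    suff E : circ_avg M (fun z => s (z ^ k%:Z) *: loop_eval X (c * (s z)^-1)) =
      circ_avg M (fun z => z ^ k%:Z *: loop_eval X (c * z ^ (-1))) by rewrite E; exact: h.
    by apply: (circ_avg_ext N) => z _; rewrite sE /= exprN1.
  have [M2 H2] := fourier_coef k%:Z X c1 (or_introl erefl) e1.
  exists M2 => M /H2; rewrite mul1r Xk scaler0 subr0 => h.
  suff E : circ_avg M (fun z => s (z ^ k%:Z) *: loop_eval X (c * (s z)^-1)) =
    circ_avg M (fun z => z ^ (- k%:Z) *: loop_eval X (c * z ^ 1)) by rewrite E; exact: h.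
  apply: (circ_avg_ext N) => z z1.
  have zz : z^* = z^-1.
    have z0 : z != 0 by rewrite -cabs_gt0 z1.
    by apply: (mulfI z0); rewrite -normCK (norm1_cabs z1) expr1n divff.
  have zk : (z ^ k%:Z)^* = z ^ (- k%:Z) by rewrite -exprz_inv -zz -!exprnP rmorphXn.
  by rewrite sE zk zz invrK expr1z.
move: H1 H2 => /(_ _ (leq_maxl M1 M2)) + /(_ _ (leq_maxr M1 M2)).
move: (maxn M1 M2) => M; rewrite exp1rz scale1r mul1r opprK => H1 H2.
have fg z : cabs z = 1 -> s (z ^ k%:Z) *: loop_eval X (c * (s z)^-1) \in g.
  by move=> z1; rewrite memvZ// Xg// cabsM c1 mul1r cabsV (cabs_semi hs) z1 invr1.
have [Ag LA] := circ_avg_semilin M fg.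
have AE : circ_avg M (fun z => z ^ k%:Z *: loop_eval X (1 * z ^ 1)) =
    L (circ_avg M (fun z => s (z ^ k%:Z) *: loop_eval X (c * (s z)^-1))).
  rewrite LA; apply: (circ_avg_ext N) => z z1; rewrite mul1r expr1z (semilinZ hs L_lin).
    by rewrite (semiK hs) XL.
  by rewrite Xg// cabsM c1 mul1r cabsV (cabs_semi hs) z1 invr1.
rewrite AE in H1; move: H1 H2; set A := circ_avg _ _ => H1 H2.
rewrite -(subKr (L A) (X _)) (le_trans (mnormB _ _ _))//.
have : N (L A) <= C * (e / 2 / (C + 1)).
  by rewrite (le_trans (HC _ Ag))// ler_wpM2l// ltW.
have : C * (e / 2 / (C + 1)) <= e / 2.
  by rewrite mulrA ler_pdivrMr// mulrC ler_wpM2l ?(ltW e20)// lerDl.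
lra.
Qed.

End CircleAverageSemilinear.

(** * Involutions of the second kind acting on loops *)

Section SecondKind.
Context (R : realType) (n : nat) (N : matnorm R n) (G : set 'M[Cx R]_n).
Context (H : set (wiener N)) (tau : wiener N -> wiener N).
Hypothesis hG : connected_complex_semisimple_group G.
Hypothesis htau : involution_second_kind G H tau.
Hypothesis HG : H `<=` LambdaG G.
Implicit Types (x y X : wiener N) (A B : 'M[Cx R]_n) (z c : Cx R).
#[local] Opaque loop_eval mexp.

Lemma loop_evalZ (t : R) x z : cabs z = 1 ->
  loop_eval (t *: x) z = real_cx t *: loop_eval x z.
Proof.
move=> z1; have -> : t *: x = wmul (mono N (real_cx t)%:M 0) x.
  apply: wienerE => k; rewrite /= /wconv (@zsum_single _ _ N _ 0) => [|i /negbTE i0].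
    by rewrite monoE eqxx subr0 mul_scalar_mx.
  by rewrite monoE i0 mul0mx.
by rewrite loop_evalM// loop_eval_mono expr0z scale1r mul_scalar_mx.
Qed.

Lemma tau_loop_automorphism : loop_automorphism H tau /\ has_order H tau 2.
Proof. by case: htau => -[]. Qed.

Lemma tau_H x : H x -> H (tau x).
Proof. by have [[[h _ _] _ _] _] := tau_loop_automorphism; exact: h. Qed.

Lemma tauM x y : H x -> H y -> tau (wmul x y) = wmul (tau x) (tau y).
Proof. by have [[_ h _] _] := tau_loop_automorphism; exact: h. Qed.

Lemma tauK x : H x -> tau (tau x) = x.
Proof. by have [_ [_ h _]] := tau_loop_automorphism; exact: h. Qed.

(** One formula for the linear and the antilinear case, (tau x)(z) = phi (x (c / s(z))), so that the
    arguments below are made once for both. *)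
Lemma second_kindP : exists (g : {vspace 'M[Cx R]_n}) s phi L c,
  [/\ [/\ matrix_lie_group G, forall A, A \in g <-> lie_algebra G A &
          s = id \/ s = Num.conj],
      [/\ set_bij G G phi, forall A B, G A -> G B -> phi (A *m B) = phi A *m phi B,
          forall A, A \in g -> L A \in g /\ phi (mexp A) = mexp (L A) &
          forall c A B, A \in g -> B \in g -> L (c *: A + B) = s c *: L A + L B],
      cabs c = 1 &
      forall x z, H x -> cabs z = 1 ->
        loop_eval (tau x) z = phi (loop_eval x (c * (s z)^-1))].
Proof.
have [mG _ [g gE _]] := hG; exists g.
have conv s phi : group_automorphism s G phi -> exists L,
    [/\ set_bij G G phi, forall A B, G A -> G B -> phi (A *m B) = phi A *m phi B,
      forall A, A \in g -> L A \in g /\ phi (mexp A) = mexp (L A) &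
      forall c A B, A \in g -> B \in g -> L (c *: A + B) = s c *: L A + L B].
  move=> [b m [L L1 L2]]; exists L; split=> // [A /gE/L1[/gE]//|c A B /gE LA /gE LB].
  exact: L2.
case: htau => [[_ _ [phi [k [aphi _ E]]]]|[_ _ [phi [e [aphi _ he E]]]]].
  have [L [L1 L2 L3 L4]] := conv _ _ aphi.
  exists id, phi, L, (cis (2 * k%:~R * pi / 2%:R)); split=> //; first by split=> //; left.
    exact: cabs_cis.
  by move=> x z Hx z1; rewrite (E x z Hx (norm1_cabs z1)) exprN1.
have [L [L1 L2 L3 L4]] := conv _ _ aphi.
exists Num.conj, phi, L, e; split=> //; first by split=> //; right.
  by case: he => ->; rewrite ?cabsN cabs1.
by move=> x z Hx z1; rewrite (E x z Hx (norm1_cabs z1)) exprN1.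
Qed.

Lemma LambdaG_eval x z : LambdaG G x -> cabs z = 1 -> G (loop_eval x z).
Proof. by move=> Gx z1; apply: Gx; exact: norm1_cabs. Qed.

(** The substitution of c / s(z) for z exchanges 0 with infinity and the inside of the circle with
    the outside. [auto_extension] turns an extension of x to one disc into one of tau x to the
    other, and phi (1) = 1 preserves the normalisations. *)
Lemma tau_swap x : H x ->
  [/\ LambdaM G x -> LambdaP G (tau x), LambdaP G x -> LambdaM G (tau x),
      LambdaM1 G x -> LambdaP1 G (tau x) & LambdaP1 G x -> LambdaM1 G (tau x)].
Proof.
move=> Hx; have [g [s [phi [L [c [[mG gE hs] [b m e l] c1 E]]]]]] := second_kindP.
have Gt := HG (tau_H Hx); have Gx := HG Hx.
have c0 : c != 0 by rewrite -cabs_gt0 c1.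
have Gx' z : `|z| = 1 -> G (loop_eval x z) by move=> z1; exact: Gx.
have Gxi z : `|z| = 1 -> G (loop_eval x z^-1).
  by move=> z1; apply: Gx; rewrite /= normfV z1 invr1.
have ci1 : cabs c^-1 = 1 by rewrite cabsV c1 invr1.
have MP h : holomorphic_extension G (fun z => loop_eval x z^-1) h ->
    holomorphic_extension G (loop_eval (tau x)) (fun z => phi (h (c^-1 * s z))).
  move=> /(auto_extension N mG gE hs b m e l Gxi ci1)[h1 h2 h3]; split=> // z z1.
  by rewrite (h3 z z1) (E _ _ Hx (cabs_norm1 z1)) invfM invrK.
have PM h : holomorphic_extension G (loop_eval x) h ->
    holomorphic_extension G (fun z => loop_eval (tau x) z^-1) (fun z => phi (h (c * s z))).
  move=> /(auto_extension N mG gE hs b m e l Gx' c1)[h1 h2 h3]; split=> // z z1.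
  have zi1 : cabs z^-1 = 1 by rewrite cabsV (cabs_norm1 z1) invr1.
  by rewrite (h3 z z1) (E _ _ Hx zi1) (semiV hs) invrK.
have phi1 := auto1 mG b m.
split=> [[_ [h xh]]|[_ [h xh]]|[_ [h xh h1]]|[_ [h xh h1]]]; split=> //.
- by exists (fun z => phi (h (c^-1 * s z))); exact: MP.
- by exists (fun z => phi (h (c * s z))); exact: PM.
- exists (fun z => phi (h (c^-1 * s z))); first exact: MP.
  by rewrite (semi0 hs) mulr0 h1.
- exists (fun z => phi (h (c * s z))); first exact: PM.
  by rewrite (semi0 hs) mulr0 h1.
Qed.

(** The hypothesis says that X is a limit of difference quotients of the fixed subgroup at the
    identity. At each z it follows that X(z) is tangent to [G], and differentiating the fixed point
    equation gives X(z) = L (X (c / s(z))), as [tangent_reflect] requires. *)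
Lemma fixed_tangent_reflect X (k : nat) :
  (forall e : R, 0 < e -> exists r y, [/\ 0 < r < e, H y, tau y = y &
     wnorm (r^-1 *: (y - wone N) - X) < e]) ->
  X k%:Z = 0 -> X (- k%:Z) = 0.
Proof.
move=> HX; have [g [s [phi [L [c [[mG gE hs] [b m e l] c1 E]]]]]] := second_kindP.
have sc z : cabs z = 1 -> cabs (c * (s z)^-1) = 1.
  by move=> z1; rewrite cabsM c1 mul1r cabsV (cabs_semi hs) z1 invr1.
have ev r y z : cabs z = 1 -> loop_eval (r^-1 *: (y - wone N) - X) z =
    real_cx r^-1 *: (loop_eval y z - 1%:M) - loop_eval X z.
  by move=> z1; rewrite (loop_evalB _ _ z1) (loop_evalZ _ _ z1) (loop_evalB _ _ z1) loop_eval_one.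
have evN r y z q : cabs z = 1 -> wnorm (r^-1 *: (y - wone N) - X) < q ->
    N (real_cx r^-1 *: (loop_eval y z - 1%:M) - loop_eval X z) < q.
  by move=> z1; apply: le_lt_trans; rewrite -ev//; exact: mnorm_loop_eval.
have Xg z : cabs z = 1 -> loop_eval X z \in g.
  move=> z1; apply/gE/(lie_limit (N := N) mG) => q q0.
  have [r [y [r0 Hy _ yX]]] := HX q q0; exists r, (loop_eval y z); split=> //.
    exact: LambdaG_eval (HG Hy) z1.
  exact: evN.
apply: (tangent_reflect hs l c1 Xg) => z z1.
have [C C0 HC] := semilin_bound N hs l.
apply/eqP; rewrite -subr_eq0; apply/eqP; apply: (@mnorm_eq0_small _ _ N) => q q0.
set z' := c * (s z)^-1; have z'1 : cabs z' = 1 by exact: sc.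
set a := N (loop_eval X z') + 1; have a0 : 0 < a by rewrite ltr_wpDl// mnorm_ge0.
have D0 : 0 < 2 * (1 + C) * (1 + a) by rewrite !mulr_gt0//; lra.
have [q1 [q10 q1q q11]] : exists q1, [/\ 0 < q1, q1 * (2 * (1 + C) * (1 + a)) <= q & q1 <= 1].
  exists (Num.min 1 (q / (2 * (1 + C) * (1 + a)))).
  by rewrite lt_min ltr01 divr_gt0// -ler_pdivlMr// !ge_min !lexx orbT.
have [d d0 Hd] := auto_diff N mG gE hs e l q10.
have dm : 0 < Num.min q1 (d / a) by rewrite lt_min q10 divr_gt0.
have [r [y [/andP[r0]]]] := HX _ dm.
rewrite !lt_min ltr_pdivlMr// => /andP[rq rd] Hy ty /andP[yX _].
have Yz := evN _ _ _ _ z1 yX; have Yz' := evN _ _ _ _ z'1 yX.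
set A := loop_eval y z' in Yz' *; have GA : G A by exact: LambdaG_eval (HG Hy) z'1.
have yE : loop_eval y z = phi A by rewrite -E// ty.
have NA : N (A - 1%:M) <= r * a.
  have -> : A - 1%:M = real_cx r *: (real_cx r^-1 *: (A - 1%:M)).
    by rewrite scalerA -real_cxM divff ?gt_eqF// real_cx1 scale1r.
  rewrite mnormZr ger0_norm ?(ltW r0)// ler_wpM2l ?(ltW r0)//.
  rewrite -(subrK (loop_eval X z') (_ *: _)) (le_trans (mnormD _ _ _))// /a addrC lerD2l.
  by rewrite ltW// (lt_le_trans Yz').
have [|Y [Yg _ AY pY]] := Hd _ GA; first exact: le_lt_trans NA rd.
have rr (B : 'M[Cx R]_n) (w : R) : N B <= q1 * (r * w) -> N (real_cx r^-1 *: B) <= q1 * w.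
  move=> h; rewrite mnormZr ger0_norm ?invr_ge0 ?(ltW r0)// ler_pdivrMl//.
  by rewrite mulrCA.
have AY' : N (real_cx r^-1 *: (A - 1%:M - Y)) <= q1 * a.
  by apply: rr; rewrite (le_trans AY)// ler_wpM2l// ltW.
have pY' : N (real_cx r^-1 *: (phi A - 1%:M - L Y)) <= q1 * a.
  by apply: rr; rewrite (le_trans pY)// ler_wpM2l// ltW.
rewrite yE in Yz.
set Z := real_cx r^-1 *: Y - loop_eval X z'.
have Zg : Z \in g by rewrite memvB ?memvZ ?Xg.
have NZ : N Z <= q1 * (1 + a).
  have -> : Z = (real_cx r^-1 *: (A - 1%:M) - loop_eval X z') -
       real_cx r^-1 *: (A - 1%:M - Y).
    rewrite /Z [X in _ = _ - X]scalerBr; move: (_ *: (A - _)) => u.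
    by rewrite [RHS]addrAC subKr.
  apply: (le_trans (mnormB _ _ _)); rewrite mulrDr mulr1; exact: lerD (ltW Yz') AY'.
have LZ : L Z = real_cx r^-1 *: L Y - L (loop_eval X z').
  rewrite /Z (semilinB hs l) ?memvZ ?Xg//.
  by rewrite (semilinZ hs l)// (semi_real hs).
have -> : loop_eval X z - L (loop_eval X z') = L Z +
    (real_cx r^-1 *: (phi A - 1%:M - L Y) -
    (real_cx r^-1 *: (phi A - 1%:M) - loop_eval X z)).
  rewrite LZ [X in _ + (X - _)]scalerBr; move: (_ *: (phi A - _)) (_ *: L Y) => u v.
  by apply/matrixP => i j; rewrite !mxE; ring.
rewrite (le_trans (mnormD _ _ _))// (le_trans (lerD (HC _ Zg) (mnormB _ _ _)))//.
apply: (le_trans (lerD (ler_wpM2l C0 NZ) (lerD pY' (ltW Yz)))).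
apply: (le_trans _ q1q); have a1 : 0 <= 1 + a by (clear -a0; lra).
have -> : C * (q1 * (1 + a)) + (q1 * a + q1) = q1 * ((1 + C) * (1 + a)) by ring.
rewrite ler_wpM2l ?(ltW q10)// ler_wpM2r// mulr_natl mulr2n lerDl addr_ge0//; exact: ler01.
Qed.

End SecondKind.

(** * Smooth and analytic maps *)

Section Differentials.
Context (R : realType) (V W : normedModType R).
Implicit Types (f g : V -> W) (x : V).

Lemma diff_eps f x : differentiable f x -> forall e, 0 < e ->
  \forall h \near (0 : V), `|f (x + h) - f x - 'd f x h| <= e * `|h|.
Proof.
move=> /diff_locally/eqaddoP df e e0; have := df e e0.
apply: filterS => h; rewrite -[X in `|X|]/(f (h + x) - (f x + 'd f x h)).
by rewrite [h + x]addrC opprD addrA.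
Qed.

Lemma eps_diff f x (L : {linear V -> W}) : continuous L ->
  (forall e, 0 < e -> \forall h \near (0 : V), `|f (x + h) - f x - L h| <= e * `|h|) ->
  differentiable f x /\ 'd f x = L :> (V -> W).
Proof.
move=> cL H; have E : f \o shift x = cst (f x) + L +o_ 0 id.
  apply/eqaddoP => e e0; have := H e e0.
  by apply: filterS => h; rewrite /= -[(f \o _ - _) h]/(f (h + x) - (f x + L h))
    [h + x]addrC opprD addrA.
have dE := diff_unique cL E; split=> //.
by apply/diff_locallyP; rewrite dE.
Qed.

Lemma eps_diff_fun f x (L : V -> W) C : linear L ->
  (forall v, `|L v| <= C * `|v|) ->
  (forall e, 0 < e -> \forall h \near (0 : V), `|f (x + h) - f x - L h| <= e * `|h|) ->
  differentiable f x /\ 'd f x = L :> (V -> W).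
Proof.
move=> lL bL H.
pose L' : {linear V -> W} := HB.pack L (GRing.isLinear.Build _ _ _ _ L lL).
apply: (@eps_diff f x L') => // .
apply/(linear_bounded_continuous L'); apply/linear_boundedP.
rewrite nearE; exists C; split; first exact: num_real.
by move=> M CM v; rewrite (le_trans (bL v))// ler_wpM2r// ltW.
Qed.

Lemma near_diff f g x : (\forall y \near x, f y = g y) -> differentiable f x ->
  differentiable g x /\ 'd g x = 'd f x :> (V -> W).
Proof.
move=> fg df; apply: eps_diff; first exact: diff_continuous.
move=> e e0; have fgx := nbhs_singleton fg.
have := diff_eps df e0; apply: filter_app.
have : \forall h \near (0 : V), f (x + h) = g (x + h).
  move: fg; rewrite (near_shift 0 x); apply: filterS => h /=.
  by rewrite subr0 addrC.
by apply: filterS => h <-; rewrite fgx.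
Qed.

(** Difference quotients carry closed conditions, such as a vanishing coefficient or tangency to a
    subgroup, over to the differential. *)
Lemma diff_quot f x v : differentiable f x -> forall e : R, 0 < e ->
  exists2 d : R, 0 < d & forall t, 0 < t < d ->
    `|t^-1 *: (f (x + t *: v) - f x) - 'd f x v| < e.
Proof.
move=> df e e0; have v1 : 0 < `|v| + 1 by rewrite ltr_wpDl.
have [d /= d0 H] := (nbhs_ballP _ _).1 (diff_eps df (divr_gt0 e0 v1)).
exists (d / (`|v| + 1)); first exact: divr_gt0.
move=> t /andP[t0 td].
have /H : ball 0 d (t *: v).
  rewrite -ball_normE /ball_ /= sub0r normrN normrZ gtr0_norm//.
  rewrite (@le_lt_trans _ _ (t * (`|v| + 1)))// -?ltr_pdivlMr//.
  by rewrite ler_wpM2l ?(ltW t0)// lerDl.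
rewrite linearZ normrZ gtr0_norm// => Hh.
have -> : t^-1 *: (f (x + t *: v) - f x) - 'd f x v =
    t^-1 *: (f (x + t *: v) - f x - t *: 'd f x v).
  by rewrite [RHS]scalerBr scalerA mulVf ?gt_eqF// scale1r.
rewrite normrZ ger0_norm ?invr_ge0 ?(ltW t0)// ltr_pdivrMl//.
rewrite (le_lt_trans Hh)// mulrCA ltr_pM2l// -mulrA gtr_pMr// mulrC.
by rewrite ltr_pdivrMr// mul1r ltrDl.
Qed.

End Differentials.

(** * Maps of class C^k *)

Section CkBasics.
Context (R : realType) (d : nat).
Implicit Types (E : normedModType R) (O : set 'rV[R]_d).

(** Valid for arbitrary sets: [Ck_on] imposes conditions at the points of [O] only, with derivatives
    taken in the ambient space. *)
Lemma Ck_loc E k O (f : 'rV[R]_d -> E) :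
  (forall x, O x -> exists2 O', O' x & Ck_on k O' f) -> Ck_on k O f.
Proof.
elim: k f => [|k IH] f H /=.
  by move=> x /H [Q Qx h]; apply: h.
split=> [x /H [Q Qx [h _]]|v]; first exact: h.
by apply: IH => x /H [Q Qx [_ h]]; exists Q => //; exact: h.
Qed.

Lemma Ck_sub E k O O' (f : 'rV[R]_d -> E) : O' `<=` O -> Ck_on k O f -> Ck_on k O' f.
Proof. by move=> sO h; apply: Ck_loc => x /sO Ox; exists O. Qed.

Lemma Ck_continuous E k O (f : 'rV[R]_d -> E) : Ck_on k O f ->
  forall x, O x -> {for x, continuous f}.
Proof.
case: k => [//|k [df _]] x Ox; exact/differentiable_continuous/df.
Qed.

Lemma CkS E k O (f : 'rV[R]_d -> E) : Ck_on k.+1 O f -> Ck_on k O f.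
Proof.
elim: k f => [|k IH] f [df Df]; first exact: (@Ck_continuous _ 1).
by split=> // v; exact: IH (Df v).
Qed.

Lemma Ck_ext E k O (f g : 'rV[R]_d -> E) : open O -> {in O, f =1 g} ->
  Ck_on k O f -> Ck_on k O g.
Proof.
move=> oO; have nfg (f' g' : 'rV[R]_d -> E) x : {in O, f' =1 g'} -> O x ->
    \forall y \near x, f' y = g' y.
  move=> fg Ox; near=> y; apply: fg; rewrite inE; near: y.
  exact: open_nbhs_nbhs.
elim: k f g => [|k IH] f g fg /=.
  move=> cf x Ox; move: (cf x Ox); rewrite /prop_for /continuous_at fg ?inE// => cfx.
  apply: cvg_trans cfx; apply: near_eq_cvg.
    exact: (@nbhs_filter _ x).
  exact: (nfg f g x fg Ox).
move=> [df Df]; split=> [x Ox|v].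
  by have [] := near_diff (nfg _ _ x fg Ox) (df x Ox).
apply: IH (Df v) => x; rewrite inE => Ox.
by rewrite (near_diff (nfg _ _ x fg Ox) (df x Ox)).2.
Unshelve. all: by end_near. Qed.

Lemma Ck_cst E k O (c : E) : open O -> Ck_on k O (fun=> c).
Proof.
move=> oO; elim: k c => [|k IH] c /=; first by move=> x _; exact: cst_continuous.
split=> [x _|v]; first exact: differentiable_cst.
by apply: Ck_ext (IH 0) => // x _; rewrite diff_cst.
Qed.

Lemma Ck_pair E E' k O (f : 'rV[R]_d -> E) (g : 'rV[R]_d -> E') : open O ->
  Ck_on k O f -> Ck_on k O g -> Ck_on k O (fun x => (f x, g x)).
Proof.
move=> oO; elim: k f g => [|k IH] f g /=.
  by move=> cf cg x Ox; exact: cvg_pair (cf x Ox) (cg x Ox).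
move=> [df Df] [dg Dg]; split=> [x Ox|v].
  by apply: differentiable_pair; [exact: df|exact: dg].
apply: Ck_ext (IH _ _ (Df v) (Dg v)) => // x; rewrite inE => Ox.
by rewrite diff_pair//; [exact: df|exact: dg].
Qed.

End CkBasics.

Lemma natr_sum_const (R : pzSemiRingType) k (c : R) : k%:R * c = \sum_(i < k) c.
Proof. by rewrite sumr_const card_ord mulr_natl. Qed.

(** * Bounded multilinear maps on the diagonal *)

Section Multilinear.
Context (R : realType) (E F : normedModType R) (k : nat).
Context (A : ('I_k -> E) -> F) (hA : multilinear A).
Implicit Types (v : 'I_k -> E) (i : 'I_k).

Lemma multiD v i x y :
  A [eta v with i |-> x + y] = A [eta v with i |-> x] + A [eta v with i |-> y].
Proof. by have := hA i v 1 x y; rewrite !scale1r. Qed.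

Lemma multi0 v i : A [eta v with i |-> 0] = 0.
Proof. by have := hA i v (-1) 0 0; rewrite scaler0 addr0 scaleN1r addNr. Qed.

Lemma multiZ v i c x : A [eta v with i |-> c *: x] = c *: A [eta v with i |-> x].
Proof. by have := hA i v c x 0; rewrite multi0 !addr0. Qed.

Lemma multiB v i x y :
  A [eta v with i |-> x - y] = A [eta v with i |-> x] - A [eta v with i |-> y].
Proof. by rewrite multiD -scaleN1r multiZ scaleN1r. Qed.

(** The slots are exchanged one at a time, from the left. *)
Lemma multi_telescope v v' : A v - A v' = \sum_(i < k)
  A (fun l => if (l < i)%N then v' l else if l == i then v i - v' i else v l).
Proof.
pose w j : 'I_k -> E := fun l => if (l < j)%N then v' l else v l.
have -> : A v - A v' = \sum_(0 <= j < k) ((- A (w j.+1)) - (- A (w j))).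
  rewrite telescope_sumr// opprK [RHS]addrC; congr (A _ - A _); apply/funext => l.
  by rewrite /w ltn_ord.
rewrite big_mkord; apply: eq_bigr => i _; rewrite opprK addrC.
have -> : w i = [eta w i with i |-> v i].
  by apply/funext => l /=; case: eqP => [->|//]; rewrite /w ltnn.
have -> : w i.+1 = [eta w i with i |-> v' i].
  apply/funext => l /=; rewrite /w ltnS leq_eqVlt.
  by rewrite [(_ == _ :> nat)]val_eqE; case: eqP => [->|].
rewrite -multiB; congr A; apply/funext => l /=; rewrite /w.
by case: eqP => [->|//]; rewrite ltnn.
Qed.

Lemma prod_slot (v : 'I_k -> E) i (s d : R) : (forall l, l != i -> `|v l| <= s) ->
  `|v i| <= d -> \prod_(l < k) `|v l| <= d * s ^+ k.-1.
Proof.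
move=> hs hd; rewrite (bigD1 i)//= ler_pM//; first exact: prodr_ge0.
have -> : s ^+ k.-1 = \prod_(l < k | l != i) s.
  by rewrite prodr_const cardC1 card_ord.
by apply: ler_prod => l li; rewrite normr_ge0 hs.
Qed.

Context (M : R) (M0 : 0 <= M) (hM : forall v, `|A v| <= M * \prod_(i < k) `|v i|).

Lemma multi_lip v v' (s d : R) : (forall l, `|v l| <= s) ->
  (forall l, `|v' l| <= s) -> (forall l, `|v l - v' l| <= d) ->
  `|A v - A v'| <= k%:R * (M * (d * s ^+ k.-1)).
Proof.
move=> hv hv' hd; rewrite multi_telescope.
rewrite (le_trans (ler_norm_sum _ _ _))//.
rewrite natr_sum_const ler_sum// => i _.
apply: (le_trans (hM _)); rewrite ler_wpM2l// (prod_slot (i := i))//.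
  by move=> l li; case: ifP => // _; rewrite (negbTE li).
by rewrite ltnn eqxx.
Qed.

(** The derivative of the homogeneous polynomial h |-> A (h, ..., h) in the direction [w]. *)
Definition multi_diff (h w : E) : F := \sum_(i < k) A [eta (fun=> h) with i |-> w].

(** The i-th term of the telescope has t w in slot i; what separates it from t times the i-th term
    of [multi_diff] is a change of other slots from h to h + t w, which is again of order t. *)
Lemma multi_diff_le (h w : E) (t : R) : 0 <= t <= 1 ->
  `|A (fun=> h + t *: w) - A (fun=> h) - t *: multi_diff h w| <=
  t ^+ 2 * (k%:R * (k%:R * (M * (`|w| * (`|h| + `|w|) ^+ k.-1)))).
Proof.
move=> /andP[t0 t1]; rewrite multi_telescope /multi_diff scaler_sumr -sumrB.
rewrite (le_trans (ler_norm_sum _ _ _))//.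
rewrite (mulrCA (t ^+ 2)) (natr_sum_const k (t ^+ 2 * _)) ler_sum// => i _.
rewrite [h + _ - h]addrAC subrr add0r.
set u := fun l : 'I_k => if (l < i)%N then h else if l == i then w else h + t *: w.
have -> : (fun l : 'I_k => if (l < i)%N then h else if l == i then t *: w
    else h + t *: w) = [eta u with i |-> t *: w].
  apply/funext => l; rewrite /u /=; case: eqP => [->|//]; by rewrite ltnn.
rewrite multiZ -scalerBr normrZ ger0_norm// expr2 -mulrA ler_wpM2l//.
have tw : `|t *: w| <= `|w| by rewrite normrZ ger0_norm// ler_piMl.
have -> : t * (k%:R * (M * (`|w| * (`|h| + `|w|) ^+ k.-1))) =
    k%:R * (M * ((t * `|w|) * (`|h| + `|w|) ^+ k.-1)).
  by rewrite mulrCA; congr (_ * _); rewrite mulrCA !mulrA.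
have ws : `|w| <= `|h| + `|w| by rewrite lerDr.
have hs : `|h| <= `|h| + `|w| by rewrite lerDl.
apply: multi_lip => l /=; rewrite /u.
- case: eqP => // _; case: ifP => // _.
  by rewrite (le_trans (ler_normD _ _))// lerD2l.
- by case: eqP => // _; rewrite (le_trans hs).
- case: eqP => _; first by rewrite subrr normr0 mulr_ge0.
  case: ifP => _; first by rewrite subrr normr0 mulr_ge0.
  by rewrite addrAC subrr add0r normrZ ger0_norm.
Qed.

End Multilinear.

Lemma norm_cvg_le (R : realType) (F : normedModType R) (u : nat -> F) l (c : R) :
  u @ \oo --> l -> (\forall m \near \oo, `|u m| <= c) -> `|l| <= c.
Proof.
move=> ul uc; apply/ler_addgt0Pr => e e0.
near \oo => m; rewrite -(subrK (u m) l) (le_trans (ler_normD _ _))// addrC lerD//.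
  by near: m.
by apply: ltW; near: m; apply: cvgr_dist_lt.
Unshelve. all: by end_near. Qed.

Lemma series_supp0 (R : realType) (F : normedModType R) (u : nat -> F) :
  (forall k, (0 < k)%N -> u k = 0) -> series u @ \oo --> u 0.
Proof.
move=> u0; apply: cvg_near_cst; near=> m.
have m0 : (0 < m)%N by near: m; exact: nbhs_infty_gt.
by rewrite /series /= big_ltn// big_nat big1 ?addr0// => k /andP[/u0].
Unshelve. all: by end_near. Qed.

(** * Analytic maps and their differentials *)

Section AnalyticCalculus.
Context (R : realType) (E F : normedModType R).
Implicit Types (g : E -> F) (x : E).

(* In analytic_at the bounds M k may be negative when E is the zero space. *)
Lemma analytic_at_ge0 g x : analytic_at g x ->
  exists (A : forall k : nat, ('I_k -> E) -> F) (M : nat -> R) (r : R),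
    [/\ 0 < r, forall k, 0 <= M k,
        forall k, multilinear (A k) /\
          forall v, `|A k v| <= M k * \prod_(i < k) `|v i|,
        cvgn (series (fun k => M k * r ^+ k)) &
        forall h, `|h| < r -> series (fun k => A k (fun=> h)) @ \oo --> g (x + h)].
Proof.
move=> [A [M [r [r0 mA bA cM cA]]]].
have [[v /eqP v0]|/forallNP E0] := pselect (exists v : E, v <> 0).
  exists A, M, r; split=> // k.
  have := le_trans (normr_ge0 _) (bA k (fun=> v)).
  by rewrite pmulr_lge0// prodr_gt0// => i _; rewrite normr_gt0.
have {}E0 v : v = 0 :> E by apply: contrapT => /E0.
exists A, (fun k => if k is 0 then `|A 0 (fun=> 0)| else 0), r; split=> //.
- by case.
- case=> [|k]; split=> // v.
    by rewrite big_ord0 mulr1 (_ : v = fun=> 0)//; apply/funext => -[].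
  have vE : ([eta v with ord0 |-> 0] : 'I_k.+1 -> E) = v by apply/funext => l; rewrite (E0 (v l)); exact: E0.
  by rewrite mul0r -vE (multi0 (mA _)) normr0.
- apply/cvg_ex; eexists; apply: series_supp0 => -[//|k] _; exact: mul0r.
Qed.

Section Expansion.
Context (g : E -> F) (x : E) (A : forall k : nat, ('I_k -> E) -> F) (M : nat -> R).
Arguments A : clear implicits.
Context (r : R) (r0 : 0 < r) (M0 : forall k, 0 <= M k).
Context (mA : forall k, multilinear (A k)).
Context (bA : forall k v, `|A k v| <= M k * \prod_(i < k) `|v i|).
Context (cM : cvgn (series (fun k => M k * r ^+ k))).
Context (cA : forall h, `|h| < r ->
  series (fun k => A k (fun=> h)) @ \oo --> g (x + h)).

Let S m h : F := \sum_(0 <= k < m) A k (fun=> h).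
Let L : R := limn (series (fun k => M k * r ^+ k)).

Lemma expansion_sum_le m p : \sum_(m <= k < p) M k * r ^+ k <= L - series (fun k => M k * r ^+ k) (minn m p).
Proof.
have nd : nondecreasing_seq (series (fun k => M k * r ^+ k)).
  by apply: nondecreasing_series => k _ _; rewrite mulr_ge0 ?exprn_ge0 ?(ltW r0).
have le p' : series (fun k => M k * r ^+ k) p' <= L by exact: nondecreasing_cvgn_le.
have [mp|pm] := leqP m p; last by rewrite big_geq ?(ltnW pm)// subr_ge0.
rewrite lerBrDr (le_trans _ (le p))// /series /= addrC.
by rewrite -big_cat_nat.
Qed.

(** The differential is the degree 1 term, and the terms of degree at least 2 add up to at most L
    r^-2 |h|^2. *)
Lemma expansion_differentiable : differentiable g x.
Proof.
have A1 h : A 1 (fun=> h) = A 1 [eta (fun=> 0) with ord0 |-> h].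
  by congr A; apply/funext => i; rewrite /= (ord1 i) eqxx.
have l1 : linear (fun h => A 1 (fun=> h)).
  by move=> c y z; rewrite !A1; exact: (mA (k := 1)).
have L0 : 0 <= L by have := expansion_sum_le 0 0; rewrite big_geq// min0n /series /= big_geq// subr0.
apply: (proj1 (eps_diff_fun (C := M 1) l1 _ _)) => [v|e e0].
  by have := bA (fun _ : 'I_1 => v); rewrite big_ord1.
have C0 : 0 < (L + 1) * r ^- 2 by rewrite mulr_gt0 ?invr_gt0 ?exprn_gt0// ltr_wpDl.
near=> h.
have hr : `|h| < r by near: h; exact: nbhs0_lt.
have he : `|h| <= e / ((L + 1) * r ^- 2).
  by near: h; apply: nbhs0_le; rewrite divr_gt0.
have g0 : g x = A 0 (fun=> 0).
  have := cA (h := 0); rewrite normr0 addr0 => /(_ r0) c0.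
  apply: (@cvg_unique _ (@norm_hausdorff _ F) _ _ _ _ c0).
  apply: (series_supp0 (u := fun k => A k (fun=> 0))) => -[//|k] _.
  have <- : ([eta (fun=> 0) with ord0 |-> 0] : 'I_k.+1 -> E) = fun=> 0.
    by apply/funext => l /=; case: eqP.
  exact: multi0 (@mA _) _ _.
have A00 : A 0 (fun=> 0) = A 0 (fun=> h) by congr A; apply/funext => -[].
have c1 : (fun m => series (fun k => A k (fun=> h)) m - (g x + A 1 (fun=> h))) @ \oo
    --> g (x + h) - (g x + A 1 (fun=> h)).
  by apply: cvgB; [exact: cA|exact: cvg_cst].
rewrite -addrA -opprD.
apply: (norm_cvg_le c1); near=> m.
have m2 : (2 <= m)%N by near: m; exact: nbhs_infty_ge.
rewrite /series /= (big_cat_nat (n := 2))//= !big_nat_recl// big_geq// addr0.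
rewrite g0 A00 [X in `|X|]addrC addKr.
rewrite (le_trans (ler_norm_sum _ _ _))//.
rewrite (@le_trans _ _ ((L * r ^- 2) * `|h| ^+ 2))//.
  have HL : \sum_(2 <= k < m) M k * r ^+ k <= L.
    apply: (le_trans (expansion_sum_le 2 m)).
    rewrite gerBl /series /= sumr_ge0// => k _.
    by rewrite mulr_ge0 ?exprn_ge0 ?(ltW r0).
  have w0 : 0 <= r ^- 2 * `|h| ^+ 2 by rewrite mulr_ge0 ?sqr_ge0// invr_ge0 sqr_ge0.
  rewrite -[leRHS]mulrA; apply: le_trans (ler_wpM2r w0 HL).
  rewrite mulr_suml !big_nat; apply: ler_sum => k /andP[k2 _].
  apply: (le_trans (bA _)); rewrite prodr_const card_ord -mulrA ler_wpM2l//.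
  rewrite mulrA -{1 2}(subnK k2) !exprD mulfK ?gt_eqF ?exprn_gt0//.
  by rewrite ler_wpM2r ?sqr_ge0// lerXn2r ?nnegrE ?(ltW r0) ?(ltW hr).
rewrite expr2 mulrA ler_wpM2r//.
move: he; rewrite ler_pdivlMr// mulrC; apply: le_trans.
by rewrite ler_wpM2r// ler_wpM2r ?invr_ge0 ?sqr_ge0// lerDl ler01.
Unshelve. all: by end_near. Qed.

Let s : R := r / 2.
Let D k h w : F := multi_diff (A k) h w.

Lemma half_radius : 0 < s /\ s < r.
Proof. by rewrite divr_gt0// ltr_pdivrMr// ltr_pMr// ltr1n. Qed.

(* On the half radius the factor k produced by differentiation is absorbed by
   k < 2 ^ k. *)
Lemma half_radius_le k : k%:R * (M k * s ^+ k.-1) <= s^-1 * (M k * r ^+ k).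
Proof.
have [s0 _] := half_radius.
have sE : r = s * 2 by rewrite divfK.
case: k => [|k]; first by rewrite mul0r mulr_ge0 ?invr_ge0 ?(ltW s0)// mulr_ge0.
rewrite ler_pdivlMl// [in leRHS]sE [in leRHS]exprMn.
rewrite (_ : s * _ = M k.+1 * (s ^+ k.+1 * k.+1%:R)); last by rewrite exprS /=; ring.
rewrite ler_wpM2l// ler_wpM2l ?exprn_ge0 ?(ltW s0)//.
by rewrite -natrX ler_nat ltnW// ltn_expl.
Qed.

(** Differentiation term by term. The tail of the difference quotient is controlled uniformly in t
    by a Lipschitz bound on the half radius, its head by [multi_diff_le] with a constant depending
    on m; hence m is fixed first and t afterwards. *)
Lemma expansion_diff_cvg h w : `|h| < s -> differentiable g (x + h) ->
  series (fun k => D k h w) @ \oo --> 'd g (x + h) w.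
Proof.
move=> hs dg; have [s0 sr] := half_radius; apply/cvgrPdist_le => e e0.
(* The difference quotient costs e1, the tail e1 |w| and the head e1. *)
pose e1 := e / (`|w| + 2); have w2 : 0 < `|w| + 2 by rewrite ltr_wpDl.
have e10 : 0 < e1 by rewrite divr_gt0.
have cL : \forall m \near \oo, `|L - series (fun k => M k * r ^+ k) m| <= s * e1.
  by move/cvgrPdist_le : cM; apply; rewrite mulr_gt0.
near=> m.
have mL : L - series (fun k => M k * r ^+ k) m <= s * e1.
  by apply: (le_trans (ler_norm _)); near: m.
pose C := \sum_(0 <= k < m) k%:R * (k%:R * (M k * (`|w| * (`|h| + `|w|) ^+ k.-1))).
have C0 : 0 <= C.
  by apply: sumr_ge0 => k _; rewrite !mulr_ge0// exprn_ge0// addr_ge0.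
have [d d0 Hd] := diff_quot w dg e10.
pose t := Num.min (Num.min 1 (d / 2)) (Num.min ((s - `|h|) / (`|w| + 1)) (e1 / (C + 1))).
have C1 : 0 < C + 1 by rewrite ltr_wpDl.
have w1 : 0 < `|w| + 1 by rewrite ltr_wpDl.
have t0 : 0 < t by rewrite !lt_min ltr01 !divr_gt0 ?subr_gt0.
have : t <= t by []; rewrite {2}/t !le_min => /andP[/andP[t1 td] /andP[tw tC]].
have {}td : t < d by rewrite (le_lt_trans td)// ltr_pdivrMr// ltr_pMr// ltr1n.
have {}tC : t * C <= e1.
  move: tC; rewrite ler_pdivlMr//; apply: le_trans.
  by rewrite ler_wpM2l ?(ltW t0)// lerDl.
have {}tw : `|h + t *: w| <= s.
  rewrite (le_trans (ler_normD _ _))// -lerBrDl normrZ gtr0_norm//.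
  move: tw; rewrite ler_pdivlMr//; apply: le_trans.
  by rewrite ler_wpM2l ?(ltW t0)// lerDl.
have step k : `|A k (fun=> h + t *: w) - A k (fun=> h)| <=
    s^-1 * (M k * r ^+ k) * (t * `|w|).
  apply: (@le_trans _ _ (k%:R * (M k * ((t * `|w|) * s ^+ k.-1)))).
    apply: (multi_lip (@mA k) (@M0 k) (@bA k)) => _ //; first exact: ltW.
    by rewrite addrAC subrr add0r normrZ gtr0_norm.
  rewrite mulrCA [X in _ <= X]mulrC [X in X <= _](_ : _ =
    (t * `|w|) * (k%:R * (M k * s ^+ k.-1))); last by ring.
  by rewrite ler_wpM2l ?half_radius_le// mulr_ge0 ?(ltW t0).
have far : `|g (x + h + t *: w) - g (x + h) - (S m (h + t *: w) - S m h)| <=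
    e1 * (t * `|w|).
  have c1 : (fun p => series (fun k => A k (fun=> h + t *: w)) p -
      series (fun k => A k (fun=> h)) p - (S m (h + t *: w) - S m h)) @ \oo -->
      g (x + h + t *: w) - g (x + h) - (S m (h + t *: w) - S m h).
    apply: cvgB; last exact: cvg_cst.
    rewrite -addrA; apply: cvgB; apply: cA; last exact: lt_trans sr.
    exact: le_lt_trans sr.
  apply: (norm_cvg_le c1); near=> p.
  have mp : (m <= p)%N by near: p; exact: nbhs_infty_ge.
  rewrite /series /= /S -!sumrB (big_cat_nat (n := m))//= [X in `|X|]addrAC subrr add0r.
  rewrite (le_trans (ler_norm_sum _ _ _))//.
  apply: (@le_trans _ _ (\sum_(m <= k < p) s^-1 * (M k * r ^+ k) * (t * `|w|))).
    exact: ler_sum.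
  rewrite -mulr_suml -mulr_sumr ler_wpM2r ?mulr_ge0 ?(ltW t0)//.
  rewrite ler_pdivrMl//; apply: le_trans mL.
  by have := expansion_sum_le m p; rewrite (minn_idPl mp).
have near_ : `|S m (h + t *: w) - S m h - t *: series (fun k => D k h w) m| <=
    t ^+ 2 * C.
  rewrite /S /series /= -sumrB scaler_sumr -sumrB mulr_sumr.
  rewrite (le_trans (ler_norm_sum _ _ _))// ler_sum// => k _.
  by apply: (multi_diff_le (@mA k) (@M0 k) (@bA k)); rewrite (ltW t0).
have := Hd t; rewrite t0 td => /(_ isT) Hd'.
set a := _ - g (x + h) in far Hd'; set b := S m _ - _ in far near_.
set c := series _ m in near_ *; set dw := 'd g _ w in Hd' *.
have -> : dw - c = - (t^-1 *: a - dw) + t^-1 *: ((a - b) + (b - t *: c)).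
  rewrite subrKA [X in _ = _ + X]scalerBr scalerA mulVf ?gt_eqF// scale1r opprB.
  by rewrite addrA subrK.
rewrite (le_trans (ler_normD _ _))// normrN normrZ ger0_norm ?invr_ge0 ?(ltW t0)//.
have : t^-1 * `|a - b + (b - t *: c)| <= e1 * `|w| + e1.
  rewrite ler_pdivrMl// (le_trans (ler_normD _ _))// mulrDr lerD//.
    by rewrite mulrCA.
  by apply: (le_trans near_); rewrite expr2 -mulrA ler_wpM2l// ltW.
move=> h1; apply: (le_trans (lerD (ltW Hd') h1)).
rewrite addrCA -mulr2n -mulr_natr -mulrDr /e1 divfK ?gt_eqF//.
Unshelve. all: by end_near. Qed.

Section Derivative.
Context (w0 : E) (dg : forall h, `|h| < s -> differentiable g (x + h)).

Let ins j (i : 'I_j.+1) (u : 'I_j -> E) : 'I_j.+1 -> E :=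
  fun l => if unlift i l is Some l' then u l' else w0.

(** The part of degree j in (h, w) of the sum over k of the derivative of A_k at h in the direction
    w0 + w: the term k = j + 1 contributes with w0 in one slot, the term k = j with w. *)
Let B j (v : 'I_j -> E * E) : F :=
  \sum_(i < j.+1) A j.+1 (ins i (fun l => (v l).1)) +
  \sum_(i < j) A j [eta (fun l => (v l).1) with i |-> (v i).2].

Let MB j : R := j.+1%:R * (`|w0| * M j.+1) + j%:R * M j.

Lemma derivative_multilinear j : multilinear (@B j).
Proof.
move=> p v c y z; rewrite /B scalerDr !scaler_sumr addrACA -!big_split /=.
congr (_ + _); apply: eq_bigr => i _.
  have E1 u : ins i (fun l => ([eta v with p |-> u] l).1) =
      [eta ins i (fun l => (v l).1) with lift i p |-> u.1].
    apply/funext => l; rewrite /ins /=; case: unliftP => [l' ->|->] /=.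
      by rewrite (inj_eq lift_inj); case: eqP.
    by rewrite (negbTE (neq_lift i p)).
  by rewrite !E1; exact: (@mA j.+1).
have [->|ip] := eqVneq i p.
  have E2 u : A j [eta (fun l => (if l == p then u else v l).1) with p |-> u.2] =
      A j [eta (fun l => (v l).1) with p |-> u.2].
    by congr A; apply/funext => l /=; case: eqP.
  by rewrite !E2; exact: (@mA j).
have E3 u : A j [eta (fun l => (if l == p then u else v l).1) with i |-> (v i).2] =
    A j [eta [eta (fun l => (v l).1) with i |-> (v i).2] with p |-> u.1].
  congr A; apply/funext => l /=; case: eqP => [->|_]; last by case: eqP.
  by rewrite (negbTE ip).
by rewrite !E3; exact: (@mA j).
Qed.

Lemma derivative_bound j v : `|B v| <= MB j * \prod_(i < j) `|v i|.
Proof.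
have v1 l : `|(v l).1| <= `|v l| by rewrite prod_normE le_max lexx.
have v2 l : `|(v l).2| <= `|v l| by rewrite prod_normE le_max lexx orbT.
rewrite /B /MB mulrDl (le_trans (ler_normD _ _))// lerD//.
  rewrite (le_trans (ler_norm_sum _ _ _))// -mulrA natr_sum_const ler_sum// => i _.
  rewrite (le_trans (bA _))// [`|w0| * _]mulrC -mulrA ler_wpM2l//.
  rewrite (bigD1_ord i)//= /ins unlift_none ler_wpM2l//.
  by apply: ler_prod => l _; rewrite liftK normr_ge0 v1.
rewrite (le_trans (ler_norm_sum _ _ _))// -mulrA natr_sum_const ler_sum// => i _.
rewrite (le_trans (bA _))// ler_wpM2l//.
by apply: ler_prod => l _; apply/andP; split=> //=; case: eqP => [->|_].
Qed.

Lemma derivative_cvg : cvgn (series (fun j => MB j * s ^+ j)).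
Proof.
have [s0 _] := half_radius.
have S0 k : 0 <= s^-1 * (M k * r ^+ k).
  by rewrite mulr_ge0 ?invr_ge0 ?(ltW s0)// mulr_ge0 ?exprn_ge0 ?(ltW r0).
have cS : cvgn (series (fun k => s^-1 * (M k * r ^+ k))).
  exact: (@is_cvg_seriesZ _ _ s^-1 cM).
pose T := limn (series (fun k => s^-1 * (M k * r ^+ k))).
have leT m : \sum_(0 <= k < m) s^-1 * (M k * r ^+ k) <= T.
  apply: (nondecreasing_cvgn_le _ cS).
  by apply: nondecreasing_series => k _ _.
apply: nondecreasing_is_cvgn.
  apply: nondecreasing_series => k _ _; rewrite mulr_ge0 ?exprn_ge0 ?(ltW s0)//.
  by rewrite addr_ge0// mulr_ge0// mulr_ge0.
exists (`|w0| * T + s * T) => _ [m _ <-]; rewrite /series /=.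
under eq_bigr do rewrite /MB mulrDl; rewrite big_split /= lerD//.
  rewrite (@le_trans _ _ (`|w0| * \sum_(0 <= k < m) s^-1 * (M k.+1 * r ^+ k.+1)))//.
    rewrite mulr_sumr ler_sum// => k _.
    rewrite (_ : _ * s ^+ k = `|w0| * (k.+1%:R * (M k.+1 * s ^+ k))); last by ring.
    by rewrite ler_wpM2l// (half_radius_le k.+1).
  rewrite ler_wpM2l// (le_trans _ (leT m.+1))// big_nat_recl// lerDr.
  exact: S0.
apply: (@le_trans _ _ (s * \sum_(0 <= k < m) s^-1 * (M k * r ^+ k))); last first.
  by rewrite ler_wpM2l ?(ltW s0).
rewrite mulr_sumr ler_sum// => -[|k] _; first by rewrite !mul0r mulr_ge0 ?(ltW s0).
apply: (@le_trans _ _ (s * (k.+1%:R * (M k.+1 * s ^+ k)))).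
  by rewrite exprS [X in _ <= X]mulrC [s * _]mulrC !mulrA.
by rewrite ler_wpM2l ?(ltW s0)// (half_radius_le k.+1).
Qed.

(** The differential is a map on [E * E] with values in [F], so it can be differentiated again in
    the same framework, without a space of operators. *)
Lemma derivative_analytic :
  analytic_at (fun p : E * E => 'd g (p.1 : E) p.2) (x, w0).
Proof.
have [s0 sr] := half_radius.
exists (fun j => @B j), MB, s; split=> //.
- exact: derivative_multilinear.
- exact: derivative_bound.
- exact: derivative_cvg.
move=> [h w] /=; rewrite prod_normE gt_max /= => /andP[hs _].
(* The first series is one term ahead because its term of index 0 vanishes, a constant having zero
   derivative. *)
have -> : series (fun k => B (fun _ : 'I_k => (h, w))) =
    (fun m => series (fun k => D k h w0) m.+1 + series (fun k => D k h w) m).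
  apply/funext => m; rewrite /series /= big_nat_recl//.
  rewrite {1}/D /multi_diff big_ord0 add0r -big_split /=; apply: eq_bigr => k _.
  rewrite /B; congr (_ + _); apply: eq_bigr => i _; congr A.
  apply/funext => l; rewrite /ins /=.
  by case: unliftP => [l' ->|->]; rewrite ?eqxx// eq_sym (negbTE (neq_lift _ _)).
rewrite linearD; apply: cvgD; last exact: expansion_diff_cvg (dg hs).
by rewrite (cvg_shiftS (series (fun k => D k h w0))); exact: expansion_diff_cvg (dg hs).
Qed.

End Derivative.

End Expansion.

Lemma analytic_differentiable g x : analytic_at g x -> differentiable g x.
Proof.
move=> /analytic_at_ge0[A [M [r [r0 M0 bA cM cA]]]].
by apply: (@expansion_differentiable g x A M r) => // k; have [] := bA k.
Qed.

(** Analyticity at the nearby points provides the differentiability that [derivative_analytic] asks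
    for there. *)
Lemma analytic_diff g (O : set E) x w : open O -> (forall y, O y -> analytic_at g y) ->
  O x -> analytic_at (fun p : E * E => 'd g (p.1 : E) p.2) (x, w).
Proof.
move=> oO aO Ox; have [A [M [r [r0 M0 bA cM cA]]]] := analytic_at_ge0 (aO x Ox).
have [e /= e0 xe] := (nbhs_ballP _ _).1 (open_nbhs_nbhs (conj oO Ox)).
pose r' := Num.min r e; have r'0 : 0 < r' by rewrite lt_min r0.
have r'r : r' <= r by rewrite ge_min lexx.
apply: (@derivative_analytic g x A M r') => //.
- by move=> k; have [] := bA k.
- by move=> k; have [] := bA k.
- apply: series_le_cvg cM => k.
  + by rewrite mulr_ge0 ?exprn_ge0 ?(ltW r'0).
  + by rewrite mulr_ge0 ?exprn_ge0 ?(ltW r0).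
  + by rewrite ler_wpM2l// lerXn2r ?nnegrE ?(ltW r'0) ?(ltW r0).
- by move=> h hr; apply: cA; exact: lt_le_trans r'r.
move=> h hr; apply/analytic_differentiable/aO/xe.
rewrite -ball_normE /ball_ /= opprD addrA subrr sub0r normrN (lt_trans hr)//.
by rewrite (@lt_le_trans _ _ r')// ?ge_min ?lexx ?orbT// ltr_pdivrMr// ltr_pMr// ltr1n.
Qed.
End AnalyticCalculus.

(** By the chain rule the derivative is again a composite, of the analytic map (y, w) |-> 'd g y w
    with x |-> (f x, 'd f x v). The induction therefore ranges over all spaces [E]. *)
Lemma analytic_comp_Ck (R : realType) d (E F : normedModType R) k (O : set 'rV[R]_d)
    (D : set E) (g : E -> F) (f : 'rV[R]_d -> E) :
  open O -> open D -> (forall y, D y -> analytic_at g y) ->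
  (forall x, O x -> D (f x)) -> Ck_on k O f -> Ck_on k O (g \o f).
Proof.
move=> oO; elim: k E F D g f => [|k IH] E F D g f oD aD fD.
  move=> /= cf x Ox; apply: continuous_comp; first exact: cf.
  by apply/differentiable_continuous/analytic_differentiable/aD/fD.
move=> Cf; have [df Df] := Cf.
have dg x : O x -> differentiable g (f x).
  by move=> Ox; apply/analytic_differentiable/aD/fD.
split=> [x Ox|v]; first by apply: differentiable_comp; [exact: df|exact: dg].
apply: (Ck_ext (f := (fun p : E * E => 'd g (p.1 : E) p.2) \o (fun x => (f x, 'd f x v)))) => //.
  by move=> x; rewrite inE => Ox /=; rewrite (diff_comp (df x Ox) (dg x Ox)).
apply: (IH _ _ (fun p => D p.1)).
- by move: oD; apply: open_comp => p _; exact: cvg_fst.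
- by move=> [y w] /= Dy; exact: analytic_diff oD aD Dy.
- by move=> x Ox /=; exact: fD.
- exact: Ck_pair oO (CkS Cf) (Df v).
Qed.

Lemma analytic_on_comp_Ck (R : realType) d (E F : normedModType R) k (O : set 'rV[R]_d)
    (D : set E) (g : E -> F) (f : 'rV[R]_d -> E) :
  open O -> analytic_on D g -> (forall x, O x -> D (f x)) ->
  Ck_on k O f -> Ck_on k O (g \o f).
Proof.
move=> oO aD fD Cf; apply: Ck_loc => x Ox.
have [Q [g' [oQ Qfx aQ gE]]] := aD _ (fD _ Ox).
have cf := Ck_continuous Cf.
exists (O `&` f @^-1` Q); first by [].
have oOQ : open (O `&` f @^-1` Q).
  rewrite openE => y [Oy Qy]; apply: filterI; first exact: open_nbhs_nbhs.
  by apply: (cf y Oy); exact: open_nbhs_nbhs.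
apply: (Ck_ext (f := g' \o f)) => //.
  by move=> y; rewrite inE => -[Oy Qy] /=; apply: gE => //; exact: fD.
apply: analytic_comp_Ck oQ aQ _ _ => // [y []//|].
by apply: Ck_sub Cf => y [].
Qed.

#[local] Opaque diff wmul.

(** * Calculus in the Wiener algebra *)

Section WienerCalculus.
Context (R : realType) (n : nat) (N : matnorm R n).
Implicit Types (V : normedModType R).

Lemma wmulZl (t : R) (x y : wiener N) : wmul (t *: x) y = t *: wmul x y.
Proof.
apply: loop_eval_inj => z z1.
by rewrite loop_evalM// !loop_evalZ// loop_evalM// scalemxAl.
Qed.

Lemma wmulZr (t : R) (x y : wiener N) : wmul x (t *: y) = t *: wmul x y.
Proof.
apply: loop_eval_inj => z z1.
by rewrite loop_evalM// !loop_evalZ// loop_evalM// scalemxAr.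
Qed.

Lemma normM (x y : wiener N) : `|wmul x y| <= `|x| * `|y|.
Proof. exact: wnormM. Qed.

Lemma diff_linear V (W : normedModType R) (f : V -> W) x (c : R) u v :
  'd f x (c *: u + v) = c *: 'd f x u + 'd f x v.
Proof. exact: linearP. Qed.

(* Stated for an opaque l rather than for 'd f x, whose unfolding by unification
   is expensive. *)
Definition has_diff V (W : normedModType R) (f : V -> W) x (l : V -> W) :=
  exists C : R,
    [/\ linear l, 0 < C, forall v, `|l v| <= C * `|v|,
        \forall h \near (0 : V), `|f (x + h) - f x| <= C * `|h| &
        forall e, 0 < e -> \forall h \near (0 : V), `|f (x + h) - f x - l h| <= e * `|h|].

Lemma has_diffP V (W : normedModType R) (f : V -> W) x :
  differentiable f x -> has_diff f x ('d f x).
Proof.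
move=> df; have [C C0 hC] := linear_lipschitz (diff_continuous df).
exists (C + 1); split=> //.
- exact: diff_linear.
- by rewrite addr_gt0.
- by move=> v; rewrite (le_trans (hC v))// ler_wpM2r// lerDl ler01.
- have := diff_eps df ltr01; apply: filterS => h H.
  rewrite -(subrK ('d f x h) (f (x + h) - f x)) (le_trans (ler_normD _ _))//.
  by rewrite mulrDl addrC lerD.
- exact: diff_eps.
Qed.

Lemma linear_wmul V (l l' : V -> wiener N) a b :
  linear l -> linear l' -> linear (fun v => wmul (l v) b + wmul a (l' v)).
Proof.
by move=> hl hl' c u v; rewrite hl hl' wmulDl wmulDr wmulZl wmulZr scalerDr addrACA.
Qed.

Lemma linear_wmul3 V (l : V -> wiener N) a :
  linear l -> linear (fun v => - wmul (wmul a (l v)) a).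
Proof. by move=> hl c u v; rewrite hl wmulDr wmulDl wmulZr wmulZl opprD scalerN. Qed.

Lemma has_diff_wmul V (f g l l' : V -> wiener N) x :
  has_diff f x l -> has_diff g x l' ->
  differentiable (fun y => wmul (f y) (g y)) x /\
  'd (fun y => wmul (f y) (g y)) x =
    (fun v => wmul (l v) (g x) + wmul (f x) (l' v)) :> (V -> wiener N).
Proof.
move=> [C [ll C0 hC HC el]] [C' [ll' C'0 hC' HC' el']].
apply: (@eps_diff_fun _ _ _ _ _ _ (C * `|g x| + `|f x| * C')).
- exact: (linear_wmul (f x) (g x) ll ll').
- move=> v; rewrite mulrDl (le_trans (ler_normD _ _))// lerD//.
    rewrite (le_trans (normM _ _))// mulrAC; exact: ler_wpM2r (normr_ge0 _) _ _ (hC v).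
  rewrite (le_trans (normM _ _))// -mulrA; exact: ler_wpM2l (normr_ge0 _) _ _ (hC' v).
move=> e e0; pose K := `|g x| + `|f x| + 1.
have K0 : 0 < K by rewrite ltr_wpDl// addr_ge0.
have e1 : 0 < e / K by rewrite divr_gt0.
near=> h; have hf : `|f (x + h) - f x| <= C * `|h| by near: h.
have hg : `|g (x + h) - g x| <= C' * `|h| by near: h.
have ef : `|f (x + h) - f x - l h| <= e / K * `|h| by near: h; exact: el.
have eg : `|g (x + h) - g x - l' h| <= e / K * `|h| by near: h; exact: el'.
have hs : `|h| <= e / K / (C * C').
  by near: h; apply: nbhs0_le; rewrite divr_gt0// mulr_gt0.
have -> : wmul (f (x + h)) (g (x + h)) - wmul (f x) (g x) -
    (wmul (l h) (g x) + wmul (f x) (l' h)) =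
    wmul (f (x + h) - f x) (g (x + h) - g x) + wmul (f (x + h) - f x - l h) (g x) +
    wmul (f x) (g (x + h) - g x - l' h).
  rewrite !(wmulBl, wmulBr); move: (wmul _ _) (wmul _ _) (wmul _ _) (wmul _ _) (wmul _ _) (wmul _ _) => a b c d1 d2 d3.
  by apply: wienerE => k; apply/matrixP => i j; rewrite /= !mxE; ring.
rewrite (le_trans (ler_normD _ _))// (le_trans (lerD (ler_normD _ _) (lexx _)))//.
apply: (@le_trans _ _ (e / K * `|h| + e / K * `|h| * `|g x| + `|f x| * (e / K * `|h|))).
  apply: lerD; [apply: lerD|].
  - rewrite (le_trans (normM _ _))// (le_trans (ler_pM _ _ hf hg))//.
    rewrite mulrACA mulrA [X in X * _]mulrC ler_wpM2r//.
    by rewrite -ler_pdivlMr ?mulr_gt0.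
  - by rewrite (le_trans (normM _ _))// ler_wpM2r.
  - by rewrite (le_trans (normM _ _))// ler_wpM2l.
rewrite [X in X <= _](_ : _ = e / K * K * `|h|); last by rewrite /K; ring.
by rewrite divfK ?gt_eqF.
Unshelve. all: by end_near. Qed.

Lemma diff_wmul V (f g : V -> wiener N) x :
  differentiable f x -> differentiable g x ->
  differentiable (fun y => wmul (f y) (g y)) x /\
  'd (fun y => wmul (f y) (g y)) x =
    (fun v => wmul ('d f x v) (g x) + wmul (f x) ('d g x v)) :> (V -> wiener N).
Proof. by move=> df dg; exact: has_diff_wmul (has_diffP df) (has_diffP dg). Qed.

Lemma continuous_distP V (W : normedModType R) (f : V -> W) x :
  {for x, continuous f} <->
  forall e, 0 < e -> \forall y \near x, `|f x - f y| <= e.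
Proof. exact: cvgrPdist_le. Qed.

Section CkAlgebra.
Context (d : nat).
Implicit Types (O : set 'rV[R]_d) (f g u : 'rV[R]_d -> wiener N).

Lemma Ck_add (E : normedModType R) k O (f g : 'rV[R]_d -> E) : open O ->
  Ck_on k O f -> Ck_on k O g -> Ck_on k O (fun x => f x + g x).
Proof.
move=> oO; elim: k f g => [|k IH] f g.
  by move=> cf cg x Ox; exact: cvgD (cf x Ox) (cg x Ox).
move=> [df Df] [dg Dg]; split=> [x Ox|v].
  exact: differentiableD (df x Ox) (dg x Ox).
apply: Ck_ext (IH _ _ (Df v) (Dg v)) => // x; rewrite inE => Ox.
exact/esym/(congr1 (@^~ v) (diffD (df x Ox) (dg x Ox))).
Qed.

Lemma Ck_opp (E : normedModType R) k O (f : 'rV[R]_d -> E) : open O ->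
  Ck_on k O f -> Ck_on k O (fun x => - f x).
Proof.
move=> oO; elim: k f => [|k IH] f.
  by move=> cf x Ox; exact: cvgN (cf x Ox).
move=> [df Df]; split=> [x Ox|v]; first exact: differentiableN (df x Ox).
apply: Ck_ext (IH _ (Df v)) => // x; rewrite inE => Ox.
exact/esym/(congr1 (@^~ v) (diffN (df x Ox))).
Qed.

Lemma Ck_wmul k O f g : open O -> Ck_on k O f -> Ck_on k O g ->
  Ck_on k O (fun x => wmul (f x) (g x)).
Proof.
move=> oO; elim: k f g => [|k IH] f g.
  move=> cf cg x Ox; apply/continuous_distP => e e0.
  pose e1 := Num.min 1 (e / (`|f x| + `|g x| + 1)).
  have K0 : 0 < `|f x| + `|g x| + 1 by rewrite ltr_wpDl// addr_ge0.
  have e10 : 0 < e1 by rewrite lt_min ltr01 divr_gt0.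
  near=> y.
  have hf : `|f x - f y| <= e1 by near: y; exact: (continuous_distP _ _).1 (cf x Ox) _ _.
  have hg : `|g x - g y| <= e1 by near: y; exact: (continuous_distP _ _).1 (cg x Ox) _ _.
  have -> : wmul (f x) (g x) - wmul (f y) (g y) =
      wmul (f x - f y) (g x) + wmul (f x) (g x - g y) - wmul (f x - f y) (g x - g y).
    rewrite !(wmulBl, wmulBr); move: (wmul _ _) (wmul _ _) (wmul _ _) (wmul _ _) => a b c d1.
    by apply: wienerE => k; apply/matrixP => i j; rewrite /= !mxE; ring.
  rewrite (le_trans (ler_normB _ _))//.
  rewrite (le_trans (lerD (ler_normD _ _) (lexx _)))//.
  apply: (@le_trans _ _ (e1 * `|g x| + `|f x| * e1 + e1 * 1)).
    apply: lerD; [apply: lerD|]; rewrite (le_trans (normM _ _))//.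
    - by rewrite ler_wpM2r.
    - by rewrite ler_wpM2l.
    - by rewrite ler_pM// (le_trans hg)// ge_min lexx.
  rewrite [X in X <= _](_ : _ = e1 * (`|f x| + `|g x| + 1)); last by ring.
  by rewrite -ler_pdivlMr// ge_min lexx orbT.
move=> Cf Cg; have [[df Df] [dg Dg]] := (Cf, Cg); split=> [x Ox|v].
  exact: (diff_wmul (df x Ox) (dg x Ox)).1.
apply: (Ck_ext (f := fun x => wmul ('d f x v) (g x) + wmul (f x) ('d g x v))) => //.
  move=> x; rewrite inE => Ox.
  exact/esym/(congr1 (@^~ v) (diff_wmul (df x Ox) (dg x Ox)).2).
exact: Ck_add oO (IH _ _ (Df v) (CkS Cg)) (IH _ _ (CkS Cf) (Dg v)).
Unshelve. all: by end_near. Qed.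

(** From v - u = - u (b - a) v the smallness hypothesis first gives |v| <= 2 |u|, then the
    estimate. *)
Lemma inverse_near (a b u v : wiener N) : wmul u a = wone N -> wmul b v = wone N ->
  `|u| * `|b - a| <= 1 / 2 -> `|v - u| <= 2 * `|u| ^+ 2 * `|b - a|.
Proof.
move=> ua bv h; have E : v - u = - wmul (wmul u (b - a)) v.
  by rewrite wmulBr wmulBl ua wmul1l -wmulA bv wmul1 opprB.
have h1 : `|v - u| <= `|u| * `|b - a| * `|v|.
  by rewrite E normrN (le_trans (normM _ _))// ler_wpM2r// normM.
have h2 : `|v| <= 2 * `|u|.
  have : `|v| <= `|v - u| + `|u| by rewrite -{1}(subrK u v) ler_normD.
  move/le_trans => /(_ _ (lerD h1 (lexx _))) h3.
  have := ler_wpM2r (normr_ge0 v) h; lra.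
apply: (le_trans h1); rewrite [X in _ <= X](_ : _ = `|u| * `|b - a| * (2 * `|u|)); last by ring.
by rewrite ler_wpM2l// mulr_ge0.
Qed.

Lemma has_diff_winv V (f u l : V -> wiener N) x :
  (\forall y \near x, wmul (f y) (u y) = wone N /\ wmul (u y) (f y) = wone N) ->
  has_diff f x l ->
  differentiable u x /\
  'd u x = (fun v => - wmul (wmul (u x) (l v)) (u x)) :> (V -> wiener N).
Proof.
move=> Hu [C [ll C0 hC HC el]].
have [fu uf] := nbhs_singleton Hu.
apply: (@eps_diff_fun _ _ _ _ _ _ (`|u x| * C * `|u x|)).
- exact: (linear_wmul3 (u x) ll).
- move=> v; rewrite normrN (le_trans (normM _ _))// mulrAC ler_wpM2r//.
  by rewrite (le_trans (normM _ _))// -mulrA ler_wpM2l.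
move=> e e0; pose K := `|u x| ^+ 2 + 1; have K0 : 0 < K by rewrite ltr_wpDl// sqr_ge0.
pose P := 2 * `|u x| ^+ 3 * C ^+ 2 + 1.
have P0 : 0 < P by rewrite ltr_wpDl// !mulr_ge0 ?exprn_ge0// ltW.
pose Q := `|u x| * C + 1; have Q0 : 0 < Q by rewrite ltr_wpDl// mulr_ge0// ltW.
have e20 : 0 < e / 2 by rewrite divr_gt0.
near=> h; have hf : `|f (x + h) - f x| <= C * `|h| by near: h.
have ef : `|f (x + h) - f x - l h| <= e / 2 / K * `|h|.
  by near: h; apply: el; rewrite divr_gt0.
have hs : `|h| <= e / 2 / P by near: h; apply: nbhs0_le; rewrite divr_gt0.
have hq : `|h| <= 1 / 2 / Q by near: h; apply: nbhs0_le; rewrite !divr_gt0.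
have [fu' uf'] : wmul (f (x + h)) (u (x + h)) = wone N /\
    wmul (u (x + h)) (f (x + h)) = wone N.
  near: h; move: Hu; rewrite (near_shift 0 x).
  by apply: filterS => y /=; rewrite subr0 addrC.
have small : `|u x| * `|f (x + h) - f x| <= 1 / 2.
  rewrite (le_trans (ler_wpM2l (normr_ge0 _) hf))// mulrA.
  move: hq; rewrite ler_pdivlMr// mulrC; apply: le_trans.
  by rewrite ler_wpM2r// lerDl ler01.
have hu := inverse_near uf fu' small.
set D := f (x + h) - f x in hf ef small hu *.
have -> : u (x + h) - u x - - wmul (wmul (u x) (l h)) (u x) =
    - wmul (wmul (u x) D) (u (x + h) - u x) - wmul (wmul (u x) (D - l h)) (u x).
  have E : u (x + h) - u x = - wmul (wmul (u x) D) (u (x + h)).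
    by rewrite /D wmulBr wmulBl uf wmul1l -wmulA fu' wmul1 opprB.
  rewrite {1}E {E hu}; move: D (l h) {ef hf small} => D D'; rewrite !(wmulBr, wmulBl).
  move: (wmul _ (u (x + h))) (wmul _ (u x)) (wmul _ (u x)) => a b c.
  by apply: wienerE => k; apply/matrixP => i j; rewrite /= !mxE; ring.
rewrite (le_trans (ler_normB _ _))// normrN (splitr e) mulrDl; apply: lerD.
  rewrite (le_trans (normM _ _))//.
  rewrite (le_trans (ler_pM _ _ (normM _ _) hu))//.
  apply: (@le_trans _ _ (2 * `|u x| ^+ 3 * (C * `|h|) ^+ 2)).
    rewrite [X in X <= _](_ : _ = 2 * `|u x| ^+ 3 * `|D| ^+ 2); last by ring.
    by rewrite ler_wpM2l ?mulr_ge0 ?exprn_ge0// lerXn2r ?nnegrE ?mulr_ge0// ltW.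
  rewrite [X in X <= _](_ : _ = 2 * `|u x| ^+ 3 * C ^+ 2 * `|h| * `|h|); last by ring.
  rewrite ler_wpM2r//; move: hs; rewrite ler_pdivlMr// mulrC; apply: le_trans.
  by rewrite ler_wpM2r// lerDl ler01.
rewrite (le_trans (normM _ _))//.
apply: (@le_trans _ _ (`|u x| * (e / 2 / K * `|h|) * `|u x|)).
  by rewrite ler_wpM2r// (le_trans (normM _ _))// ler_wpM2l.
rewrite [X in X <= _](_ : _ = `|u x| ^+ 2 * (e / 2 / K) * `|h|); last by ring.
rewrite ler_wpM2r// mulrCA ler_piMr ?(ltW e20)// ler_pdivrMr// mul1r lerDl.
exact: ler01.
Unshelve. all: by end_near. Qed.

Lemma diff_winv V (f u : V -> wiener N) x :
  (\forall y \near x, wmul (f y) (u y) = wone N /\ wmul (u y) (f y) = wone N) ->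
  differentiable f x ->
  differentiable u x /\
  'd u x = (fun v => - wmul (wmul (u x) ('d f x v)) (u x)) :> (V -> wiener N).
Proof. by move=> Hu df; exact: has_diff_winv Hu (has_diffP df). Qed.

(** The differential - u f' u involves u itself, so the class of u rises by one at each step of the
    induction. *)
Lemma Ck_winv k O f u : open O ->
  (forall x, O x -> wmul (f x) (u x) = wone N /\ wmul (u x) (f x) = wone N) ->
  Ck_on k O f -> Ck_on k O u.
Proof.
move=> oO H; elim: k => [|k IH].
  move=> cf x Ox; apply/continuous_distP => e e0.
  pose Q := `|u x| + 1; have Q0 : 0 < Q by rewrite ltr_wpDl.
  pose P := 2 * `|u x| ^+ 2 + 1.
  have P0 : 0 < P by rewrite ltr_wpDl// mulr_ge0// sqr_ge0.
  near=> y; have Oy : O y by near: y; exact: open_nbhs_nbhs.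
  have [_ ux] := H x Ox; have [fy _] := H y Oy.
  have h1 : `|f x - f y| <= 1 / 2 / Q.
    by near: y; apply: (continuous_distP _ _).1 (cf x Ox) _ _; rewrite !divr_gt0.
  have h2 : `|f x - f y| <= e / P.
    by near: y; apply: (continuous_distP _ _).1 (cf x Ox) _ _; rewrite !divr_gt0.
  rewrite distrC in h1 h2; rewrite distrC.
  apply: (le_trans (inverse_near ux fy _)).
    move: h1; rewrite ler_pdivlMr// mulrC; apply: le_trans.
    by rewrite ler_wpM2r// lerDl ler01.
  move: h2; rewrite ler_pdivlMr// mulrC; apply: le_trans.
  by rewrite ler_wpM2r// lerDl ler01.
move=> Cf; have [df Df] := Cf.
have Hx x : O x -> \forall y \near x, wmul (f y) (u y) = wone N /\ wmul (u y) (f y) = wone N.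
  by move=> Ox; apply: filterS H _; exact: open_nbhs_nbhs.
split=> [x Ox|v]; first exact: (diff_winv (Hx x Ox) (df x Ox)).1.
apply: (Ck_ext (f := fun x => - wmul (wmul (u x) ('d f x v)) (u x))) => //.
  move=> x; rewrite inE => Ox.
  exact/esym/(congr1 (@^~ v) (diff_winv (Hx x Ox) (df x Ox)).2).
have Cu := IH (CkS Cf).
exact: Ck_opp oO (Ck_wmul oO (Ck_wmul oO Cu (Df v)) Cu).
Unshelve. all: by end_near. Qed.

End CkAlgebra.
End WienerCalculus.

#[local] Opaque diff wmul wnorm wone.

Lemma near_addr (R : realType) (V : normedModType R) (P : V -> Prop) x :
  (\forall y \near x, P y) -> \forall h \near (0 : V), P (x + h).
Proof. by rewrite (near_shift 0 x); apply: filterS => h /=; rewrite subr0 addrC. Qed.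

(** * Sylvester equations and square roots of constant loops *)

Section SquareRoots.
Context (R : realType) (n : nat) (N : matnorm R n).
Implicit Types (V : normedModType R) (a b s p q D : wiener N).

Definition const_loop (x : wiener N) := forall k, k != 0 -> x k = 0.

Lemma const_loopE x : const_loop x -> x = mono N (x 0) 0.
Proof. by move=> cx; apply: wienerE => k; rewrite monoE; case: eqVneq => [->|/cx]. Qed.

Lemma const_mono A : const_loop (mono N A 0).
Proof. by move=> k /negbTE k0; rewrite monoE k0. Qed.

Lemma const_anticomm a b : const_loop a -> const_loop b ->
  const_loop (wmul a b + wmul b a).
Proof.
by move=> ca cb; rewrite (const_loopE ca) (const_loopE cb) !wmul_mono -monoD; exact: const_mono.
Qed.

Lemma coef_eq0_norm (x : wiener N) k :
  (forall e : R, 0 < e -> exists2 y : wiener N, y k = 0 & `|y - x| < e) -> x k = 0.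
Proof.
move=> H; apply: (@mnorm_eq0_small _ _ N) => e e0; have [y yk yx] := H e e0.
apply: le_trans (ltW yx); rewrite -mnormN.
have -> : - x k = (y - x) k by rewrite -[RHS]/(y k - x k) yk sub0r.
exact: mnorm_coef.
Qed.

Lemma diff_coef0 V (f : V -> wiener N) x v k : (\forall y \near x, f y k = 0) ->
  differentiable f x -> ('d f x v : wiener N) k = 0.
Proof.
move=> f0 df; have fx0 := nbhs_singleton f0.
apply: coef_eq0_norm => e e0; have [d d0 Hd] := diff_quot v df e0.
have [r /= r0 Hr] := (nbhs_ballP _ _).1 f0.
pose t := Num.min (d / 2) (r / (`|v| + 1) / 2).
have v1 : 0 < `|v| + 1 by rewrite ltr_wpDl.
have t0 : 0 < t by rewrite lt_min !divr_gt0.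
have td : t < d by rewrite gt_min ltr_pdivrMr// ltr_pMr// ltr1n.
have tr : `|t *: v| < r.
  rewrite normrZ gtr0_norm// (@le_lt_trans _ _ (t * (`|v| + 1)))//.
    by rewrite ler_wpM2l ?(ltW t0)// lerDl.
  by rewrite -ltr_pdivlMr// gt_min orbC ltr_pdivrMr// ltr_pMr ?divr_gt0// ltr1n.
exists (t^-1 *: (f (x + t *: v) - f x)); last by apply: Hd; rewrite t0.
have fy0 : f (x + t *: v) k = 0.
  by apply: Hr; rewrite -ball_normE /ball_ /= opprD addrA subrr sub0r normrN.
by rewrite -[LHS]/(real_cx t^-1 *: (f (x + t *: v) k - f x k)) fx0 fy0 subrr scaler0.
Qed.

(** Near the identity D |-> a D + D b is close to doubling: 2 |D| exceeds |a D + D b| by at most |D|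
    / 2. *)
Lemma sylvester_le a b D : `|a - wone N| <= 1 / 4 -> `|b - wone N| <= 1 / 4 ->
  `|D| <= `|wmul a D + wmul D b|.
Proof.
move=> ha hb; have E : D + D = wmul a D + wmul D b - wmul (a - wone N) D - wmul D (b - wone N).
  rewrite wmulBl wmulBr wmul1 wmul1l; move: (wmul a D) (wmul D b) => u v.
  by apply: wienerE => k; apply/matrixP => i j; rewrite /= !mxE; ring.
have h1 : `|wmul (a - wone N) D| <= 1 / 4 * `|D|.
  exact: le_trans (normM _ _) (ler_wpM2r (normr_ge0 _) ha).
have h2 : `|wmul D (b - wone N)| <= 1 / 4 * `|D|.
  by apply: (le_trans (normM _ _)); rewrite mulrC; exact: ler_wpM2r (normr_ge0 _) _ _ hb.
have : `|D + D| = 2 * `|D|.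
  by rewrite -(@ger0_norm _ 2)// -normrZ scaler_nat mulr2n.
have : `|D + D| <= `|wmul a D + wmul D b| + 1 / 4 * `|D| + 1 / 4 * `|D|.
  rewrite E (le_trans (ler_normB _ _))// lerD// (le_trans (ler_normB _ _))// lerD//.
move: `|D + D| `|wmul a D + wmul D b| `|D| (normr_ge0 D) => u w v; clear; lra.
Qed.

Lemma sylvester_inj a b D D' : `|a - wone N| <= 1 / 4 -> `|b - wone N| <= 1 / 4 ->
  wmul a D + wmul D b = wmul a D' + wmul D' b -> D = D'.
Proof.
move=> ha hb E; apply/eqP; rewrite -subr_eq0 -normr_le0.
by apply: (le_trans (sylvester_le _ ha hb)); rewrite wmulBr wmulBl addrACA -opprD E subrr normr0.
Qed.

(** Constant loops form a finite-dimensional space, where the injectivity given by [sylvester_inj]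
    implies surjectivity. *)
Lemma sylvester_const s q : const_loop s -> const_loop q -> `|s - wone N| <= 1 / 4 ->
  exists2 D, const_loop D & wmul s D + wmul D s = q.
Proof.
move=> cs cq hs; set S := s 0; have sE := const_loopE cs.
pose f (X : 'M[Cx R]_n) := S *m X + X *m S.
have lf : linear f.
  by move=> c X Y; rewrite /f mulmxDl mulmxDr -scalemxAl -scalemxAr scalerDr addrACA.
pose f' : {linear _ -> _} := HB.pack f (GRing.isLinear.Build _ _ _ _ f lf).
have fE X : wmul s (mono N X 0) + wmul (mono N X 0) s = mono N (f X) 0.
  by rewrite {1 2}sE !wmul_mono monoD.
have kf : lker (linfun f') == 0%VS.
  apply/lker0P => X Y; rewrite !lfunE /= => XY.
  have : mono N X 0 = mono N Y 0 by apply: (sylvester_inj hs hs); rewrite !fE XY.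
  by move/(congr1 (fun x : wiener N => x 0)); rewrite !monoE eqxx.
exists (mono N ((linfun f')^-1%VF (q 0)) 0); first exact: const_mono.
rewrite fE [RHS](const_loopE cq); congr mono.
have := lker0_compfV kf => /(congr1 (fun g : 'End(_) => g (q 0))).
by rewrite comp_lfunE id_lfunE lfunE.
Qed.

Lemma sylvester_implicit V (F q : V -> wiener N) s x C : const_loop s ->
  `|s - wone N| <= 1 / 4 -> linear q -> (forall v, `|q v| <= C * `|v|) ->
  (forall v, const_loop (q v)) ->
  (forall e, 0 < e -> \forall h \near (0 : V),
     `|wmul s (F (x + h) - F x) + wmul (F (x + h) - F x) s - q h| <= e * `|h|) ->
  differentiable F x /\ forall v, wmul s ('d F x v) + wmul ('d F x v) s = q v.
Proof.
move=> cs hs lq bq cq H.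
have /choice[E HE] : forall v, exists D, wmul s D + wmul D s = q v.
  by move=> v; have [D _ DE] := sylvester_const cs (cq v) hs; exists D.
suff [dF dE] : differentiable F x /\ 'd F x = E :> (V -> wiener N).
  split=> // v.
  exact: (eq_ind_r (fun l : V -> wiener N => wmul s (l v) + wmul (l v) s = q v) (HE v) dE).
apply: (@eps_diff_fun _ _ _ _ _ _ C) => [c u v|v|e e0].
- apply: (sylvester_inj hs hs); rewrite HE lq -!HE.
  by rewrite wmulDr wmulDl wmulZl wmulZr scalerDr addrACA.
- by apply: le_trans (bq v); rewrite -HE; exact: sylvester_le.
have := H e e0; apply: filterS => h; apply: le_trans.
apply: le_trans (sylvester_le _ hs hs) _.
rewrite -HE [wmul s (_ - E h)]wmulBr [wmul (_ - E h) s]wmulBl.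
by rewrite addrACA opprD.
Qed.

(** The estimate of [has_diff_sylvester] for one increment of norm [t]. [K] is a Lipschitz constant
    for F, [P] counts the error of q once and that of s twice with weight |F|, and the bound on [t]
    absorbs the quadratic terms. *)
Lemma sylvester_step s0 q0 F0 s' q' F' sh qh (C C' e t : R) :
  let f := `|F0| in let K := C' + 2 * C * f in let P := 1 + 2 * f in
  0 < C -> 0 < K -> 0 < P -> 0 <= t ->
  `|s0 - wone N| <= 1 / 4 -> wmul s0 F0 + wmul F0 s0 = q0 ->
  `|s' - wone N| <= 1 / 4 -> wmul s' F' + wmul F' s' = q' ->
  `|s' - s0| <= C * t -> `|q' - q0| <= C' * t ->
  `|s' - s0 - sh| <= e / 2 / P * t -> `|q' - q0 - qh| <= e / 2 / P * t ->
  t <= e / 2 / (2 * C * K) ->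
  `|wmul s0 (F' - F0) + wmul (F' - F0) s0 - (qh - (wmul sh F0 + wmul F0 sh))| <= e * t.
Proof.
move=> f K P C0 K0 P0 t0 hs Ex hs' Ex' h1 h2 h3 h4 h5.
have E1 : wmul s' (F' - F0) + wmul (F' - F0) s' =
    q' - q0 - wmul (s' - s0) F0 - wmul F0 (s' - s0).
  rewrite -Ex -Ex' !(wmulBr, wmulBl).
  move: (wmul _ _) (wmul _ _) (wmul _ _) (wmul _ _) (wmul _ _) (wmul _ _) => a b c d1 d2 d3.
  by apply: wienerE => k; apply/matrixP => i j; rewrite /= !mxE; ring.
have hF : `|F' - F0| <= K * t.
  rewrite (le_trans (sylvester_le _ hs' hs'))// E1.
  rewrite (le_trans (ler_normB _ _))// (le_trans (lerD (ler_normB _ _) (lexx _)))//.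
  have i1 := ler_wpM2r (normr_ge0 F0) h1.
  have i2 : `|wmul F0 (s' - s0)| <= C * t * `|F0| by rewrite (le_trans (normM _ _))// mulrC.
  apply: (le_trans (lerD (lerD h2 (le_trans (normM _ _) i1)) i2)).
  by rewrite [X in X <= _](_ : _ = K * t)// /K /f; ring.
have -> : wmul s0 (F' - F0) + wmul (F' - F0) s0 - (qh - (wmul sh F0 + wmul F0 sh)) =
    (q' - q0 - qh) - wmul (s' - s0 - sh) F0 - wmul F0 (s' - s0 - sh) -
    (wmul (s' - s0) (F' - F0) + wmul (F' - F0) (s' - s0)).
  rewrite -Ex -Ex' !(wmulBr, wmulBl).
  move: (wmul _ _) (wmul _ _) (wmul _ _) (wmul _ _) (wmul _ _) (wmul _ _) (wmul _ _) (wmul _ _) => a b c d1 d2 d3 d4 d5.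
  by apply: wienerE => k; apply/matrixP => i j; rewrite /= !mxE; ring.
rewrite (splitr e) mulrDl (le_trans (ler_normB _ _))//; apply: lerD.
  rewrite (le_trans (ler_normB _ _))// (le_trans (lerD (ler_normB _ _) (lexx _)))//.
  have i1 := ler_wpM2r (normr_ge0 F0) h3.
  have i2 : `|wmul F0 (s' - s0 - sh)| <= e / 2 / P * t * `|F0|.
    by rewrite (le_trans (normM _ _))// mulrC.
  apply: (le_trans (lerD (lerD h4 (le_trans (normM _ _) i1)) i2)).
  have -> (c : R) : c * t + c * t * `|F0| + c * t * `|F0| = c * P * t.
    by rewrite /P /f; ring.
  by rewrite divfK ?gt_eqF.
rewrite (le_trans (ler_normD _ _))//.
have i0 : 0 <= C * t by rewrite mulr_ge0 ?(ltW C0).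
have i1 : `|wmul (s' - s0) (F' - F0)| <= C * t * (K * t).
  by rewrite (le_trans (normM _ _))// ler_pM.
have i2 : `|wmul (F' - F0) (s' - s0)| <= C * t * (K * t).
  by rewrite (le_trans (normM _ _))// mulrC ler_pM.
apply: (le_trans (lerD i1 i2)).
rewrite [X in X <= _](_ : _ = t * (2 * C * K) * t); last by ring.
by rewrite ler_wpM2r// -ler_pdivlMr// !mulr_gt0.
Qed.

Lemma has_diff_sylvester V (F s q ls lq : V -> wiener N) x :
  (\forall y \near x, `|s y - wone N| <= 1 / 4 /\ wmul (s y) (F y) + wmul (F y) (s y) = q y) ->
  const_loop (s x) -> const_loop (F x) ->
  (forall v, const_loop (ls v)) -> (forall v, const_loop (lq v)) ->
  has_diff s x ls -> has_diff q x lq ->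
  differentiable F x /\ forall v, wmul (s x) ('d F x v) + wmul ('d F x v) (s x) =
    lq v - (wmul (ls v) (F x) + wmul (F x) (ls v)).
Proof.
move=> H cs cF cls clq [C [ll C0 hC HC el]] [C' [ll' C'0 hC' HC' el']].
have [hs Ex] := nbhs_singleton H.
apply: (@sylvester_implicit _ F (fun v => lq v - (wmul (ls v) (F x) + wmul (F x) (ls v)))
  (s x) x (C' + 2 * C * `|F x|)) => //.
- by move=> c u v; rewrite ll' (linear_wmul (F x) (F x) ll ll) scalerBr opprD addrACA.
- move=> v; rewrite (le_trans (ler_normB _ _))// mulrDl lerD//.
  rewrite (le_trans (ler_normD _ _))//.
  have h1 : `|wmul (ls v) (F x)| <= C * `|v| * `|F x|.
    rewrite (le_trans (normM _ _))//; exact: ler_wpM2r (normr_ge0 _) _ _ (hC v).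
  have h2 : `|wmul (F x) (ls v)| <= C * `|v| * `|F x|.
    rewrite (le_trans (normM _ _))// mulrC; exact: ler_wpM2r (normr_ge0 _) _ _ (hC v).
  apply: (le_trans (lerD h1 h2)).
  by rewrite [X in X <= _](_ : _ = 2 * C * `|F x| * `|v|)//; ring.
- move=> v k k0.
  have h := const_anticomm (cls v) cF k0; have := clq v k k0; move: h.
  by move: (lq v) (_ + _) => u w h h'; rewrite -[LHS]/(u k - w k) h h' subrr.
move=> e e0; pose f := `|F x|.
pose K := C' + 2 * C * f; have K0 : 0 < K by rewrite ltr_wpDr// !mulr_ge0 ?(ltW C0)// normr_ge0.
pose P := 1 + 2 * f; have P0 : 0 < P by rewrite ltr_wpDr// mulr_ge0// normr_ge0.
have e20 : 0 < e / 2 by rewrite divr_gt0.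
near=> h.
have h1 : `|s (x + h) - s x| <= C * `|h| by near: h.
have h2 : `|q (x + h) - q x| <= C' * `|h| by near: h.
have h3 : `|s (x + h) - s x - ls h| <= e / 2 / P * `|h|.
  by near: h; apply: el; rewrite divr_gt0.
have h4 : `|q (x + h) - q x - lq h| <= e / 2 / P * `|h|.
  by near: h; apply: el'; rewrite divr_gt0.
have h5 : `|h| <= e / 2 / (2 * C * K).
  by near: h; apply: nbhs0_le; rewrite divr_gt0// !mulr_gt0.
have [hs' Ex'] : `|s (x + h) - wone N| <= 1 / 4 /\
    wmul (s (x + h)) (F (x + h)) + wmul (F (x + h)) (s (x + h)) = q (x + h).
  near: h; exact: near_addr H.
exact: (sylvester_step C0 K0 P0 (normr_ge0 h) hs Ex hs' Ex' h1 h2 h3 h4 h5).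
Unshelve. all: by end_near. Qed.

Lemma has_diff_sqrt V (s p lp : V -> wiener N) x :
  (\forall y \near x, `|s y - wone N| <= 1 / 4 /\ wmul (s y) (s y) = p y) ->
  const_loop (s x) -> (forall v, const_loop (lp v)) -> has_diff p x lp ->
  differentiable s x /\ forall v, wmul (s x) ('d s x v) + wmul ('d s x v) (s x) = lp v.
Proof.
move=> H cs clp [C [ll C0 hC HC el]].
have [hs Ex] := nbhs_singleton H.
apply: (@sylvester_implicit _ s lp (s x) x C cs hs ll hC clp) => e e0.
have e20 : 0 < e / 2 by rewrite divr_gt0.
near=> h.
have h1 : `|p (x + h) - p x| <= C * `|h| by near: h.
have h2 : `|p (x + h) - p x - lp h| <= e / 2 * `|h| by near: h; apply: el.
have h3 : `|h| <= e / 2 / (C * C).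
  by near: h; apply: nbhs0_le; rewrite divr_gt0// !mulr_gt0.
have [hs' Ex'] : `|s (x + h) - wone N| <= 1 / 4 /\ wmul (s (x + h)) (s (x + h)) = p (x + h).
  near: h; exact: near_addr H.
move: (s (x + h)) (p (x + h)) (lp h) (s x) (p x) hs Ex hs' Ex' h1 h2 
  => s' p' ph s0 p0 hs Ex hs' Ex' h1 h2.
have hF : `|s' - s0| <= C * `|h|.
  rewrite (le_trans (sylvester_le _ hs' hs))//.
  by rewrite wmulBr wmulBl addrA subrK Ex Ex'.
have -> : wmul s0 (s' - s0) + wmul (s' - s0) s0 - ph =
    (p' - p0 - ph) - wmul (s' - s0) (s' - s0).
  rewrite -Ex -Ex' !(wmulBr, wmulBl).
  move: (wmul _ _) (wmul _ _) (wmul _ _) (wmul _ _) => a b c d1.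
  by apply: wienerE => k; apply/matrixP => i j; rewrite /= !mxE; ring.
rewrite (splitr e) mulrDl (le_trans (ler_normB _ _))//; apply: lerD => //.
rewrite (le_trans (normM _ _))//.
apply: (@le_trans _ _ (C * `|h| * (C * `|h|))); first exact: ler_pM.
rewrite [X in X <= _](_ : _ = `|h| * (C * C) * `|h|); last by ring.
by rewrite ler_wpM2r// -ler_pdivlMr// !mulr_gt0.
Unshelve. all: by end_near. Qed.

Section CkRoots.
Context (d : nat) (O : set 'rV[R]_d) (oO : open O).
Implicit Types (f : 'rV[R]_d -> wiener N).

Lemma const_diff f x v : (forall y, O y -> const_loop (f y)) -> O x ->
  differentiable f x -> const_loop ('d f x v).
Proof.
move=> cf Ox df k k0; apply: diff_coef0 df.
by apply: filterS (open_nbhs_nbhs (conj oO Ox)) => y Oy; exact: cf.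
Qed.

(** The derivative of F solves a Sylvester equation with the same [s] and a right-hand side made of
    F and the derivatives of q and s. The induction closes because [q] and [F] are general in it. *)
Lemma Ck_sylvester k (s q F : 'rV[R]_d -> wiener N) :
  (forall x, O x -> const_loop (s x) /\ `|s x - wone N| <= 1 / 4) ->
  (forall x, O x -> const_loop (q x)) -> (forall x, O x -> const_loop (F x)) ->
  (forall x, O x -> wmul (s x) (F x) + wmul (F x) (s x) = q x) ->
  Ck_on k O s -> Ck_on k O q -> Ck_on k O F.
Proof.
elim: k q F => [|k IH] q F hs hq hF E Cs Cq.
  move=> x Ox; apply/continuous_distP => e e0.
  pose P := 1 + 2 * `|F x|; have P0 : 0 < P by rewrite ltr_wpDr// mulr_ge0// normr_ge0.
  have cs := (continuous_distP _ _).1 (Cs x Ox) _ (divr_gt0 e0 P0).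
  have cq := (continuous_distP _ _).1 (Cq x Ox) _ (divr_gt0 e0 P0).
  near=> y; have Oy : O y by near: y; exact: open_nbhs_nbhs.
  have h1 : `|s x - s y| <= e / P by near: y.
  have h2 : `|q x - q y| <= e / P by near: y.
  have [[_ hx] [_ hy]] := (hs x Ox, hs y Oy).
  move: (E x Ox) (E y Oy) => Ex Ey.
  apply: (le_trans (sylvester_le _ hy hy)).
  have -> : wmul (s y) (F x - F y) + wmul (F x - F y) (s y) =
      q x - q y - wmul (s x - s y) (F x) - wmul (F x) (s x - s y).
    rewrite -Ex -Ey; move: (s x) (s y) (F x) (F y) => a a' b b'.
    rewrite !(wmulBr, wmulBl).
    move: (wmul _ _) (wmul _ _) (wmul _ _) (wmul _ _) (wmul _ _) (wmul _ _) => u1 u2 u3 u4 u5 u6.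
    by apply: wienerE => l; apply/matrixP => i j; rewrite /= !mxE; ring.
  apply: (le_trans (ler_normB _ _)).
  apply: (le_trans (lerD (ler_normB _ _) (lexx _))).
  have i1 := le_trans (normM _ _) (ler_wpM2r (normr_ge0 (F x)) h1).
  have i2 := le_trans (normM _ _) (ler_wpM2l (normr_ge0 (F x)) h1).
  apply: (le_trans (lerD (lerD h2 i1) i2)).
  have -> (c : R) : c + c * `|F x| + `|F x| * c = c * P by rewrite /P; ring.
  by rewrite divfK ?gt_eqF.
have CF := IH _ _ hs hq hF E (CkS Cs) (CkS Cq).
have [[ds Ds] [dq Dq]] := (Cs, Cq).
have DF x : O x -> differentiable F x /\ forall v,
    wmul (s x) ('d F x v) + wmul ('d F x v) (s x) =
    'd q x v - (wmul ('d s x v) (F x) + wmul (F x) ('d s x v)).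
  move=> Ox; apply: has_diff_sylvester (has_diffP (ds x Ox)) (has_diffP (dq x Ox)).
  - apply: filterS (open_nbhs_nbhs (conj oO Ox)) => y Oy.
    by split; [exact: (hs y Oy).2|exact: E].
  - exact: (hs x Ox).1.
  - exact: hF.
  - by move=> v; apply: const_diff (ds x Ox) => // y /hs[].
  - by move=> v; apply: const_diff (dq x Ox).
split=> [x /DF[]//|v].
apply: (IH (fun x => 'd q x v - (wmul ('d s x v) (F x) + wmul (F x) ('d s x v)))) => //.
- move=> x Ox; have [dF eE] := DF x Ox; rewrite -eE.
  exact: const_anticomm (hs x Ox).1 (const_diff v hF Ox dF).
- by move=> x Ox; exact: const_diff (DF x Ox).1.
- by move=> x Ox; exact: (DF x Ox).2.
- exact: CkS Cs.
apply: (Ck_add oO (Dq v)); apply: (Ck_opp oO).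
exact: (Ck_add oO (Ck_wmul oO (Ds v) CF) (Ck_wmul oO CF (Ds v))).
Unshelve. all: by end_near. Qed.

(** The derivative of s solves s D + D s = p', so regularity passes to it through [Ck_sylvester]. No
    regularity of s is assumed: closeness to the identity already makes it continuous. *)
Lemma Ck_sqrt k (s p : 'rV[R]_d -> wiener N) :
  (forall x, O x -> const_loop (s x) /\ `|s x - wone N| <= 1 / 4) ->
  (forall x, O x -> const_loop (p x)) ->
  (forall x, O x -> wmul (s x) (s x) = p x) ->
  Ck_on k O p -> Ck_on k O s.
Proof.
move=> hs hp E; elim: k => [|k IH] Cp.
  move=> x Ox; apply/continuous_distP => e e0.
  have cp := (continuous_distP _ _).1 (Cp x Ox) _ e0.
  near=> y; have Oy : O y by near: y; exact: open_nbhs_nbhs.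
  have h1 : `|p x - p y| <= e by near: y.
  have [[_ hx] [_ hy]] := (hs x Ox, hs y Oy).
  apply: (le_trans (sylvester_le _ hx hy)).
  by rewrite wmulBr wmulBl addrA subrK (E x Ox) (E y Oy).
have [dp Dp] := Cp; have Cs := IH (CkS Cp).
have DF x : O x -> differentiable s x /\ forall v,
    wmul (s x) ('d s x v) + wmul ('d s x v) (s x) = 'd p x v.
  move=> Ox; apply: has_diff_sqrt (has_diffP (dp x Ox)).
  - apply: filterS (open_nbhs_nbhs (conj oO Ox)) => y Oy.
    by split; [exact: (hs y Oy).2|exact: E].
  - exact: (hs x Ox).1.
  - by move=> v; apply: const_diff (dp x Ox).
split=> [x /DF[]//|v].
apply: (@Ck_sylvester k s (fun x => 'd p x v)) => //.
- by move=> x Ox; apply: const_diff (dp x Ox).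
- by move=> x Ox; apply: const_diff (DF x Ox).1 => // y /hs[].
- by move=> x Ox; exact: (DF x Ox).2.
- exact: Dp.
Unshelve. all: by end_near. Qed.

End CkRoots.

End SquareRoots.

#[local] Opaque diff wmul wnorm wone loop_eval mexp lie_algebra.

(** * Lifts to the fixed subgroup *)

Section Subgroups.
Context (R : realType) (n : nat) (N : matnorm R n).
Implicit Types (x y : wiener N) (K : set (wiener N)) (A B : 'M[Cx R]_n).

Lemma subgroup_winv K x : subgroup K -> K x ->
  [/\ K (winv x), wmul x (winv x) = wone N & wmul (winv x) x = wone N].
Proof. by move=> [_ _ hV] /hV[y [Ky xy yx]]; rewrite (winvE xy yx). Qed.

Lemma winvM x y : wmul x (winv x) = wone N -> wmul (winv x) x = wone N ->
  wmul y (winv y) = wone N -> wmul (winv y) y = wone N ->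
  winv (wmul x y) = wmul (winv y) (winv x).
Proof.
move=> xx' x'x yy' y'y; apply: winvE.
  by rewrite wmulA -[wmul (wmul x y) _]wmulA yy' wmul1.
by rewrite wmulA -[wmul (wmul _ _) x]wmulA x'x wmul1.
Qed.

Lemma winvK x : wmul x (winv x) = wone N -> wmul (winv x) x = wone N ->
  winv (winv x) = x.
Proof. by move=> xx' x'x; exact: winvE. Qed.

Lemma winv1 : winv (wone N) = wone N.
Proof. by apply: winvE; rewrite wmul1. Qed.

Lemma analytic_on_continuous (E F : normedModType R) (D : set E) (f : E -> F) :
  analytic_on D f -> {within D, continuous f}.
Proof.
move=> aD; apply/subspace_continuousP => x Dx.
have [Q [g [oQ Qx ag gE]]] := aD x Dx.
have cg := differentiable_continuous (analytic_differentiable (ag x Qx)).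
change (f y @[y --> within D (nbhs x)] --> f x).
rewrite -(gE x Qx Dx); apply/cvgrPdist_le => e e0.
rewrite near_withinE.
apply: filterS2 ((continuous_distP _ _).1 cg e e0) (open_nbhs_nbhs (conj oQ Qx)).
by move=> y gy Qy Dy; rewrite -gE.
Qed.

Lemma id_component_sub K : id_component K `<=` K.
Proof. by move=> x [C [_ CK _] Cx]; exact: CK. Qed.

Lemma id_component_map K K' (f : wiener N -> wiener N) : f (wone N) = wone N ->
  (forall x, K x -> K' (f x)) -> {within K, continuous f} ->
  forall x, id_component K x -> id_component K' (f x).
Proof.
move=> f1 fK cf x [C [C1 CK cC] Cx]; exists (f @` C); last by exists x.
split; first by exists (wone N).
  by move=> _ [y Cy <-]; apply/fK/CK.
apply: connected_continuous_connected => //.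
exact: continuous_subspaceW cf.
Qed.

Section Constants.
Context (G : set 'M[Cx R]_n) (mG : matrix_lie_group G).

Lemma LambdaPM_mono A : G A -> LambdaP G (mono N A 0) /\ LambdaM G (mono N A 0).
Proof.
move=> GA; have E z : loop_eval (mono N A 0) z = A by rewrite loop_eval_mono expr0z scale1r.
have ext u : (forall z, u z = A) -> holomorphic_extension G u (fun=> A).
  move=> uA; split=> [z _||z _]; last by rewrite uA.
    by split=> //; exact: derivable_cst.
  by apply: continuous_subspaceT; exact: cst_continuous.
by split; (split; [by move=> z _; rewrite E|by exists (fun=> A); apply: ext => z; rewrite E]).
Qed.

Lemma const_partP K x : K `<=` LambdaG G -> const_part G K x <-> K x /\ const_loop x.
Proof.
move=> KG; split=> [[[Kx Px] Mx]|[Kx cx]].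
  split=> // -[k|k] k0; first by apply: LambdaM_coef Mx _; rewrite lt0n.
  by rewrite NegzE; exact: (LambdaP_coef Px).
have GA : G (x 0).
  have := KG x Kx 1 (normr1 _); rewrite {1}(const_loopE cx).
  by rewrite loop_eval_mono expr0z scale1r.
by have [Px Mx] := LambdaPM_mono GA; rewrite (const_loopE cx) in Kx *; split.
Qed.

Lemma mono_norm A : `|mono N A 0 - wone N| = N (A - 1%:M).
Proof.
have -> : mono N A 0 - wone N = mono N (A - 1%:M) 0.
  by apply: wienerE => k; rewrite wone_mono -[LHS]/(mono N A 0 k - mono N 1%:M 0 k)
    !monoE; case: ifP => // _; rewrite subrr.
exact: wnorm_mono.
Qed.

(** Prepares [cartan] for the constants of [K]. A matrix limit of constants is also a limit in the
    Wiener norm, and it lies in [G] since [G] is closed among invertible matrices. *)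
Lemma const_matrix_lie_group K : banach_lie_subgroup G K ->
  matrix_lie_group [set A | K (mono N A 0)].
Proof.
move=> [KG [K1 KM KV] Kcl _]; have [_ _ GV Gcl] := mG.
have KA A : K (mono N A 0) -> G A.
  move=> /KG/(_ 1 (normr1 _)); by rewrite loop_eval_mono expr0z scale1r.
split=> [|A B KA' KB|A KA'|A].
- by rewrite /= -wone_mono.
- by rewrite /= -[0]addr0 -wmul_mono; exact: KM.
- have [uA _] := GV A (KA A KA'); split=> //=.
  have [Ki _ _] := subgroup_winv (And3 K1 KM KV) KA'.
  rewrite -(_ : winv (mono N A 0) = mono N (invmx A) 0)//.
  by apply: winvE; rewrite wmul_mono addr0 wone_mono ?mulmxV ?mulVmx.
move=> [clA uA] /=; apply: Kcl; split.
  move=> B /nbhs_ballP[e /= e0 Be].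
  have : \forall A' \near A, `|mono N A 0 - mono N A' 0| < e.
    apply/(nbhs_mnormP N); exists e => // A' A'A.
    have -> : mono N A 0 - mono N A' 0 = mono N (A - A') 0.
      by apply: wienerE => k; rewrite -[LHS]/(mono N A 0 k - mono N A' 0 k)
        !monoE; case: ifP => // _; rewrite subrr.
    by rewrite -[X in X < _]/(wnorm (mono N (A - A') 0)) wnorm_mono mnorm_distC.
  move=> /clA[A' [KA' A'A]]; exists (mono N A' 0); split=> //; apply: Be.
  by rewrite -ball_normE.
move=> z z1; rewrite loop_eval_mono expr0z scale1r; apply: Gcl; split=> //.
by move=> B /clA[A' [KA' BA']]; exists A'; split=> //; exact: KA.
Qed.

(** The root is the exponential of half a logarithm. Taking the logarithm in the Lie algebra of the
    constants of [K] is what keeps the root in [K]. *)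
Lemma const_sqrt K : banach_lie_subgroup G K -> forall e : R, 0 < e ->
  exists2 d : R, 0 < d & forall p, const_part G K p -> `|p - wone N| < d ->
    exists k, [/\ const_part G K k, wmul k k = p & `|k - wone N| <= e].
Proof.
move=> bK e e0; have [KG sK _ _] := bK.
have [d d0 Hd] := cartan N (const_matrix_lie_group bK).
have E0 : 0 < expR 1 :> R := expR_gt0 1.
(* As Y has norm at most 1, exp Y is within expR 1 times |Y| of the identity, and |Y| is at most |p
   - 1|. *)
exists (Num.min d (Num.min 1 (e / expR 1))).
  by rewrite !lt_min d0 ltr01 divr_gt0.
move=> p /(const_partP p KG)[Kp cp]; rewrite (const_loopE cp) mono_norm.
rewrite !lt_min => /andP[pd /andP[p1 pe]].
have KA : [set A | K (mono N A 0)] (p 0) by rewrite /= -const_loopE.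
have [X [lX XA NX]] := Hd _ KA pd.
pose Y := real_cx (1 / 2) *: X.
have YY : Y + Y = X.
  rewrite -scalerDl -real_cxD (_ : 1 / 2 + 1 / 2 = 1 :> R); last by lra.
  by rewrite real_cx1 scale1r.
have lY : lie_algebra [set A | K (mono N A 0)] Y by exact: lieZ.
have KY := lie_mexp lY.
have NY : N Y <= N (p 0 - 1%:M).
  rewrite mnormZr ger0_norm; last by rewrite divr_ge0.
  rewrite mulrC mulrA mulr1 ler_pdivrMr// mulrC; exact: NX.
exists (mono N (mexp Y) 0); split.
- by apply/(const_partP _ KG); split=> //; exact: const_mono.
- by rewrite wmul_mono addr0 -(mexp_double N) YY XA.
rewrite mono_norm -(subrK Y (_ - _)) (le_trans (mnormD _ _ _))//.
have Y1 : N Y <= 1 by rewrite (le_trans NY)// ltW.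
apply: (le_trans (lerD (mexp_approx Y1) (lexx _))).
rewrite mulrBl mul1r subrK; apply: (le_trans (ler_wpM2l (ltW E0) NY)).
by rewrite mulrC -ler_pdivlMr// ltW.
Qed.

End Constants.
End Subgroups.

#[local] Opaque diff wmul wnorm wone.

Lemma Ck_linear (R : realType) d (E F : normedModType R) k (O : set 'rV[R]_d)
    (L : {linear E -> F}) (f : 'rV[R]_d -> E) :
  open O -> continuous L -> Ck_on k O f -> Ck_on k O (L \o f).
Proof.
move=> oO cL; elim: k f => [|k IH] f.
  by move=> cf x Ox; apply: continuous_comp; [exact: cf|exact: cL].
move=> [df Df]; have dL x := linear_differentiable x cL.
split=> [x Ox|v]; first exact: differentiable_comp (df x Ox) (dL _).
apply: Ck_ext (IH _ (Df v)) => // x; rewrite inE => Ox.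
by rewrite (diff_comp (df x Ox) (dL _)) /= (diff_lin _ cL).
Qed.

Lemma within_open_continuous (T T' : topologicalType) (D : set T) (f : T -> T') x :
  open D -> D x -> {within D, continuous f} -> {for x, continuous f}.
Proof.
move=> oD Dx /subspace_continuousP/(_ x Dx) cf A /cf.
rewrite -[X in X -> _]/(nbhs x [set y | D y -> A (f y)]) => fA.
by apply: filterS2 fA (open_nbhs_nbhs (conj oD Dx)) => y /= h Dy; exact: h.
Qed.

(** * Smooth maps on a manifold *)

Section Manifold.
Context (R : realType) (U : topologicalType) (d : nat) (atlas : set (chart R U d)).
Hypothesis hU : smooth_manifold atlas.
Implicit Types (E F : normedModType R) (W : set U) (c : chart R U d).

Lemma chart_invK c W x : atlas c -> chart_image c W x ->
  [/\ W (chart_inv c x), chart_dom c (chart_inv c x) & chart_map c (chart_inv c x) = x].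
Proof.
move=> ac [t [Dt Wt] <-]; have [_ _ /(_ c ac)[_ _ K _ _] _ _] := hU.
by rewrite K ?inE.
Qed.

Lemma chart_mapK c t : atlas c -> chart_dom c t -> chart_inv c (chart_map c t) = t.
Proof.
by move=> ac Dt; have [_ _ /(_ c ac)[_ _ K _ _] _ _] := hU; rewrite K ?inE.
Qed.

Lemma chart_image_open c W : atlas c -> open W -> open (chart_image c W).
Proof.
move=> ac oW; have [_ _ /(_ c ac)[_ oI K _ ci] _ _] := hU.
rewrite openE => x Wx; have [Wix Dix ixK] := chart_invK ac Wx.
have Ix : chart_image c setT x by exists (chart_inv c x).
have cx : {for x, continuous (chart_inv c)} := within_open_continuous oI Ix ci.
have nW : nbhs (chart_inv c x) W by exact: open_nbhs_nbhs.
refine (@filterS2 _ (nbhs x) _ _ _ _ _ (cx _ nW) (open_nbhs_nbhs (conj oI Ix))) => y Wy Iy.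
by have [_ Dy yK] := chart_invK ac Iy; exists (chart_inv c y).
Qed.

Lemma near_chart c t (A : set 'rV[R]_d) : atlas c -> chart_dom c t ->
  nbhs (chart_map c t) A -> \forall s \near t, chart_dom c s /\ A (chart_map c s).
Proof.
move=> ac Dt; have [_ _ /(_ c ac)[oD _ _ cm _] _ _] := hU.
move=> /(within_open_continuous oD Dt cm) h.
exact: filterI (open_nbhs_nbhs (conj oD Dt)) h.
Qed.

Lemma smooth_map_sub E W W' (F : U -> E) : W' `<=` W -> smooth_map atlas W F ->
  smooth_map atlas W' F.
Proof.
move=> sW sF c ac k; apply: Ck_sub (sF c ac k) => x [t [Dt Wt] <-].
by exists t => //; split=> //; exact: sW.
Qed.

Lemma smooth_map_continuous E W (F : U -> E) t : smooth_map atlas W F -> W t ->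
  {for t, continuous F}.
Proof.
move=> sF Wt; have [_ _ _ /(_ t)[c ac Dt] _] := hU.
have Ix : chart_image c W (chart_map c t) by exists t.
have cF := sF c ac 0 _ Ix; move=> A FA.
have : nbhs (chart_map c t) ((F \o chart_inv c) @^-1` A).
  by apply: cF; rewrite /= chart_mapK.
move/(near_chart ac Dt); apply: filterS => s [Ds]; by rewrite /= chart_mapK.
Qed.

Lemma smooth_map_wmul n (N : matnorm R n) W (F G : U -> wiener N) : open W ->
  smooth_map atlas W F -> smooth_map atlas W G ->
  smooth_map atlas W (fun t => wmul (F t) (G t)).
Proof.
move=> oW sF sG c ac k.
exact: Ck_wmul (chart_image_open ac oW) (sF c ac k) (sG c ac k).
Qed.

Lemma smooth_map_cst E W (a : E) : open W -> smooth_map atlas W (fun=> a).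
Proof. move=> oW c ac k; exact: Ck_cst (chart_image_open ac oW). Qed.

Lemma smooth_map_winv n (N : matnorm R n) W (F : U -> wiener N) : open W ->
  (forall t, W t -> wmul (F t) (winv (F t)) = wone N /\ wmul (winv (F t)) (F t) = wone N) ->
  smooth_map atlas W F -> smooth_map atlas W (fun t => winv (F t)).
Proof.
move=> oW FV sF c ac k; apply: Ck_winv (chart_image_open ac oW) _ (sF c ac k).
by move=> x /(chart_invK ac)[Wx _ _]; exact: FV.
Qed.

Lemma smooth_map_analytic E E' W (D : set E) (g : E -> E') (F : U -> E) : open W ->
  analytic_on D g -> (forall t, W t -> D (F t)) -> smooth_map atlas W F ->
  smooth_map atlas W (g \o F).
Proof.
move=> oW ag FD sF c ac k.
apply: (analytic_on_comp_Ck (chart_image_open ac oW) ag _ (sF c ac k)).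
by move=> x /(chart_invK ac)[Wx _ _]; exact: FD.
Qed.

Lemma smooth_map_linear E E' W (L : {linear E -> E'}) (F : U -> E) : open W ->
  continuous L -> smooth_map atlas W F -> smooth_map atlas W (L \o F).
Proof.
move=> oW cL sF c ac k; exact: Ck_linear (chart_image_open ac oW) cL (sF c ac k).
Qed.

Lemma smooth_map_fst E E' W (F : U -> E * E') : open W ->
  smooth_map atlas W F -> smooth_map atlas W (fun t => (F t).1).
Proof.
move=> oW; have lf : linear (fst : E * E' -> E) by [].
pose L : {linear (E * E')%type -> E} := HB.pack (fst : E * E' -> E) (GRing.isLinear.Build _ _ _ _ _ lf).
by apply: (@smooth_map_linear _ _ _ L) => // x; exact: cvg_fst.
Qed.

Lemma smooth_map_snd E E' W (F : U -> E * E') : open W ->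
  smooth_map atlas W F -> smooth_map atlas W (fun t => (F t).2).
Proof.
move=> oW; have lf : linear (snd : E * E' -> E') by [].
pose L : {linear (E * E')%type -> E'} := HB.pack (snd : E * E' -> E') (GRing.isLinear.Build _ _ _ _ _ lf).
by apply: (@smooth_map_linear _ _ _ L) => // x; exact: cvg_snd.
Qed.

(** In a chart, a segment joins t to each nearby point, and its image under F is a connected subset
    of [K] through the identity. *)
Lemma near_id_component n (N : matnorm R n) (K : set (wiener N)) W (F : U -> wiener N) t :
  open W -> W t -> smooth_map atlas W F -> (forall s, W s -> K (F s)) ->
  F t = wone N -> \forall s \near t, id_component K (F s).
Proof.
move=> oW Wt sF KF Ft; have [_ _ _ /(_ t)[c ac Dt] _] := hU.
have oI := chart_image_open ac oW.
have Ix : chart_image c W (chart_map c t) by exists t.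
have [r /= r0 Ir] := (nbhs_ballP _ _).1 (open_nbhs_nbhs (conj oI Ix)).
have : nbhs (chart_map c t) (ball (chart_map c t) r) by exact: nbhsx_ballx.
move/(near_chart ac Dt); apply: filterS => s [Ds].
set x := chart_map c t in Ix Ir *; set y := chart_map c s => xy.
pose g (u : R) := F (chart_inv c (x + u *: (y - x))).
have gI u : u \in `[0, 1] -> chart_image c W (x + u *: (y - x)).
  rewrite in_itv /= => /andP[u0 u1]; apply: Ir.
  rewrite -ball_normE /ball_ /= opprD addrA subrr sub0r normrN normrZ ger0_norm//.
  move: xy; rewrite -ball_normE /ball_ /= distrC; apply: le_lt_trans.
  by rewrite ler_piMl.
exists (g @` `[0, 1]); last first.
  exists 1; first by rewrite /= in_itv /= ler01 lexx.
  by rewrite /g scale1r addrC subrK chart_mapK.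
split.
- exists 0; first by rewrite /= in_itv /= ler01 lexx.
  by rewrite /g scale0r addr0 chart_mapK.
- move=> _ [u /= uI <-]; apply: KF; by have [] := chart_invK ac (gI u uI).
apply: connected_continuous_connected; first exact: segment_connected.
apply: continuous_in_subspaceT => u; rewrite inE => /= uI.
have -> : g = (F \o chart_inv c) \o (fun u => x + u *: (y - x)) by [].
apply: continuous_comp.
  by apply: cvgD; [exact: cvg_cst|apply: cvgZr_tmp; exact: cvg_id].
exact: (sF c ac 0 _ (gI u uI)).
Qed.

End Manifold.

#[local] Opaque diff wmul wnorm wone winv.

Lemma near_open (T : topologicalType) (P : set T) t : (\forall s \near t, P s) ->
  exists2 W, open W /\ W t & W `<=` P.
Proof. by rewrite -nbhs_nearE nbhsE. Qed.

(** * Local lifts to the fixed subgroup *)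

Section Lifts.
Context (R : realType) (n : nat) (N : matnorm R n) (G : set 'M[Cx R]_n).
Hypothesis hG : connected_complex_semisimple_group G.
Context (H : set (wiener N)) (hH : birkhoff_subgroup G H).
Context (tau : wiener N -> wiener N) (htau : involution_second_kind G H tau).
Implicit Types (x y h k p q m : wiener N).

Let Hp := id_component (H `&` LambdaP1 G).
Let Hm := id_component (H `&` LambdaM1 G).
Let Ho := id_component (const_part G H).

Lemma birkhoff_LambdaG : H `<=` LambdaG G.
Proof. by have [[]] := hH. Qed.

Lemma birkhoff_group : subgroup H.
Proof. by have [[]] := hH. Qed.

Let HG := birkhoff_LambdaG.
Let sH := birkhoff_group.

Lemma tau_one : tau (wone N) = wone N.
Proof.
have [H1 _ _] := sH; have Ht1 := tau_H htau H1.
have [_ _ tV] := subgroup_winv sH Ht1.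
have TT : wmul (tau (wone N)) (tau (wone N)) = tau (wone N).
  by rewrite -(tauM htau H1 H1) wmul1.
move: (tau (wone N)) tV TT => T TV TT.
by rewrite -[LHS]wmul1l -[X in wmul X _]TV -wmulA TT.
Qed.

Lemma tau_winv x : H x -> tau (winv x) = winv (tau x).
Proof.
move=> Hx; have [Hx' xx' x'x] := subgroup_winv sH Hx.
by apply/esym/winvE; rewrite -(tauM htau)// ?xx' ?x'x tau_one.
Qed.

Lemma tau_analytic : analytic_on H tau.
Proof. by have [[_ _ [_ h _]] _] := tau_loop_automorphism htau. Qed.

(** tau is continuous and fixes the identity, so the exchange of [tau_swap] respects identity
    components, which are the factors in the definition of decomposability. *)
Lemma tau_components x : [/\ Hp x -> Hm (tau x), Hm x -> Hp (tau x) & Ho x -> Ho (tau x)].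
Proof.
have ct := analytic_on_continuous tau_analytic.
have cW K : K `<=` H -> {within K, continuous tau}.
  by move=> KH; apply: continuous_subspaceW ct.
split; apply: (id_component_map tau_one).
- by move=> y [Hy yP]; have [_ _ _ h] := tau_swap hG htau HG Hy; split; [exact: (tau_H htau Hy)|exact: h].
- by apply: cW => y [].
- by move=> y [Hy yM]; have [_ _ h _] := tau_swap hG htau HG Hy; split; [exact: (tau_H htau Hy)|exact: h].
- by apply: cW => y [].
- move=> y [[Hy yP] yM]; have [h h' _ _] := tau_swap hG htau HG Hy.
  by split; [split; [exact: (tau_H htau Hy)|exact: h]|exact: h'].
- by apply: cW => y [[]].
Qed.

Lemma birkhoff_parts x :
  [/\ Hp x -> H x, Hm x -> H x /\ minus_part G H x & Ho x -> H x /\ const_part G H x].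
Proof.
split=> /id_component_sub => [[]//|[Hx [Gx [h xh _]]]|[[Hx xP] xM]]; split=> //.
by split=> //; split=> //; exists h.
Qed.

Lemma birkhoff_sub : [/\ subgroup Hp, subgroup Hm & subgroup Ho].
Proof.
move: hH => [_ [_ s1 _ _] [_ s2 _ _] [_ s3 _ _] _].
split; [exact: s1|exact: s2|exact: s3].
Qed.

(* Applying tau to P = p q m exchanges the two Birkhoff factorisations. *)
Lemma birkhoff_symmetric p q m : Hp p -> Ho q -> Hm m ->
  tau (wmul3 (p, q, m)) = winv (wmul3 (p, q, m)) ->
  tau m = winv p /\ tau q = winv q.
Proof.
move=> pp qo mm; have [sp sm so] := birkhoff_sub.
have [hp _ _] := birkhoff_parts p; have [_ hm _] := birkhoff_parts m.
have [_ _ ho] := birkhoff_parts q.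
have {hp}Hp' := hp pp; have {hm}[Hm' _] := hm mm; have {ho}[Ho' _] := ho qo.
have [_ HM _] := sH; have Hpq := HM _ _ Hp' Ho'.
have [vp v1 v1'] := subgroup_winv sp pp; have [vo v2 v2'] := subgroup_winv so qo.
have [vm v3 v3'] := subgroup_winv sm mm.
have [_ v4 v4'] := subgroup_winv sH Hpq.
rewrite /wmul3 /= !(tauM htau)// (winvM v4 v4' v3 v3') (winvM v1 v1' v2 v2') wmulA.
have [_ _ _ _ [_ _ _ [_ _ [f' fK _]]]] := hH.
have [tp _ _] := tau_components p; have [_ tm _] := tau_components m.
have [_ _ to] := tau_components q.
have D1 : (Hm `*` Ho `*` Hp) (tau p, tau q, tau m).
  by split; [split; [exact: tp|exact: to]|exact: tm].
have D2 : (Hm `*` Ho `*` Hp) (winv m, winv q, winv p) by split; [split|].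
move=> E; have : wmul3 (tau p, tau q, tau m) = wmul3 (winv m, winv q, winv p) by [].
move/(congr1 f'); rewrite !fK ?inE//; by move=> [_ -> ->].
Qed.

Lemma norm_one : `|wone N| = 1.
Proof. by rewrite wone_mono -[LHS]/(wnorm (mono N 1%:M 0)) wnorm_mono mnorm1. Qed.

(** Both tau(k) and k^-1 are square roots of q^-1 near the identity: a^2 = b^2 gives a a + a b = a b
    + b b, and [sylvester_inj] yields a = b. The bound 1 / 8 on k puts its inverse within 1 / 4. *)
Lemma tau_sqrt k q : H k -> wmul k k = q -> tau q = winv q ->
  `|k - wone N| <= 1 / 8 -> `|tau k - wone N| <= 1 / 4 -> tau k = winv k.
Proof.
move=> Hk kk tq k8 tk4; have [Hk' kk' k'k] := subgroup_winv sH Hk.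
have k4 : `|winv k - wone N| <= 1 / 4.
  have := @inverse_near _ _ _ (wone N) k (wone N) (winv k).
  rewrite norm_one expr1n mulr1 mul1r => /(_ (wmul1 _) kk').
  move: `|_| `|k - _| k8 => u v k8 h; have h8 : v <= 1 / 2 by lra.
  by apply: (le_trans (h h8)); lra.
apply: (sylvester_inj tk4 k4); rewrite -(tauM htau)// kk tq -kk (winvM kk' k'k kk' k'k).
by rewrite addrC.
Qed.

Section LocalLift.
Context (U : topologicalType) (d : nat) (atlas : set (chart R U d)).
Hypothesis hU : smooth_manifold atlas.
Hypothesis sHm : subgroup (minus_part G H).

Lemma smooth_sqrt W (k q : U -> wiener N) : open W ->
  (forall t, W t -> [/\ const_loop (k t), const_loop (q t), wmul (k t) (k t) = q t &
     `|k t - wone N| <= 1 / 4]) ->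
  smooth_map atlas W q -> smooth_map atlas W k.
Proof.
move=> oW hk sq c ac l; apply: (Ck_sqrt (chart_image_open hU ac oW) _ _ _ (sq c ac l)).
- by move=> x /(chart_invK hU ac)[/hk[]].
- by move=> x /(chart_invK hU ac)[/hk[]].
- by move=> x /(chart_invK hU ac)[/hk[]].
Qed.

(** The big cell is open in the identity component only, so P must be kept there, by
    [near_id_component], as well as in the open set [Q]. The factors are smooth because inverse
    multiplication is analytic. *)
Lemma local_splitting (P : U -> wiener N) t1 : smooth_map atlas setT P ->
  (forall t, H (P t)) -> P t1 = wone N -> forall e : R, 0 < e ->
  exists W (p q m : U -> wiener N), [/\ open W /\ W t1,
    smooth_map atlas W q /\ smooth_map atlas W m &
    forall t, W t -> [/\ Hp (p t), Ho (q t), Hm (m t), P t = wmul3 (p t, q t, m t) &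
      `|q t - wone N| < e]].
Proof.
move=> sP HP P1 e e0; have [_ _ _ _ [[[Q oQ RBE] _] _ [_ _ [f' fK af]] _]] := hH.
have one K : subgroup K -> K (wone N) by case.
have [/one p1 /one m1 /one o1] := birkhoff_sub.
have one3 : wmul3 (wone N, wone N, wone N) = wone N by rewrite /wmul3 /= !wmul1.
have D1 : (Hp `*` Ho `*` Hm) (wone N, wone N, wone N).
  by split; [split; [exact: p1|exact: o1]|exact: m1].
have RB1 : (@wmul3 _ _ N @` (Hp `*` Ho `*` Hm)) (wone N).
  by exists (wone N, wone N, wone N); [exact: D1|exact: one3].
have Q1 : Q (wone N) by move: RB1; rewrite RBE => -[].
have nQ : \forall t \near t1, Q (P t).
  apply: (smooth_map_continuous hU sP I); rewrite P1; exact: open_nbhs_nbhs.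
have nI := near_id_component hU openT I sP (fun t _ => HP t) P1.
have [W1 [oW1 W1t] W1P] := near_open (filterI nQ nI).
pose T t := f' (P t).
have TP t : W1 t -> (Hp `*` Ho `*` Hm) (T t) /\ P t = wmul3 (T t).
  move=> /W1P[OP IP]; have : (H `&` Q) (P t) by [].
  have : (id_component H `&` Q) (P t) by [].
  rewrite -RBE => -[u Du uP] _; have Tu : T t = u by rewrite /T -uP fK ?inE.
  by rewrite Tu uP.
have T1 : T t1 = (wone N, wone N, wone N).
  by have := fK _ (mem_set D1); rewrite one3 /T P1.
have sT : smooth_map atlas W1 T.
  apply: (smooth_map_analytic hU oW1 af); last exact: smooth_map_sub sP.
  by move=> t /W1P[OP IP]; rewrite RBE.
have sq := smooth_map_snd hU oW1 (smooth_map_fst hU oW1 sT).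
have nq : \forall t \near t1, `|(T t).1.2 - wone N| < e.
  have cq := smooth_map_continuous hU sq W1t.
  move/cvgrPdist_lt : cq => /(_ e e0); apply: filterS => t.
  by rewrite T1 /= distrC.
have [W [oW Wt] WP] := near_open (filterI (open_nbhs_nbhs (conj oW1 W1t)) nq).
have sW : W `<=` W1 by move=> t /WP[].
exists W, (fun t => (T t).1.1), (fun t => (T t).1.2), (fun t => (T t).2); split=> //.
  split; first exact: smooth_map_sub sq.
  exact: smooth_map_sub sW (smooth_map_snd hU oW1 sT).
move=> t Wt'; have [/TP[[[pT oT] mT] PT] qe] := WP t Wt'.
by split=> //; rewrite PT; case: (T t) => [[]].
Qed.

Lemma lift_exists (Fp : U -> wiener N) t1 : smooth_maps atlas H setT Fp ->
  iwasawa_cell G tau H (Fp t1) ->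
  exists W F, [/\ open W, W t1, smooth_map atlas W F & forall t, W t ->
    fixed_part tau H (F t) /\ exists2 h, minus_part G H h & F t = wmul (Fp t) h].
Proof.
move=> [HF sF] [[f1 h1] [/= [Hf1 tf1] Mh1] E1]; have [_ HM _] := sH.
have [Mi1 hV hV'] := subgroup_winv sHm Mh1; set hi := winv h1 in Mi1 hV hV'.
(* At [t1] this is [f1], which tau fixes, so that P starts at the identity. *)
pose K t := wmul (Fp t) hi.
have HK t : H (K t) by apply: HM; [exact: HF|case: Mi1].
have K1 : K t1 = f1 by rewrite /K -E1 -wmulA hV wmul1.
have sK : smooth_map atlas setT K.
  exact: (smooth_map_wmul (G := fun=> hi) hU openT sF (smooth_map_cst hU hi openT)).
have sTK : smooth_map atlas setT (tau \o K).
  by apply: (smooth_map_analytic hU openT tau_analytic) sK.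
have HTK t : H (tau (K t)) by exact: (tau_H htau (HK t)).
have VT t := subgroup_winv sH (HTK t).
have VK t := subgroup_winv sH (HK t).
pose P t := wmul (winv (tau (K t))) (K t).
have sP : smooth_map atlas setT P.
  apply: (smooth_map_wmul (F := fun t => winv (tau (K t))) hU openT _ sK).
  apply: (smooth_map_winv (F := tau \o K) hU openT _ sTK).
  by move=> t _; have [] := VT t.
have HP t : H (P t) by apply: HM => //; have [] := VT t.
have P1 : P t1 = wone N by rewrite /P K1 tf1; have [] := subgroup_winv sH Hf1.
have tP t : tau (P t) = winv (P t).
  have [HTV v1 v1'] := VT t; have [HKV v2 v2'] := VK t.
  have [_ v3 v3'] := subgroup_winv sH HTV.
  rewrite /P (tauM htau)// tau_winv// (tauK htau)//.
  by rewrite (winvM v3 v3' v2 v2') (winvK v1 v1').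
have [H1 _ _] := sH.
have [d1 d10 td] : exists2 d1 : R, 0 < d1 & forall x, H x -> `|x - wone N| < d1 ->
    `|tau x - wone N| <= 1 / 4.
  have /subspace_continuousP/(_ _ H1) := analytic_on_continuous tau_analytic.
  rewrite -[X in X -> _]/(tau y @[y --> within H (nbhs (wone N))] --> tau (wone N)).
  move/cvgrPdist_le => /(_ (1 / 4) (divr_gt0 ltr01 (ltr0n _ 4))).
  rewrite near_withinE => /nbhs_ballP[r /= r0 Hr]; exists r => // x Hx xr.
  rewrite distrC -{1}tau_one; apply: Hr => //.
  by rewrite -ball_normE /ball_ /= distrC.
(* [1 / 8] is the radius required by [tau_sqrt]; [d1] keeps [tau k] within [1 / 4] of the
   identity. *)
pose e1 : R := Num.min (1 / 8) (d1 / 2).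
have e10 : 0 < e1 by rewrite lt_min !divr_gt0.
have [mG _ _] := hG; have [bH _ _ _ _] := hH.
have [d2 d20 Hsq] := const_sqrt mG bH e10.
have [W [p [q [m [[oW Wt1] [sq sm] HW]]]]] := local_splitting sP HP P1 d20.
(* The roots are chosen point by point, with a dummy value outside [W]; [smooth_sqrt] makes the
   choice smooth. *)
have /choice[k Hk] : forall t, exists k, W t ->
    [/\ const_part G H k, wmul k k = q t & `|k - wone N| <= e1].
  move=> t; have [Wt|nWt] := pselect (W t); last by exists (wone N).
  have [_ qo _ _ qe] := HW t Wt.
  have [_ _ h] := birkhoff_parts (q t); have [_ cq] := h qo.
  by have [k hk] := Hsq _ cq qe; exists k.
have sk : smooth_map atlas W k.
  apply: smooth_sqrt oW _ sq => t Wt; have [kc kk ke] := Hk t Wt.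
  have [_ qo _ _ _] := HW t Wt; have [_ _ h] := birkhoff_parts (q t).
  have [_ /(const_partP _ HG)[_ cq]] := h qo.
  have /(const_partP _ HG)[_ ck] := kc; split=> //.
  apply: (le_trans ke); rewrite ge_min; apply/orP; left; lra.
pose h t := wmul (k t) (m t).
have hprop t : W t -> [/\ H (k t), H (m t), minus_part G H (h t) & tau (h t) = winv (wmul (p t) (k t))].
  move=> Wt; have [kc kk ke] := Hk t Wt; have [pp qo mm PE _] := HW t Wt.
  have [_ hm _] := birkhoff_parts (m t); have [Hmt Mm] := hm mm.
  have [hp _ _] := birkhoff_parts (p t); have Hpt := hp pp.
  have [[Hkt _] Mk] := kc; have [_ MM _] := sHm.
  split=> //; first exact: MM.
  have := tP t; rewrite PE => /(birkhoff_symmetric pp qo mm)[tm tq].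
  have tk : tau (k t) = winv (k t).
    apply: (tau_sqrt Hkt kk tq); first by rewrite (le_trans ke)// ge_min lexx.
    apply: td => //; apply: (le_lt_trans ke).
    by rewrite gt_min orbC ltr_pdivrMr// ltr_pMr// ltr1n.
  have [_ v1 v1'] := subgroup_winv sH Hpt; have [_ v2 v2'] := subgroup_winv sH Hkt.
  by rewrite /h (tauM htau)// tk tm (winvM v1 v1' v2 v2').
have sh : smooth_map atlas W h by exact: (smooth_map_wmul (F := k) (G := m) hU oW sk sm).
exists W, (fun t => wmul (K t) (winv (h t))); split=> //.
  apply: (smooth_map_wmul (F := K) (G := fun t => winv (h t)) hU oW); first exact: smooth_map_sub sK.
  apply: (smooth_map_winv (F := h) hU oW _ sh) => t /hprop[_ _ /(subgroup_winv sHm)[_ a b] _].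
  by split.
move=> t Wt; have [Hkt Hmt Mh th] := hprop t Wt.
have [Mhi v1 v1'] := subgroup_winv sHm Mh; have [Hht _] := Mh; have [Hhi _] := Mhi.
split; last first.
  exists (wmul hi (winv (h t))); last by rewrite /K wmulA.
  by have [_ MM _] := sHm; exact: MM.
split; first exact: HM.
have [pp qo mm PE _] := HW t Wt; have [kc kk _] := Hk t Wt.
have [hp _ _] := birkhoff_parts (p t); have Hpt := hp pp.
have [_ w1 w1'] := subgroup_winv sH (HM _ _ Hpt Hkt).
have [_ u1 u1'] := VT t.
(* P = p k k m = (p k) h. Since tau(h)^-1 = p k, this gives tau(K h^-1) = tau(K) p k = K h^-1. *)
have KE : K t = wmul (wmul (tau (K t)) (wmul (p t) (k t))) (h t).
  rewrite /h -wmulA [X in wmul _ X](_ : _ = P t).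
    by rewrite /P wmulA u1 wmul1l.
  by rewrite PE /wmul3 /= -kk !wmulA.
rewrite /= (tauM htau)// tau_winv// th (winvK w1 w1').
by rewrite [in RHS]KE -[RHS]wmulA v1 wmul1.
Qed.

End LocalLift.
End Lifts.

#[local] Opaque diff wmul wnorm wone winv.

(** * Fourier support of Maurer-Cartan forms *)

Section ConnectionOrders.
Context (R : realType) (n : nat) (N : matnorm R n) (G : set 'M[Cx R]_n).
Implicit Types (x y p m X Y : wiener N).

Lemma coef_wmul x y (a b i : int) : (forall k, a < k -> x k = 0) ->
  (forall k, b < k -> y k = 0) -> a + b < i -> wmul x y i = 0.
Proof.
move=> xa yb abi; rewrite -[LHS]/(zsum (fun l => x l *m y (i - l))).
have Z l : x l *m y (i - l) = 0.
  have [al|la] := ltP a l; first by rewrite xa// mul0mx.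
  by rewrite (yb (i - l)) ?mulmx0// ltrBrDl (le_lt_trans _ abi)// lerD2r.
by rewrite (@zsum_single _ _ N _ 0) => [|l _]; exact: Z.
Qed.

Lemma minus_coef (H : set (wiener N)) x (k : int) : minus_part G H x -> 0 < k -> x k = 0.
Proof. by case: k => // k [_ xM] k0; exact: (LambdaM_coef xM). Qed.

(** The gauge formula: for F = p m the form is m^-1 (p^-1 dp) m + m^-1 dm. Conjugation by loops
    without positive coefficients cannot raise the top degree, and the second term has degree at
    most 0 < b. *)
Lemma coef_gauge p p' m m' X Y (b i : int) : 0 < b -> wmul p' p = wone N ->
  (forall k : int, 0 < k -> m k = 0) -> (forall k : int, 0 < k -> m' k = 0) ->
  (forall k : int, 0 < k -> Y k = 0) -> (forall k : int, b < k -> wmul p' X k = 0) ->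
  b < i -> wmul (wmul m' p') (wmul X m + wmul p Y) i = 0.
Proof.
move=> b0 p'p hm hm' hY hX bi.
have -> : wmul (wmul m' p') (wmul X m + wmul p Y) =
    wmul m' (wmul (wmul p' X) m) + wmul m' Y.
  rewrite wmulDr -!wmulA; congr (_ + wmul _ _).
  by rewrite wmulA p'p wmul1l.
rewrite -[LHS]/(wmul m' (wmul (wmul p' X) m) i + wmul m' Y i).
rewrite (coef_wmul (a := 0) (b := b) hm') ?add0r//.
  by rewrite (coef_wmul (a := 0) (b := 0) hm' hY)// addr0 (lt_trans b0).
by move=> k bk; rewrite (coef_wmul (a := b) (b := 0) hX hm)// addr0.
Qed.

Section Charts.
Hypothesis hG : connected_complex_semisimple_group G.
Context (H : set (wiener N)) (sH : subgroup H) (HG : H `<=` LambdaG G).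
Context (tau : wiener N -> wiener N) (htau : involution_second_kind G H tau).
Context (sHm : subgroup (minus_part G H)).
Context (U : topologicalType) (d : nat) (atlas : set (chart R U d)).
Hypothesis hU : smooth_manifold atlas.
Context (W : set U) (oW : open W) (c : chart R U d) (ac : atlas c).
Context (z v : 'rV[R]_d) (Wz : chart_image c W z).

Let smooth_diff (F : U -> wiener N) (y : 'rV[R]_d) : smooth_map atlas W F -> chart_image c W y ->
  differentiable (F \o chart_inv c) y.
Proof. by move=> sF Wy; have [df _] := sF c ac 1; exact: df. Qed.

Lemma maurer_cartan_above (F Fp Fm : U -> wiener N) (b : int) : 0 < b ->
  (forall t, W t -> H (Fp t)) -> smooth_map atlas W Fp ->
  (forall t, W t -> minus_part G H (Fm t)) -> smooth_map atlas W Fm ->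
  (forall t, W t -> F t = wmul (Fp t) (Fm t)) ->
  (forall i, b < i -> maurer_cartan Fp c z v i = 0) ->
  forall i, b < i -> maurer_cartan F c z v i = 0.
Proof.
move=> b0 HFp sFp HFm sFm FE Hb i bi.
have oI := chart_image_open hU ac oW.
have [Wt _ _] := chart_invK hU ac Wz; set t := chart_inv c z in Wt.
have [Hpi p1 p2] := subgroup_winv sH (HFp t Wt).
have [Mmi m1 m2] := subgroup_winv sHm (HFm t Wt).
have dp := smooth_diff sFp Wz; have dm := smooth_diff sFm Wz.
have [dw dwE] := diff_wmul dp dm.
have nE : \forall y \near z, wmul ((Fp \o chart_inv c) y) ((Fm \o chart_inv c) y) =
    (F \o chart_inv c) y.
  apply: filterS (open_nbhs_nbhs (conj oI Wz)) => y Wy.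
  by have [Wy' _ _] := chart_invK hU ac Wy; rewrite /= FE.
have [_ dE] := near_diff nE dw.
have dEv := congr1 (@^~ v) (etrans dE dwE); rewrite /= -/t in dEv.
have -> : maurer_cartan F c z v = wmul (wmul (winv (Fm t)) (winv (Fp t)))
    (wmul ('d (Fp \o chart_inv c) z v) (Fm t) + wmul (Fp t) ('d (Fm \o chart_inv c) z v)).
  apply: (congr2 (@wmul _ _ N) _ dEv).
  by rewrite -(winvM p1 p2 m1 m2) -FE.
apply: (coef_gauge b0 p2 _ _ _ Hb bi) => k k0.
- exact: (minus_coef (HFm t Wt) k0).
- exact: (minus_coef Mmi k0).
apply: diff_coef0 dm; apply: filterS (open_nbhs_nbhs (conj oI Wz)) => y Wy.
by have [Wy' _ _] := chart_invK hU ac Wy; exact: (minus_coef (HFm _ Wy') k0).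
Qed.

(** The loops F(z)^-1 F(z + s v) belong to the fixed subgroup, and their difference quotients at the
    identity tend to the Maurer-Cartan form. *)
Lemma maurer_cartan_reflect (F : U -> wiener N) (k : nat) :
  subgroup (fixed_part tau H) -> (forall t, W t -> fixed_part tau H (F t)) ->
  smooth_map atlas W F ->
  maurer_cartan F c z v k%:Z = 0 -> maurer_cartan F c z v (- k%:Z) = 0.
Proof.
move=> sHt HF sF; apply: (fixed_tangent_reflect hG htau HG) => e e0.
have oI := chart_image_open hU ac oW.
have [Wt _ _] := chart_invK hU ac Wz; set t := chart_inv c z in Wt.
have [[HFi _] f1 f2] := subgroup_winv sHt (HF t Wt).
have [_ MT _] := sHt.
pose K := `|winv (F t)| + 1; have K0 : 0 < K by rewrite ltr_wpDl.
have [d1 d10 Hd] := diff_quot v (smooth_diff sF Wz) (divr_gt0 e0 K0).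
have [r /= r0 Hr] := (nbhs_ballP _ _).1 (open_nbhs_nbhs (conj oI Wz)).
pose s := Num.min (e / 2) (Num.min (d1 / 2) (r / (`|v| + 1) / 2)).
have v1 : 0 < `|v| + 1 by rewrite ltr_wpDl.
have s0 : 0 < s by rewrite !lt_min !divr_gt0.
have se : s < e by rewrite gt_min ltr_pdivrMr// ltr_pMr// ltr1n.
have sd : s < d1.
  by rewrite !gt_min [X in _ || (X || _)]ltr_pdivrMr// ltr_pMr// ltr1n orbT.
have sr : `|s *: v| < r.
  rewrite normrZ gtr0_norm// (@le_lt_trans _ _ (s * (`|v| + 1)))//.
    by rewrite ler_wpM2l ?(ltW s0)// lerDl.
  rewrite -ltr_pdivlMr// !gt_min [X in _ || (_ || X)]ltr_pdivrMr//.
  by rewrite ltr_pMr ?divr_gt0// ltr1n !orbT.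
have Wzs : chart_image c W (z + s *: v).
  by apply: Hr; rewrite -ball_normE /ball_ /= opprD addrA subrr sub0r normrN.
have [Wts _ _] := chart_invK hU ac Wzs.
have [HF2 tF2] : fixed_part tau H (wmul (winv (F t)) (F (chart_inv c (z + s *: v)))).
  by apply: MT; [have [] := subgroup_winv sHt (HF t Wt)|exact: HF].
exists s, (wmul (winv (F t)) (F (chart_inv c (z + s *: v)))); split=> //.
  by rewrite s0.
have := Hd s; rewrite s0 sd => /(_ isT); rewrite /maurer_cartan /= -/t.
move: ('d _ z v) (F (chart_inv c (z + s *: v))) => X Y.
have -> : s^-1 *: (wmul (winv (F t)) Y - wone N) - wmul (winv (F t)) X =
    wmul (winv (F t)) (s^-1 *: (Y - F t) - X).
  by rewrite wmulBr wmulZr wmulBr f2.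
move=> h; apply: le_lt_trans (normM _ _) _; move: h.
rewrite ltr_pdivlMr// mulrC; apply: le_lt_trans.
by rewrite ler_wpM2r// lerDl.
Qed.

End Charts.
End ConnectionOrders.

#[local] Opaque diff wmul wnorm wone winv.

(** * The coset map and its frames *)

Section Cosets.
Context (R : realType) (n : nat) (N : matnorm R n) (G : set 'M[Cx R]_n).
Hypothesis hG : connected_complex_semisimple_group G.
Context (H : set (wiener N)) (hH : birkhoff_subgroup G H).
Context (tau : wiener N -> wiener N) (htau : involution_second_kind G H tau).
Hypothesis sHm : subgroup (minus_part G H).
Hypothesis sHt : subgroup (fixed_part tau H).
Hypothesis sHto : subgroup (const_part G (fixed_part tau H)).
Context (U : topologicalType) (d : nat) (atlas : set (chart R U d)).
Hypothesis hU : smooth_manifold atlas.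
Context (b : \bar int) (hb : (0 < b)%E) (Fp : U -> wiener N).
Hypothesis hFp : smooth_maps_order atlas H -oo%E b setT Fp.
Hypothesis hFpB : forall t, iwasawa_cell G tau H (Fp t).
Implicit Types (W : set U) (F : U -> wiener N) (t : U).

Let Ht := fixed_part tau H.
Let Hto := const_part G Ht.
Let HG : H `<=` LambdaG G := birkhoff_LambdaG hH.
Let sH : subgroup H := birkhoff_group hH.

Definition frame_coset t : set (wiener N) :=
  [set f | Ht f /\ exists2 h, minus_part G H h & f = wmul (Fp t) h].

Let HFp t : H (Fp t).
Proof. by have [[h _] _] := hFp; exact: h. Qed.

Let sFp : smooth_map atlas setT Fp.
Proof. by have [[_ h] _] := hFp. Qed.

Lemma fixed_minus_const x : Ht x -> minus_part G H x -> Hto x.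
Proof.
move=> [Hx tx] [_ Mx]; have [h _ _ _] := tau_swap hG htau HG Hx.
by have := h Mx; rewrite tx => Px; split.
Qed.

Lemma const_minus x : Hto x -> minus_part G H x.
Proof. by move=> [[[Hx _] _] Mx]; split. Qed.

Lemma frame_cosetE t f : frame_coset t f -> frame_coset t = lcoset f Hto.
Proof.
move=> [Hf [h Mh fE]]; have [Hfi f1 f2] := subgroup_winv sHt Hf.
have [Mhi h1 h2] := subgroup_winv sHm Mh; have [_ p1 p2] := subgroup_winv sH (HFp t).
have [_ Mt _] := sHt; have [_ Mm _] := sHm.
apply/seteqP; split=> [f' [Hf' [h' Mh' fE']]|_ [k Hk <-]].
  have kE : wmul (winv f) f' = wmul (winv h) h'.
    by rewrite fE' fE (winvM p1 p2 h1 h2) -wmulA [wmul (winv (Fp t)) _]wmulA p2 wmul1l.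
  exists (wmul (winv f) f'); last by rewrite wmulA f1 wmul1l.
  apply: fixed_minus_const; first exact: Mt.
  by rewrite kE; exact: Mm.
have [[Hk' _] _] := Hk; split; first exact: Mt.
exists (wmul h k); last by rewrite fE wmulA.
apply: Mm => //; exact: const_minus.
Qed.

Lemma frame_coset_lcoset t x : frame_coset t = lcoset x Hto -> frame_coset t x.
Proof. by move=> ->; exists (wone N); [case: sHto|rewrite wmul1]. Qed.

Lemma frame_split t f : frame_coset t f ->
  [/\ minus_part G H (wmul (winv (Fp t)) f), f = wmul (Fp t) (wmul (winv (Fp t)) f) &
      f = wmul (tau (Fp t)) (tau (wmul (winv (Fp t)) f))].
Proof.
move=> [[Hf tf] [h Mh fE]]; have [Hi p1 p2] := subgroup_winv sH (HFp t).
have hE : wmul (winv (Fp t)) f = h by rewrite fE wmulA p2 wmul1l.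
rewrite hE; split=> //.
by rewrite -(tauM htau) -?fE ?tf//; case: Mh.
Qed.

Lemma frame_split_smooth W F : open W -> smooth_map atlas W F ->
  smooth_map atlas W (fun t => wmul (winv (Fp t)) (F t)).
Proof.
move=> oW sF; apply: (smooth_map_wmul (F := fun t => winv (Fp t)) hU oW _ sF).
apply: (smooth_map_winv (F := Fp) hU oW); last exact: smooth_map_sub sFp.
by move=> t _; have [_ p1 p2] := subgroup_winv sH (HFp t).
Qed.

Lemma frame_order W F : open W -> smooth_map atlas W F ->
  (forall t, W t -> frame_coset t (F t)) -> connection_order atlas (- b)%E b W F.
Proof.
move=> oW sF PF c x v i ac Wx.
have HF t : W t -> Ht (F t) by move=> /PF[].
(* There is no such index when [b] is infinite. *)
have above k : (b < k%:E)%E -> maurer_cartan F c x v k = 0.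
  move=> bk; case: b hb hFp bk => [b0||]// b00 [_ oFp] bk.
  apply: (maurer_cartan_above sH sHm hU oW ac Wx (b := b0) (Fp := Fp)
    (Fm := fun t => wmul (winv (Fp t)) (F t))) => //.
  - exact: smooth_map_sub sFp.
  - by move=> t /PF/frame_split[].
  - exact: frame_split_smooth.
  - by move=> t /PF/frame_split[].
  move=> l bl; apply: oFp => //.
    by have [_ Dx xE] := chart_invK hU ac Wx; exists (chart_inv c x).
  by rewrite leNye /= -ltNge lte_fin.
rewrite negb_and -!ltNge => /orP[ib|]; last exact: above.
(* As b > 0, an index below -b is negative, and its opposite lies above b, where the coefficient is
   already known to vanish. *)
have [k kE bk] : exists2 k : nat, i = - k%:Z & (b < k%:Z%:E)%E.
  case: b hb ib => [b0||]// b00.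
  rewrite -[(- _)%E]/((- b0)%:E) !lte_fin => ib.
  have i0 : i < 0 by rewrite (lt_trans ib)// oppr_lt0 -lte_fin.
  by exists `|i|%N; rewrite ?lte_fin abszE ltr0_norm// ?opprK// ltrNr.
rewrite kE; apply: (maurer_cartan_reflect hG HG htau hU oW ac Wx sHt HF sF).
exact: above.
Qed.

Lemma frame_lift t : exists W F, [/\ W t, local_lift atlas Ht Hto frame_coset W F &
  forall s, W s -> frame_coset s (F s)].
Proof.
have [[hF _] _] := hFp.
have [W [F [oW Wt sF HF]]] := lift_exists hG hH htau hU sHm (conj hF sFp) (hFpB t).
have PF s : W s -> frame_coset s (F s) by move=> /HF[].
exists W, F; split=> //; split=> //; first by split=> // s /HF[].
by move=> s /PF; exact: frame_cosetE.
Qed.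

End Cosets.

(** [hHm], [hHtau] and [hHtauo] express the convention that the subgroups of the loop group under
    consideration are Banach Lie subgroups. Elements of the quotient are encoded by the cosets
    themselves, so uniqueness is an equality of set-valued maps. *)
Theorem proposition3p4 (R : realType) (n : nat) (N : matnorm R n)
    (G : set 'M[Cx R]_n) (hG : connected_complex_semisimple_group G)
    (H : set (wiener N)) (hH : birkhoff_subgroup G H)
    (tau : wiener N -> wiener N) (htau : involution_second_kind G H tau)
    (hHm : banach_lie_subgroup G (minus_part G H))
    (hHtau : banach_lie_subgroup G (fixed_part tau H))
    (hHtauo : banach_lie_subgroup G (const_part G (fixed_part tau H)))
    (U : topologicalType) (d : nat) (atlas : set (chart R U d))
    (hU : smooth_manifold atlas)
    (b : \bar int) (hb : (0 < b)%E)
    (Fp : U -> wiener N)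
    (hFp : smooth_maps_order atlas H -oo%E b setT Fp)
    (hFpB : forall t, iwasawa_cell G tau H (Fp t)) :
  let Ht := fixed_part tau H in
  let Hto := const_part G Ht in
  let local_frame Phi W F :=
    local_lift atlas Ht Hto Phi W F /\ connection_order atlas (- b)%E b W F in
  let splits W F Fm :=
    smooth_maps atlas (minus_part G H) W Fm /\
    forall t, W t -> F t = wmul (Fp t) (Fm t) /\
                     F t = wmul (tau (Fp t)) (tau (Fm t)) in
  let solution Phi :=
    quotient_maps_order atlas Ht Hto (- b)%E b Phi /\
    (forall W F, local_frame Phi W F -> exists Fm, splits W F Fm) in
  exists Phi : U -> set (wiener N),
    [/\ solution Phi,
        forall Phi', solution Phi' -> Phi' = Phi &
        forall t0, Fp t0 = wone N ->
          forall W F, W t0 -> local_frame Phi W F ->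
          exists F' Fm', [/\ local_frame Phi W F', splits W F' Fm',
                             F' t0 = wone N & Fm' t0 = wone N]].
Proof.
move=> Ht Hto local_frame splits solution.
have [_ sHm _ _] := hHm; have [_ sHt _ _] := hHtau; have [_ sHto _ _] := hHtauo.
pose Phi := frame_coset G H tau Fp.
have PhiE t f : Phi t f -> Phi t = lcoset f Hto.
  exact: (frame_cosetE hG hH htau sHm sHt hFp).
have PhiP t f : Phi t = lcoset f Hto -> Phi t f.
  exact: (frame_coset_lcoset sHto).
have splitP := frame_split hH htau hFp.
have order W F : open W -> smooth_map atlas W F -> (forall t, W t -> Phi t (F t)) ->
    connection_order atlas (- b)%E b W F.
  exact: (frame_order hG hH htau sHm sHt hU hb hFp).
have liftE := frame_lift hG hH htau sHm sHt hU hFp hFpB.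
have splitF W F : open W -> smooth_map atlas W F -> (forall t, W t -> Phi t (F t)) ->
    splits W F (fun t => wmul (winv (Fp t)) (F t)).
  move=> oW sF PF; split; last by move=> t /PF/splitP[].
  split; first by move=> t /PF/splitP[].
  exact: (frame_split_smooth hH hU hFp).
have frameP W F : local_lift atlas Ht Hto Phi W F -> forall t, W t -> Phi t (F t).
  by move=> [_ _ PE] t Wt; apply: PhiP; exact: PE.
exists Phi; split.
- split; first split.
  + move=> t; have [W [F [Wt _ PF]]] := liftE t; exists (F t); first by have [] := PF t Wt.
    exact: PhiE (PF t Wt).
  + by move=> t; have [W [F [Wt lF _]]] := liftE t; exists W, F.
  + by move=> W F lF; have [oW [_ sF] _] := lF; exact: order (frameP W F lF).
  by move=> W F [lF _]; have [oW [_ sF] _] := lF; eexists; exact: splitF (frameP W F lF).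
(* A local lift of a second solution splits as F_+ F_- by assumption, hence its value at t lies in
   [Phi t], and a coset is determined by any of its elements. *)
- move=> Phi' [[_ lift' order'] split']; apply/funext => t.
  have [W [F [Wt lF]]] := lift' t.
  have [Fm [[HFm _] FE]] := split' W F (conj lF (order' W F lF)).
  have [_ [HF _] PE] := lF; rewrite PE//; apply/esym/PhiE.
  by split; [exact: HF|exists (Fm t); [exact: HFm|have [] := FE t Wt]].
move=> t0 Fp1 W F Wt0 [lF oF]; have [oW [HF sF] PE] := lF.
have PF := frameP W F lF; have [_ Mt _] := sHt.
have [Mh hE _] := splitP _ _ (PF t0 Wt0).
(* As F_+(t0) = 1, the value F(t0) = F_-(t0) lies in both the fixed subgroup and the minus part, so
   it is a constant; right multiplication by its inverse bases the frame without changing its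
   coset. *)
have Hto0 : Hto (F t0).
  apply: (fixed_minus_const hG hH htau); first exact: HF.
  by rewrite hE Fp1 wmul1l -Fp1.
have [Hi f1 f2] := subgroup_winv sHto Hto0; have [[Hti _] _] := Hi.
pose F' t := wmul (F t) (winv (F t0)).
have sF' : smooth_map atlas W F'.
  exact: (smooth_map_wmul (F := F) (G := fun=> winv (F t0)) hU oW sF (smooth_map_cst hU _ oW)).
have PF' t : W t -> Phi t (F' t).
  by move=> Wt; rewrite (PhiE t (F t) (PF t Wt)); exists (winv (F t0)).
exists F', (fun t => wmul (winv (Fp t)) (F' t)); split.
- split; last exact: order.
  split=> //; first by split=> // t Wt; have [] := PF' t Wt.
  by move=> t Wt; apply: PhiE; exact: PF'.
- exact: splitF.
- exact: f1.
by rewrite Fp1 winv1 wmul1l; exact: f1.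
Qed.
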